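(* For any $K\geq 0$ and any integer $d\geq 1$ there exist constants $C,\alpha>0$ (depending only on $K$ and $d$) such that the following holds. Let $p\geq 1$ be an integer and $\phi\in L^2(\mathbb{B}_1,\mathbb{R}^p)$. Assume that $\mathcal{F}_\phi\cap\mathbb{B}_1\neq\emptyset$ and that for every ball $\mathbb{B}_{z,r}\subset\mathbb{B}_1$ there exists $\phi_{\mathbb{B}_{z,r}}\in L^2(\mathbb{B}_{z,r},\mathbb{R}^p)$ such that $$\int_{\mathbb{B}_{z,r}}|\phi-\phi_{\mathbb{B}_{z,r}}|^2\leq |\mathbb{B}_{z,r}\cap\{\phi=0\}|$$ and $$r\Vert \nabla \phi_{\mathbb{B}_{z,r}}\Vert_{L^\infty(\mathbb{B}_{z,\frac{r}{2}})}\leq K\left(\frac{1}{|\mathbb{B}_{z,r}|}\int_{\mathbb{B}_{z,r}}\left|\phi_{\mathbb{B}_{z,r}}-\frac{1}{|\mathbb{B}_{z,r}|}\int_{\mathbb{B}_{z,r}}\phi_{\mathbb{B}_{z,r}}\right|^2\right)^{\frac12}.$$ Then for almost every $z\in\mathbb{B}_{\frac12}$, $$|\phi(z)|\leq C\left(1+\mathrm{dist}(z,\mathcal{F}_\phi)^\alpha\Vert\phi\Vert_{L^2(\mathbb{B}_1)}\right).$$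
   Context: $\mathbb{B}_1$ is the unit ball of $\mathbb{R}^d$ centered at the origin, $\mathbb{B}_r=r\mathbb{B}_1$ and $\mathbb{B}_{z,r}=z+r\mathbb{B}_1$. $|A|$ denotes the Lebesgue measure of $A$. For a measurable $\phi:\mathbb{B}_1\to\mathbb{R}^p$, its boundary is $$\mathcal{F}_\phi=\left\{z\in\mathbb{B}_1:\ \forall r\in(0,1-|z|),\ |\mathbb{B}_{z,r}\cap\{\phi=0\}|\cdot|\mathbb{B}_{z,r}\cap\{\phi\neq0\}|>0\right\}.$$ The condition on $\nabla\phi_{\mathbb{B}_{z,r}}$ includes that the weak gradient of $\phi_{\mathbb{B}_{z,r}}$ on $\mathbb{B}_{z,r/2}$ exists and is essentially bounded. *)

(* Defs.v *)
From HB Require Import structures.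
From mathcomp Require Import all_boot all_order all_algebra.
From mathcomp Require Import all_classical all_reals all_analysis.

Set Implicit Arguments.
Unset Strict Implicit.
Unset Printing Implicit Defensive.

Import Order.TTheory GRing.Theory Num.Theory.
Import numFieldNormedType.Exports.

Local Open Scope classical_set_scope.
Local Open Scope ring_scope.

Definition matrix_display (d : measure_display) : measure_display.
Proof. exact: d. Qed.

(* Matrices carry the sigma-algebra generated by their entries; for a realType
   of entries this is the Borel sigma-algebra. *)
Section measurable_matrix.
Context (dT : measure_display) (T : measurableType dT) (m n : nat).

Definition entry_preimages : set (set 'M[T]_(m, n)) :=
  \bigcup_(ij : 'I_m * 'I_n)
    preimage_set_system setT (fun M : 'M[T]_(m, n) => M ij.1 ij.2) measurable.

Let matrix_set0 : <<s entry_preimages >> set0.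
Proof. exact: sigma_algebra0. Qed.

Let matrix_setC A : <<s entry_preimages >> A -> <<s entry_preimages >> (~` A).
Proof. exact: sigma_algebraC. Qed.

Let matrix_bigcup (F : (set 'M[T]_(m, n))^nat) :
  (forall i, <<s entry_preimages >> (F i)) ->
  <<s entry_preimages >> (\bigcup_i F i).
Proof. exact: sigma_algebra_bigcup. Qed.

HB.instance Definition _ := @isMeasurable.Build (matrix_display dT)
  'M[T]_(m, n) <<s entry_preimages >> matrix_set0 matrix_setC matrix_bigcup.

End measurable_matrix.

Lemma measurable_entry (dT : measure_display) (T : measurableType dT)
    (m n : nat) (i : 'I_m) (j : 'I_n) :
  measurable_fun setT (fun M : 'M[T]_(m, n) => M i j).
Proof.
move=> _ Y mY; rewrite setTI; apply: sub_sigma_algebra.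
by exists (i, j) => //; exists Y => //; rewrite setTI.
Qed.

Lemma measurable_fun_matrix (d0 dT : measure_display) (X : measurableType d0)
    (T : measurableType dT) (m n : nat) (f : X -> 'M[T]_(m, n)) :
  (forall i j, measurable_fun setT (fun x => f x i j)) ->
  measurable_fun setT f.
Proof.
move=> mf; apply: (@measurability _ _ _ _ _ _ (@entry_preimages _ T m n)) => //.
move=> _ [A [[i j] _ [B mB <-]]] <-.
rewrite !setTI; have := mf i j measurableT B mB.
by rewrite setTI.
Qed.

Section lebesgue_rV.
Context (R : realType).

Definition row_cons (n : nat) (xv : measurableTypeR R * 'rV[R]_n) :
  'rV[R]_n.+1 := row_mx (xv.1)%:M xv.2.

Definition row_uncons (n : nat) (w : 'rV[R]_n.+1) :
  measurableTypeR R * 'rV[R]_n := (w 0 0, rsubmx (w : 'rV[R]_(1 + n))).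

Lemma row_consK n : cancel (@row_cons n) (@row_uncons n).
Proof.
case=> x v; congr pair; last exact: row_mxKr.
rewrite /row_cons [LHS](_ : _ = row_mx x%:M v 0 (lshift n 0)); last first.
  by congr (row_mx _ _ _); exact/val_inj.
by rewrite row_mxEl mxE.
Qed.

Lemma measurable_row_cons n : measurable_fun setT (@row_cons n).
Proof.
apply: measurable_fun_matrix => i j; rewrite /row_cons.
have -> : j = unsplit (fintype.split (j : 'I_(1 + n))) by rewrite splitK.
case: fintype.split => k /=.
- rewrite (_ : (fun _ => _) = fst); first exact: measurable_fst.
  apply/funext => x; apply: etrans (row_mxEl _ _ _ _) _.
  by rewrite !ord1 mxE.
- rewrite (_ : (fun _ => _) = (fun v : 'rV[R]_n => v i k) \o snd).
    by apply: measurableT_comp => //; exact: measurable_entry.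
  by apply/funext => x; exact: row_mxEr.
Qed.

Lemma measurable_row_uncons n : measurable_fun setT (@row_uncons n).
Proof.
apply/measurable_fun_pair.
  exact: measurable_entry.
apply: measurable_fun_matrix => i j.
rewrite (_ : (fun _ => _) = (fun w : 'rV[R]_(1 + n) => w i (rshift 1 j))).
  exact: measurable_entry.
by apply/funext => w; rewrite mxE.
Qed.

Section step.
Context (n : nat) (mu : {sigma_finite_measure set 'rV[R]_n -> \bar R}).

Definition leb_step : set 'rV[R]_n.+1 -> \bar R :=
  pushforward (@lebesgue_measure R \x mu)%E (@row_cons n).

HB.instance Definition _ := Measure.copy leb_step
  (measure_function_pushforward__canonical__measure_function_Measure
    (@lebesgue_measure R \x mu)%E (@measurable_row_cons n)).

Let leb_step_sigma_finite : sigma_finite setT leb_step.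
Proof.
have /sigma_finiteP[F [FT ndF Foo]] := sigma_finiteT (@lebesgue_measure R).
have /sigma_finiteP[G [GT ndG Goo]] := sigma_finiteT mu.
exists (fun k => @row_uncons n @^-1` (F k `*` G k)).
  rewrite -preimage_bigcup [X in _ @^-1` X](_ : _ = setT) ?preimage_setT//.
  apply/seteqP; split=> // -[x v] _.
  have [i _ Fix] : (\bigcup_i F i) x by rewrite -FT.
  have [j _ Gjv] : (\bigcup_i G i) v by rewrite -GT.
  exists (maxn i j) => //; split => /=.
  - by move: x Fix; exact/subsetPset/ndF/leq_maxl.
  - by move: v Gjv; exact/subsetPset/ndG/leq_maxr.
move=> k; have [mF Fk] := Foo k; have [mG Gk] := Goo k; split.
  rewrite -[X in measurable X]setTI; apply: measurable_row_uncons => //.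
  exact: measurableX.
rewrite /leb_step /pushforward -comp_preimage.
rewrite (_ : _ \o _ = id); last by apply/funext; exact: row_consK.
by rewrite [ltLHS]product_measure1E// lte_mul_pinfty// ge0_fin_numE.
Qed.

HB.instance Definition _ :=
  Measure_isSigmaFinite.Build _ _ _ leb_step leb_step_sigma_finite.

End step.

(* Lebesgue measure on R^n, as the n-fold product of lebesgue_measure
   (characterized by its values on boxes, see leb_box). *)
Fixpoint leb (n : nat) : {sigma_finite_measure set 'rV[R]_n -> \bar R} :=
  if n is n'.+1 then leb_step (leb n') else \d_(0 : 'rV[R]_0).

End lebesgue_rV.

Lemma measurable_box (R : realType) (n : nat) (a b : 'I_n -> R) :
  measurable [set x : 'rV[R]_n | forall i, x 0 i \in `[a i, b i]].
Proof.
rewrite [X in measurable X](_ : _ =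
    \bigcap_(i : 'I_n) ((fun x : 'rV[R]_n => x 0 i) @^-1` `[a i, b i])).
  apply: fin_bigcap_measurable => [|i _]; first exact: finite_finset.
  rewrite -[X in measurable X]setTI.
  by apply: measurable_entry => //; exact: measurable_itv.
by apply/seteqP; split=> [x h i _|x h i]; exact: h.
Qed.

Lemma leb_box (R : realType) (n : nat) (a b : 'I_n -> R) :
  (forall i, a i <= b i) ->
  leb R n [set x | forall i, x 0 i \in `[a i, b i]] =
  (\prod_(i < n) (b i - a i))%:E.
Proof.
elim: n a b => [|n IHn] a b ab.
  by rewrite big_ord0 [LHS]diracE mem_set//= => -[].
rewrite big_ord_recl EFinM -IHn// [LHS]/= /leb_step /pushforward.
rewrite [X in (_ \x _)%E X](_ : _ = `[a ord0, b ord0]%classic `*`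
    [set v : 'rV[R]_n | forall i, v 0 i \in `[a (lift ord0 i), b (lift ord0 i)]]).
  rewrite product_measure1E; last 2 first.
  - exact: measurable_itv.
  - exact: measurable_box.
  congr (_ * _)%E; apply: etrans (lebesgue_measure_itv `[a ord0, b ord0]) _.
  rewrite /= lte_fin; case: ltP => // ba.
  by rewrite (@le_anti _ _ (a ord0) (b ord0)) ?subrr// ab ba.
have rc0 (xv : measurableTypeR R * 'rV[R]_n) : row_cons xv 0 ord0 = xv.1.
  by have /(congr1 fst) := row_consK xv.
have rcS (xv : measurableTypeR R * 'rV[R]_n) (i : 'I_n) :
    row_cons xv 0 (lift ord0 i) = xv.2 0 i.
  have -> : lift ord0 i = rshift 1 i :> 'I_(1 + n) by exact/val_inj.
  exact: row_mxEr.
apply/seteqP; split=> [xv /= h|xv [/= h0 hS] i /=].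
  split=> [|i]; first by have := h ord0; rewrite rc0.
  by have := h (lift ord0 i); rewrite rcS.
by case: (unliftP ord0 i) => [j|] ->; rewrite ?rc0 ?rcS.
Qed.

Section euclidean.
Context (R : realType).

(* The library norm on matrices is the sup norm; this is the Euclidean (on
   p x d matrices, Frobenius) norm. It induces the same topology. *)
Definition eucl_norm (m n : nat) (M : 'M[R]_(m, n)) : R :=
  Num.sqrt (\sum_i \sum_j M i j ^+ 2).

Definition eucl_ball (n : nat) (z : 'rV[R]_n) (r : R) : set 'rV[R]_n :=
  [set x | eucl_norm (x - z) < r].

Definition eucl_dist (n : nat) (z : 'rV[R]_n) (F : set 'rV[R]_n) : R :=
  inf [set eucl_norm (z - y) | y in F].

(* The extended norm of |f| in L^q(A); for q = +oo it is the essential supremum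
   of |f| on A, since the ambient measure is nonzero. *)
Definition LnormOn (d m n : nat) (q : \bar R) (A : set 'rV[R]_d)
    (f : 'rV[R]_d -> 'M[R]_(m, n)) : \bar R :=
  'N[leb R d]_q[EFin \o ((fun x => eucl_norm (f x)) \_ A)]%E.

(* Square-integrable functions on A, through Borel representatives; the values
   outside A are irrelevant. *)
Definition L2On (d m n : nat) (A : set 'rV[R]_d)
    (f : 'rV[R]_d -> 'M[R]_(m, n)) : Prop :=
  measurable_fun A f /\ (LnormOn 2%:E A f < +oo)%E.

Definition average (d p : nat) (A : set 'rV[R]_d) (f : 'rV[R]_d -> 'rV[R]_p) :
  'rV[R]_p :=
  \row_j ((fine (leb R d A))^-1 * \int[leb R d]_(x in A) f x 0 j).

Definition oscillation (d p : nat) (A : set 'rV[R]_d)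
    (f : 'rV[R]_d -> 'rV[R]_p) : R :=
  Num.sqrt ((fine (leb R d A))^-1 *
    \int[leb R d]_(x in A) eucl_norm (f x - average A f) ^+ 2).

Definition partial_deriv (d : nat) (i : 'I_d) (f : 'rV[R]_d -> R) : 'rV[R]_d -> R :=
  'D_(delta_mx 0 i) f.

Definition smooth (d : nat) (f : 'rV[R]_d -> R) : Prop :=
  forall s : seq 'I_d,
    continuous (foldr (@partial_deriv d) f s) /\
    forall i x, derivable (foldr (@partial_deriv d) f s) x (delta_mx 0 i).

Definition test_function (d : nat) (U : set 'rV[R]_d) (g : 'rV[R]_d -> R) :
  Prop :=
  let supp := closure [set x | g x != 0] in
  [/\ smooth g, compact supp & supp `<=` U].

Definition loc_integrable (d m n : nat) (U : set 'rV[R]_d)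
    (f : 'rV[R]_d -> 'M[R]_(m, n)) : Prop :=
  measurable_fun U f /\
  forall C : set 'rV[R]_d, compact C -> C `<=` U ->
    (\int[leb R d]_(x in C) (eucl_norm (f x))%:E < +oo)%E.

(* G j i is the weak i-th partial derivative of the j-th component of u. *)
Definition weak_gradient (d p : nat) (U : set 'rV[R]_d)
    (u : 'rV[R]_d -> 'rV[R]_p) (G : 'rV[R]_d -> 'M[R]_(p, d)) : Prop :=
  [/\ loc_integrable U u, loc_integrable U G &
    forall (g : 'rV[R]_d -> R) (j : 'I_p) (i : 'I_d), test_function U g ->
      \int[leb R d]_(x in U) (u x 0 j * partial_deriv i g x) =
      - \int[leb R d]_(x in U) (G x j i * g x)].

(* Balls are open: with the closed unit ball, its whole sphere would satisfy
   the condition vacuously. *)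
Definition zero_boundary (d p : nat) (phi : 'rV[R]_d -> 'rV[R]_p) :
  set 'rV[R]_d :=
  [set z | eucl_ball 0 1 z /\ forall r, 0 < r < 1 - eucl_norm z ->
    (0 < leb R d (eucl_ball z r `&` [set x | phi x = 0%R]) *
         leb R d (eucl_ball z r `&` [set x | phi x <> 0%R]))%E].

End euclidean.

(* Main.v *)
(* Write V(r) for the mean of |phi - m|^2 over a ball of radius r, with m the
   mean of phi on it, and e(r) <= 1 for the fraction of the ball where phi = 0.
   Comparing phi with its approximation and using the gradient bound through a
   Poincare estimate gives V(lambda r) <= V(r) / 8 + C e(r) for a small ratio
   lambda. Moreover e(r) |m|^2 <= V(r), since phi = 0 contributes |m|^2 to V.
   Hence, once |m| is much larger than 1 + sqrt V at some scale, the zeroth-order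
   term is absorbed, V decays geometrically at all smaller scales and the means
   stay close to m; applied at every center this forces phi <> 0 a.e. on a
   smaller ball, so that ball avoids the boundary. For x at distance less than
   tau from the boundary, |m| is therefore at most of order 1 + sqrt V at all
   scales above tau, where V has decayed to 1 + tau^alpha |phi|_2; below that
   scale the means no longer move, which bounds the means of |phi|^2 on all
   small balls around x. *)
From HB Require Import structures.
Require Import Defs.
From mathcomp Require Import all_boot all_order all_algebra.
From mathcomp Require Import all_classical all_reals all_analysis.
From mathcomp Require Import measurable_realfun ess_sup_inf ring lra.

Set Implicit Arguments.
Unset Strict Implicit.
Unset Printing Implicit Defensive.

Import Order.TTheory GRing.Theory Num.Theory numFieldNormedType.Exports.
Local Open Scope classical_set_scope.
Local Open Scope ring_scope.

(** The target is pointwise while the hypotheses control only L^2 means, so every estimate is proved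
    around each point of an open set and at every small scale; comparing integrals over dyadic cubes
    then gives almost everywhere bounds, at the price of a dimensional factor. The gradient enters
    only through test functions. Two bumps on nested boxes are compared by pairing the weak
    derivative with a primitive of their balanced difference; the resulting bound on box averages
    does not see the size of the inner box, so no mollification is used. As C must not depend on p,
    vectors are tested against rational directions rather than coordinate by coordinate. The 1/8 in
    the decay leaves room for a second V/8 coming from the absorbed zeroth-order term: V then drops
    by a factor 4 and its square root by 2, which fixes alpha by [ratio] to the power alpha being
    1/2. The distance to the boundary varies with the point, whereas only countably many null sets
    can be joined; hence neighbourhoods of the boundary of rational radius tau are treated first. *)

Section eucl_norm.
Context (R : realType).

(** * Euclidean norm of vectors and matrices *)

Lemma sum_cauchy_schwarz (I : finType) (a b : I -> R) :
  (\sum_i a i * b i) ^+ 2 <= (\sum_i a i ^+ 2) * (\sum_i b i ^+ 2).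
Proof.
have : 0 <= \sum_i \sum_j (a i * b j - a j * b i) ^+ 2.
  by apply: sumr_ge0 => i _; apply: sumr_ge0 => j _; exact: sqr_ge0.
have -> : \sum_i \sum_j (a i * b j - a j * b i) ^+ 2 =
    2 * ((\sum_i a i ^+ 2) * (\sum_i b i ^+ 2) - (\sum_i a i * b i) ^+ 2).
  have -> : 2 * ((\sum_i a i ^+ 2) * (\sum_i b i ^+ 2) - (\sum_i a i * b i) ^+ 2)
     = (\sum_i a i ^+ 2) * (\sum_i b i ^+ 2) + (\sum_i b i ^+ 2) * (\sum_i a i ^+ 2)
       - 2 * ((\sum_i a i * b i) * (\sum_i a i * b i)) by ring.
  rewrite !big_distrlr/= mulr_sumr -sumrN -!big_split/=; apply: eq_bigr => i _.
  rewrite mulr_sumr -sumrN -!big_split/=; apply: eq_bigr => j _; ring.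
by rewrite pmulr_rge0// subr_ge0.
Qed.

Lemma eucl_norm_ge0 m n (M : 'M[R]_(m, n)) : 0 <= eucl_norm M.
Proof. exact: sqrtr_ge0. Qed.

Lemma sqr_eucl_norm m n (M : 'M[R]_(m, n)) :
  eucl_norm M ^+ 2 = \sum_i \sum_j M i j ^+ 2.
Proof.
rewrite sqr_sqrtr//; apply: sumr_ge0 => i _; apply: sumr_ge0 => j _.
exact: sqr_ge0.
Qed.

Lemma sqr_eucl_norm_row n (v : 'rV[R]_n) :
  eucl_norm v ^+ 2 = \sum_j v 0 j ^+ 2.
Proof. by rewrite sqr_eucl_norm big_ord1. Qed.

Lemma eucl_norm_coord m n (M : 'M[R]_(m, n)) i j : `|M i j| <= eucl_norm M.
Proof.
rewrite -(@ler_pXn2r _ 2)// ?nnegrE// ?eucl_norm_ge0// sqr_eucl_norm.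
rewrite real_normK ?num_real// (bigD1 i)//= (bigD1 j)//= -addrA lerDl addr_ge0//.
  by apply: sumr_ge0 => k _; exact: sqr_ge0.
by apply: sumr_ge0 => k _; apply: sumr_ge0 => l _; exact: sqr_ge0.
Qed.

Lemma eucl_normN m n (M : 'M[R]_(m, n)) : eucl_norm (- M) = eucl_norm M.
Proof.
congr Num.sqrt; apply: eq_bigr => i _; apply: eq_bigr => j _.
by rewrite mxE sqrrN.
Qed.

Lemma eucl_normBC m n (M N : 'M[R]_(m, n)) : eucl_norm (M - N) = eucl_norm (N - M).
Proof. by rewrite -eucl_normN opprB. Qed.

Lemma eucl_norm0 m n : eucl_norm (0 : 'M[R]_(m, n)) = 0.
Proof.
apply/eqP; rewrite sqrtr_eq0 le_eqVlt big1 ?eqxx// => i _.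
by rewrite big1// => j _; rewrite mxE expr0n.
Qed.

Lemma eucl_norm_eq0 m n (M : 'M[R]_(m, n)) : eucl_norm M = 0 -> M = 0.
Proof.
move=> M0; apply/matrixP => i j; rewrite mxE; apply/normr0_eq0/eqP.
by rewrite eq_le normr_ge0 -M0 eucl_norm_coord.
Qed.

Lemma dot_le n (v w : 'rV[R]_n) :
  \sum_j v 0 j * w 0 j <= eucl_norm v * eucl_norm w.
Proof.
apply: (le_trans (ler_norm _)).
rewrite -(@ler_pXn2r _ 2)// ?nnegrE// ?mulr_ge0 ?eucl_norm_ge0//.
rewrite exprMn !sqr_eucl_norm_row real_normK ?num_real//.
exact: sum_cauchy_schwarz.
Qed.

Lemma dot_col_le m n (v : 'rV[R]_m) (G : 'M[R]_(m, n)) i :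
  `|\sum_j v 0 j * G j i| <= eucl_norm v * eucl_norm G.
Proof.
rewrite -(@ler_pXn2r _ 2)// ?nnegrE// ?mulr_ge0 ?eucl_norm_ge0//.
rewrite exprMn sqr_eucl_norm_row sqr_eucl_norm real_normK ?num_real//.
apply: (le_trans (sum_cauchy_schwarz _ _)).
rewrite ler_wpM2l//; first by apply: sumr_ge0 => j _; exact: sqr_ge0.
apply: ler_sum => j _; rewrite (bigD1 i)//= lerDl.
by apply: sumr_ge0 => k _; exact: sqr_ge0.
Qed.

Lemma ler_eucl_normD n (v w : 'rV[R]_n) :
  eucl_norm (v + w) <= eucl_norm v + eucl_norm w.
Proof.
rewrite -(@ler_pXn2r _ 2)// ?nnegrE// ?addr_ge0 ?eucl_norm_ge0//.
have -> : eucl_norm (v + w) ^+ 2 =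
    eucl_norm v ^+ 2 + (\sum_j v 0 j * w 0 j) *+ 2 + eucl_norm w ^+ 2.
  rewrite !sqr_eucl_norm_row -sumrMnl -!big_split/=; apply: eq_bigr => j _.
  by rewrite mxE sqrrD.
by rewrite sqrrD lerD2r lerD2l lerMn2r/= dot_le.
Qed.

Lemma ler_eucl_distD n (u v w : 'rV[R]_n) :
  eucl_norm (v - w) <= eucl_norm (v - u) + eucl_norm (u - w).
Proof. by rewrite (le_trans _ (ler_eucl_normD _ _))// addrA subrK. Qed.

Lemma sqr_eucl_normD_le n (v w : 'rV[R]_n) :
  eucl_norm (v + w) ^+ 2 <= 2 * eucl_norm v ^+ 2 + 2 * eucl_norm w ^+ 2.
Proof.
apply: (@le_trans _ _ ((eucl_norm v + eucl_norm w) ^+ 2)).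
  by rewrite ler_pXn2r ?nnegrE ?addr_ge0 ?eucl_norm_ge0// ler_eucl_normD.
have := sqr_ge0 (eucl_norm v - eucl_norm w); nra.
Qed.

(** The crude factor [n], in place of its square root, is the origin of the condition [n * s < r]
    under which a cube of half-side [s] fits in a ball of radius [r]. *)
Lemma eucl_norm_le_coord n (v : 'rV[R]_n) s : 0 <= s ->
  (forall i, `|v 0 i| <= s) -> eucl_norm v <= n%:R * s.
Proof.
move=> s0 vs; rewrite -(@ler_pXn2r _ 2)// ?nnegrE ?mulr_ge0 ?eucl_norm_ge0//.
rewrite sqr_eucl_norm_row (@le_trans _ _ (\sum_(j < n) s ^+ 2))//.
  apply: ler_sum => j _; rewrite -[leLHS]real_normK ?num_real//.
  by rewrite ler_pXn2r ?nnegrE.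
rewrite sumr_const card_ord exprMn -[_ *+ _]mulr_natl ler_wpM2r ?sqr_ge0//.
by rewrite -natrX ler_nat; case: n {v vs} => // n; rewrite leq_pmull.
Qed.

Lemma sub_eucl_ball n (z y : 'rV[R]_n) r s :
  eucl_norm (y - z) + s <= r -> eucl_ball y s `<=` eucl_ball z r.
Proof.
move=> yzsr x /= xy; rewrite /eucl_ball/=.
have := ler_eucl_distD y x z; rewrite /eucl_ball/= in xy; lra.
Qed.

End eucl_norm.

(** Turns inequalities between integrals into inequalities between measures, the form in which a
    monotone class argument applies. *)
Lemma exists_density_measure d (T : measurableType d) (R : realType)
    (mu : {measure set T -> \bar R}) (f : T -> \bar R) :
  measurable_fun setT f -> (forall x, 0 <= f x)%E ->
  exists nu : {measure set T -> \bar R},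
    forall A, nu A = (\int[mu]_(x in A) f x)%E.
Proof.
move=> mf f0; pose m A := (\int[mu]_(x in A) f x)%E.
have m0 : m set0 = 0%E by rewrite /m integral_set0.
have mge0 A : (0 <= m A)%E by apply: integral_ge0.
have msa : semi_sigma_additive m.
  move=> F mF tF mUF; rewrite /m ge0_integral_bigcup//; last first.
    exact: measurable_funTS.
  by apply: is_cvg_ereal_nneg_natsum_cond => n _ _; exact: integral_ge0.
pose b := isMeasure.Build _ _ _ m m0 mge0 msa.
pose M : {measure set T -> \bar R} := HB.pack m b.
by exists M.
Qed.

(** * Dyadic cubes and almost everywhere comparison of functions *)

Section dyadic.
Context (R : realType) (n : nat).
Implicit Types (x y : 'rV[R]_n) (N : nat) (D : set 'rV[R]_n).

Definition dyadic N x : 'rV[int]_n := \row_i Num.floor (2 ^+ N * x 0 i).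

Definition dyadic_cube N x : set 'rV[R]_n := [set y | dyadic N x = dyadic N y].

Definition dyadic_set N D := forall x y, dyadic N x = dyadic N y -> D x -> D y.

(** The integer part of [2 * u] determines that of [u], so each level refines the previous one. *)
Lemma dyadic_coarser N N' x y : (N <= N')%N ->
  dyadic N' x = dyadic N' y -> dyadic N x = dyadic N y.
Proof.
move=> /subnK <-; elim: (N' - N)%N => // k IH h; apply: IH; apply/rowP => i.
have /rowP/(_ i) := h; rewrite addSn !mxE.
set a := 2 ^+ (k + N) * x 0 i; set b := 2 ^+ (k + N) * y 0 i.
have -> : 2 ^+ (k + N).+1 * x 0 i = 2 * a by rewrite exprS mulrA.
have -> : 2 ^+ (k + N).+1 * y 0 i = 2 * b by rewrite exprS mulrA.
have half (u v : R) : Num.floor (2 * u) = Num.floor (2 * v) ->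
    Num.floor u <= Num.floor v.
  move=> uv; have : 2 * Num.floor u <= Num.floor (2 * u).
    by rewrite floor_ge_int intrM ler_pM2l// floor_le_tmp.
  by rewrite uv !floor_ge_int intrM ler_pM2l.
by move=> h'; apply/eqP; rewrite eq_le !half.
Qed.

Lemma dyadic_set_finer N N' D : (N <= N')%N -> dyadic_set N D -> dyadic_set N' D.
Proof. by move=> NN' hD x y /(dyadic_coarser NN'); exact: hD. Qed.

Lemma measurable_dyadic_cube N x : measurable (dyadic_cube N x).
Proof.
rewrite (_ : dyadic_cube N x = \bigcap_(i : 'I_n) ((fun y : 'rV[R]_n => y 0 i) @^-1`
    `[(Num.floor (2 ^+ N * x 0 i))%:~R / 2 ^+ N,
      (Num.floor (2 ^+ N * x 0 i) + 1)%:~R / 2 ^+ N[)).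
  apply: fin_bigcap_measurable => [|i _]; first exact: finite_finset.
  rewrite -[X in measurable X]setTI.
  by apply: measurable_entry => //; exact: measurable_itv.
have key (y : 'rV[R]_n) i : (y 0 i \in `[(Num.floor (2 ^+ N * x 0 i))%:~R / 2 ^+ N,
      (Num.floor (2 ^+ N * x 0 i) + 1)%:~R / 2 ^+ N[) =
      (Num.floor (2 ^+ N * y 0 i) == Num.floor (2 ^+ N * x 0 i)).
  by rewrite floor_eq in_itv/= ler_pdivrMr ?exprn_gt0// ltr_pdivlMr ?exprn_gt0// [y 0 i * _]mulrC.
apply/seteqP; split=> [y /rowP h i _|y h].
  by rewrite /= key; have := h i; rewrite !mxE => ->.
by apply/rowP => i; have := h i I; rewrite /= key !mxE => /eqP ->.
Qed.

(** [choice.pickle] numbers the cubes of level [N], which makes the decomposition of a dyadic set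
    countable; a number taken by no cube of [D] gives the empty piece. *)
Definition dyadic_piece N D (m : nat) : set 'rV[R]_n :=
  [set x | D x /\ choice.pickle (dyadic N x) = m].

Lemma dyadic_pieceP N D m : dyadic_set N D ->
  dyadic_piece N D m = set0 \/
  exists2 x, D x & dyadic_piece N D m = dyadic_cube N x.
Proof.
move=> DN; have [->|/set0P[x [Dx xm]]] := eqVneq (dyadic_piece N D m) set0.
  by left.
right; exists x => //; apply/seteqP; split=> [y [Dy ym]|y xy].
  by apply: (pcan_inj choice.pickleK); rewrite ym.
by split; [exact: DN xy Dx|rewrite -xy].
Qed.

Lemma bigcup_dyadic_piece N D : \bigcup_m dyadic_piece N D m = D.
Proof.
apply/seteqP; split=> [x [m _ []//]|x Dx].
by exists (choice.pickle (dyadic N x)).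
Qed.

Lemma trivIset_dyadic_piece N D : trivIset setT (dyadic_piece N D).
Proof. by move=> i j _ _ [x [[_ <-] [_ <-]]]. Qed.

Lemma measurable_dyadic_piece N D m : dyadic_set N D ->
  measurable (dyadic_piece N D m).
Proof.
by move=> /(@dyadic_pieceP _ _ m)[->//|[x _ ->]]; exact: measurable_dyadic_cube.
Qed.

Lemma measurable_dyadic_set N D : dyadic_set N D -> measurable D.
Proof.
move=> DN; rewrite -(bigcup_dyadic_piece N D).
by apply: bigcup_measurable => k _; exact: measurable_dyadic_piece.
Qed.

Lemma dyadic_set_le (m1 m2 : {measure set 'rV[R]_n -> \bar R}) N D :
  dyadic_set N D ->
  (forall x, D x -> m1 (dyadic_cube N x) <= m2 (dyadic_cube N x))%E ->
  (m1 D <= m2 D)%E.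
Proof.
move=> DN m12; rewrite -(bigcup_dyadic_piece N D).
have mp i : [set: nat] i -> measurable (dyadic_piece N D i).
  by move=> _; exact: measurable_dyadic_piece.
have tp := @trivIset_dyadic_piece N D.
rewrite (measure_bigcup m1 _ _ mp tp) (measure_bigcup m2 _ _ mp tp).
apply: lee_nneseries => // m _.
by have [->|[x Dx ->]] := @dyadic_pieceP _ _ m DN; [rewrite !measure0|exact: m12].
Qed.

Lemma dyadic_cube_diam N x y : dyadic_cube N x y ->
  eucl_norm (y - x) <= n%:R * 2 ^- N.
Proof.
move=> xy; apply: eucl_norm_le_coord; first by rewrite invr_ge0 exprn_ge0.
move=> i; rewrite !mxE -(@ler_pM2l _ (2 ^+ N)) ?exprn_gt0// divff ?expf_neq0//.
rewrite -[X in X * `|_|]gtr0_norm ?exprn_gt0// -normrM mulrBr.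
have /rowP/(_ i) := xy; rewrite !mxE => fxy.
have := floor_itv (2 ^+ N * x 0 i); have := floor_itv (2 ^+ N * y 0 i).
rewrite -fxy intrD => /andP[a b] /andP[c e]; rewrite ler_norml; apply/andP; split; lra.
Qed.

Lemma half_expn_small (e : R) : 0 < e -> exists N0, forall N, (N0 <= N)%N -> 2 ^- N < e.
Proof.
move=> e0; exists (Num.trunc e^-1).+1 => N hN.
have lt2 : forall k, k%:R < 2 ^+ k :> R.
  by move=> k; rewrite -natrX ltr_nat ltn_expl.
rewrite -[e]invrK ltf_pV2 ?posrE ?exprn_gt0 ?invr_gt0//.
apply: lt_trans (lt2 N); apply: (lt_le_trans (truncnS_gt _)); by rewrite ler_nat.
Qed.

Lemma dyadic_cube_small x (e : R) : 0 < e ->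
  exists N0, forall N y, (N0 <= N)%N -> dyadic_cube N x y -> eucl_norm (y - x) < e.
Proof.
move=> e0; have n0 : 0 < n%:R + 1 :> R by rewrite ltr_wpDl.
have [N0 hN0] := half_expn_small (divr_gt0 e0 n0).
exists N0 => N y /hN0 hN /dyadic_cube_diam/le_lt_trans; apply.
move: hN; rewrite ltr_pdivlMr// mulrC; apply: le_lt_trans.
by rewrite ler_pM2r ?invr_gt0 ?exprn_gt0// lerDl.
Qed.

Definition dyadic_sets : set (set 'rV[R]_n) := [set D | exists N, dyadic_set N D].

Lemma setring_dyadic_sets : setring dyadic_sets.
Proof.
have common A B : dyadic_sets A -> dyadic_sets B ->
    exists N, dyadic_set N A /\ dyadic_set N B.
  move=> [N hN] [M hM]; exists (maxn N M); split.
    exact: dyadic_set_finer (leq_maxl _ _) hN.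
  exact: dyadic_set_finer (leq_maxr _ _) hM.
split; first by exists 0%N.
  move=> A B dA /(common _ _ dA)[N [hA hB]]; exists N => x y xy [Ax|Bx].
    by left; exact: hA xy Ax.
  by right; exact: hB xy Bx.
move=> A B dA /(common _ _ dA)[N [hA hB]]; exists N => x y xy [Ax nBx]; split.
  exact: hA xy Ax.
by move=> By; apply: nBx; exact: hB (esym xy) By.
Qed.

Lemma sigma_algebra_dyadic : sigma_algebra setT <<sr dyadic_sets>>.
Proof.
have [S0 SD SU] := @smallest_sigma_ring _ dyadic_sets.
split=> // A SA; apply: SD => //; apply: sub_g_sigma_ring.
by exists 0%N.
Qed.

Lemma dyadic_coord_gt (i : 'I_n) (c : R) :
  <<sr dyadic_sets>> [set x : 'rV[R]_n | c < x 0 i].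
Proof.
have [S0 SD SU] := @smallest_sigma_ring _ dyadic_sets.
(* A coordinate exceeds [c] exactly when, at some level, the lower face of the cube of the point
   does. *)
rewrite (_ : [set _ | _] = \bigcup_N
   [set x : 'rV[R]_n | 2 ^+ N * c < (Num.floor (2 ^+ N * x 0 i))%:~R]).
  apply: SU => N; apply: sub_g_sigma_ring; exists N => x y /rowP/(_ i).
  by rewrite !mxE /= => ->.
apply/seteqP; split=> [x /= cx|x [N _ /= h]]; last first.
  rewrite -(@ltr_pM2l _ (2 ^+ N)) ?exprn_gt0//.
  exact: lt_le_trans (floor_le_tmp _).
have cx0 : 0 < x 0 i - c by rewrite subr_gt0.
have [N0 hN0] := half_expn_small cx0.
have h := hN0 _ (leqnn N0); exists N0 => //=; have := floor_itv (2 ^+ N0 * x 0 i) => /andP[_].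
rewrite intrD; have : 1 < 2 ^+ N0 * (x 0 i - c).
  by rewrite -ltr_pdivrMl ?exprn_gt0// mulr1.
by rewrite mulrBr; lra.
Qed.

(** Open rays generate the Borel sets of the line, so it is enough to reach their preimages under
    the coordinates, which [dyadic_coord_gt] provides. *)
Lemma measurable_sub_dyadic (A : set 'rV[R]_n) : measurable A ->
  <<sr dyadic_sets>> A.
Proof.
have [S0 SD SU] := sigma_algebra_dyadic.
suff : <<s @entry_preimages _ (measurableTypeR R) 1 n >> `<=` <<sr dyadic_sets>>.
  by apply.
apply: smallest_sub; first exact: sigma_algebra_dyadic.
move=> _ [[i j] _ [B mB <-]]; rewrite setTI ord1/=; move: mB.
rewrite RGenOInfty.measurableE.
move: B; apply: smallest_sub => /=.
  split => /=.
  - by rewrite preimage_set0.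
  - by move=> B SB; rewrite setTD preimage_setC -setTD; exact: SD.
  - by move=> F SF; rewrite preimage_bigcup; exact: SU.
move=> _ [c ->] /=; rewrite (_ : _ @^-1` _ = [set x : 'rV[R]_n | c < x 0 j]).
  exact: dyadic_coord_gt.
by apply/seteqP; split=> x; rewrite /= in_itv/= andbT.
Qed.

(** Monotone class argument. The sets satisfying the inequality within [W] are stable under monotone
    limits, the decreasing ones because both measures are finite, and they include the dyadic sets,
    since cubes of a level beyond [N0] tile their intersection with [W]. *)
Lemma dyadic_measure_le_in (m1 m2 : {measure set 'rV[R]_n -> \bar R}) N0 W :
  (m1 setT < +oo)%E -> (m2 setT < +oo)%E -> dyadic_set N0 W ->
  (forall N x, (N0 <= N)%N -> W x ->
    m1 (dyadic_cube N x) <= m2 (dyadic_cube N x))%E ->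
  forall E, measurable E -> (m1 (E `&` W) <= m2 (E `&` W))%E.
Proof.
move=> m1oo m2oo W0 m12.
have mW := measurable_dyadic_set W0.
pose C := [set E | measurable E /\ (m1 (E `&` W) <= m2 (E `&` W))%E].
suff : <<sr dyadic_sets>> `<=` C.
  by move=> h E /measurable_sub_dyadic/h[].
apply: monotone_setring_sub_g_sigma_ring; last 2 first.
- exact: setring_dyadic_sets.
- move=> D [N DN]; split; first exact: measurable_dyadic_set DN.
  apply: (@dyadic_set_le _ _ (maxn N0 N)).
    move=> x y xy [Dx Wx]; split.
      exact: dyadic_set_finer (leq_maxr _ _) DN _ _ xy Dx.
    exact: dyadic_set_finer (leq_maxl _ _) W0 _ _ xy Wx.
  by move=> x [_ Wx]; apply: m12 => //; exact: leq_maxl.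
split=> F monF CF.
- have mF i : measurable (F i) by have [] := CF i.
  split; first exact: bigcup_measurable.
  rewrite setI_bigcupl.
  have mFW i : measurable (F i `&` W) by exact: measurableI.
  have mUFW : measurable (\bigcup_i (F i `&` W)) by exact: bigcup_measurable.
  have ndFW : nondecreasing_seq (fun i => F i `&` W).
    by move=> i j ij; apply/subsetPset; apply: setSI; exact/subsetPset/monF.
  have c1 := @nondecreasing_cvg_mu _ _ _ m1 _ mFW mUFW ndFW.
  have c2 := @nondecreasing_cvg_mu _ _ _ m2 _ mFW mUFW ndFW.
  rewrite -(cvg_lim _ c1)// -(cvg_lim _ c2)//.
  apply: lee_lim; [by apply/cvg_ex; eexists; exact: c1|
    by apply/cvg_ex; eexists; exact: c2|].
  by near=> i; have [] := CF i.
- have mF i : measurable (F i) by have [] := CF i.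
  split; first exact: bigcapT_measurable.
  rewrite -bigcapIl//.
  have mFW i : measurable (F i `&` W) by exact: measurableI.
  have mUFW : measurable (\bigcap_i (F i `&` W)) by exact: bigcapT_measurable.
  have ndFW : nonincreasing_seq (fun i => F i `&` W).
    by move=> i j ij; apply/subsetPset; apply: setSI; exact/subsetPset/monF.
  have fin (m : {measure set 'rV[R]_n -> \bar R}) : (m setT < +oo -> m (F 0%N `&` W) < +oo)%E.
    by apply: le_lt_trans; rewrite le_measure ?inE.
  have c1 := @nonincreasing_cvg_mu _ _ _ m1 _ (fin _ m1oo) mFW mUFW ndFW.
  have c2 := @nonincreasing_cvg_mu _ _ _ m2 _ (fin _ m2oo) mFW mUFW ndFW.
  rewrite -(cvg_lim _ c1)// -(cvg_lim _ c2)//.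
  apply: lee_lim; [by apply/cvg_ex; eexists; exact: c1|
    by apply/cvg_ex; eexists; exact: c2|].
  by near=> i; have [] := CF i.
Unshelve. all: by end_near. Qed.

Definition dyadic_interior N (V : set 'rV[R]_n) : set 'rV[R]_n :=
  [set x | dyadic_cube N x `<=` V].

Lemma dyadic_interior_set N V : dyadic_set N (dyadic_interior N V).
Proof. by move=> x y xy h z yz; apply: h; rewrite /dyadic_cube/= xy. Qed.

(** Openness is phrased directly with Euclidean balls, since the library topology on matrices comes
    from the sup norm; [open_eucl_open] makes the link. *)
Definition eucl_open (V : set 'rV[R]_n) : Prop :=
  forall x, V x -> exists2 e, 0 < e & eucl_ball x e `<=` V.

Lemma eucl_open_dyadic V : eucl_open V -> V = \bigcup_N dyadic_interior N V.
Proof.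
move=> oV; apply/seteqP; split=> [x Vx|x [N _]]; last by apply.
have [e e0 xeV] := oV _ Vx; have [N hN] := dyadic_cube_small x e0.
by exists N => // y xy; apply: xeV; exact: hN xy.
Qed.

Lemma measurable_eucl_open V : eucl_open V -> measurable V.
Proof.
move=> /eucl_open_dyadic ->; apply: bigcup_measurable => N _.
exact: measurable_dyadic_set (@dyadic_interior_set N V).
Qed.

Lemma eucl_open_ball (z : 'rV[R]_n) r : eucl_open (eucl_ball z r).
Proof.
move=> x xz; exists (r - eucl_norm (x - z)); first by rewrite subr_gt0.
by apply: sub_eucl_ball; rewrite addrC subrK.
Qed.

Lemma measurable_eucl_ball (z : 'rV[R]_n) r : measurable (eucl_ball z r).
Proof. by apply: measurable_eucl_open; exact: eucl_open_ball. Qed.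

(* A substitute for Lebesgue's differentiation theorem, which would need a
   covering theorem in dimension n. *)
Lemma ae_le_of_dyadic_cubes (mu : {measure set 'rV[R]_n -> \bar R})
    (V : set 'rV[R]_n) (f g : 'rV[R]_n -> R) N0 : eucl_open V ->
  measurable_fun V f -> measurable_fun V g ->
  (forall x, V x -> 0 <= f x) -> (forall x, V x -> 0 <= g x) ->
  (\int[mu]_(x in V) (f x)%:E < +oo)%E -> (\int[mu]_(x in V) (g x)%:E < +oo)%E ->
  (forall N x, (N0 <= N)%N -> dyadic_cube N x `<=` V ->
    \int[mu]_(y in dyadic_cube N x) (f y)%:E <=
    \int[mu]_(y in dyadic_cube N x) (g y)%:E)%E ->
  {ae mu, forall x, V x -> f x <= g x}.
Proof.
move=> oV mf mg f0 g0 ioof ioog fg.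
have mV := measurable_eucl_open oV.
have mfV : measurable_fun setT ((EFin \o f) \_ V).
  by apply/(measurable_restrictT _ mV)/measurable_EFinP.
have mgV : measurable_fun setT ((EFin \o g) \_ V).
  by apply/(measurable_restrictT _ mV)/measurable_EFinP.
have fV0 x : (0 <= ((EFin \o f) \_ V) x)%E.
  by apply: erestrict_ge0 => y Vy; rewrite /= lee_fin f0.
have gV0 x : (0 <= ((EFin \o g) \_ V) x)%E.
  by apply: erestrict_ge0 => y Vy; rewrite /= lee_fin g0.
have [m1 m1E] := exists_density_measure mu mfV fV0.
have [m2 m2E] := exists_density_measure mu mgV gV0.
have restrE (h : 'rV[R]_n -> R) (D : set 'rV[R]_n) : D `<=` V ->
    (\int[mu]_(x in D) ((EFin \o h) \_ V) x = \int[mu]_(x in D) (h x)%:E)%E.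
  by move=> DV; apply: eq_integral => x /[!inE] Dx; rewrite patchE mem_set//; exact: DV.
have m1oo : (m1 setT < +oo)%E by rewrite m1E -integral_mkcond.
have m2oo : (m2 setT < +oo)%E by rewrite m2E -integral_mkcond.
pose B := [set x | V x /\ g x < f x].
have mB : measurable B.
  rewrite (_ : B = V `&` (fun x => g x < f x) @^-1` [set true]); last first.
    by apply/seteqP; split.
  by apply: measurable_fun_ltr.
have mBN N : measurable (B `&` dyadic_interior (N0 + N) V).
  by apply: measurableI => //; exact: measurable_dyadic_set (@dyadic_interior_set _ _).
(* The bad set is cut by dyadic interiors because the comparison holds only for cubes inside [V] of
   level at least [N0]. On each piece [f - g] is positive but its integral is not, so the piece is
   null. *)
have B0 N : mu (B `&` dyadic_interior (N0 + N) V) = 0%E.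
  set E := B `&` _; have EV : E `<=` V by move=> x [[]].
  have : (m1 E <= m2 E)%E.
    apply: dyadic_measure_le_in m1oo m2oo (@dyadic_interior_set _ _) _ _ mB => M x NM xV.
    have cV : dyadic_cube M x `<=` V.
      move=> y xy; apply: xV; exact: dyadic_coarser NM xy.
    by rewrite m1E m2E !restrE//; apply: fg => //; exact: leq_trans (leq_addr _ _) NM.
  rewrite m1E m2E !restrE//.
  have mfE : measurable_fun E f by exact: measurable_funS mf.
  have mgE : measurable_fun E g by exact: measurable_funS mg.
  have mE : measurable E by exact: mBN.
  have fE : (\int[mu]_(x in E) (f x)%:E =
      \int[mu]_(x in E) (g x)%:E + \int[mu]_(x in E) (f x - g x)%:E)%E.
    rewrite -ge0_integralD//.
    - by apply: eq_integral => x _; rewrite -EFinD addrC subrK.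
    - by move=> x /EV Vx; rewrite lee_fin g0.
    - exact/measurable_EFinP.
    - by move=> x [[Vx gf] _]; rewrite lee_fin subr_ge0 ltW.
    - by apply/measurable_EFinP; exact: measurable_funB.
  have goo : (\int[mu]_(x in E) (g x)%:E < +oo)%E.
    apply: le_lt_trans ioog; apply: ge0_subset_integral => //.
    exact/measurable_EFinP.
  rewrite fE => h.
  have h0 : (\int[mu]_(x in E) (f x - g x)%:E = 0)%E.
    apply/eqP; rewrite eq_le; apply/andP; split; last first.
      by apply: integral_ge0 => x [[Vx gf] _]; rewrite lee_fin subr_ge0 ltW.
    move: h; rewrite -[leRHS]adde0 leeD2lE// ge0_fin_numE//.
    by apply: integral_ge0 => x /EV Vx; rewrite lee_fin g0.
  have [|] := @ae_eq_integral_abs _ _ _ mu E mE (EFin \o (fun x => f x - g x)).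
    by apply/measurable_EFinP; exact: measurable_funB.
  move=> + _; rewrite [X in X = _ -> _](_ : _ = 0%E); last first.
    rewrite -[RHS]h0; apply: eq_integral => x /[!inE] -[[Vx gf] _] /=.
    by rewrite ger0_norm// subr_ge0 ltW.
  move=> /(_ erefl) [A [mA A0 EA]].
  apply/eqP; rewrite eq_le measure_ge0 andbT -A0 le_measure ?inE//.
  move=> x Ex; apply: EA => /(_ Ex) /= [/eqP]; rewrite subr_eq0 => /eqP fgx.
  by have [[_]] := Ex; rewrite fgx ltxx.
have : mu.-negligible (\bigcup_N (B `&` dyadic_interior (N0 + N) V)).
  by apply: negligible_bigcup => N; apply/negligibleP; [exact: mBN|exact: B0].
apply: negligibleS => x /= /not_implyP[Vx /negP]; rewrite -ltNge => gf.
have : (\bigcup_N dyadic_interior N V) x by rewrite -eucl_open_dyadic.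
move=> [N _ VN]; exists N => //; split=> // y xy; apply: VN.
exact: dyadic_coarser (leq_addl _ _) xy.
Qed.

End dyadic.

(** * Boxes, volumes of balls, and pointwise bounds from ball means *)

Section boxes.
Context (R : realType) (n : nat).
Implicit Types (a b : 'I_n -> R) (z : 'rV[R]_n).

Definition closed_box a b : set 'rV[R]_n := [set x | forall i, x 0 i \in `[a i, b i]].
Definition open_box a b : set 'rV[R]_n := [set x | forall i, x 0 i \in `]a i, b i[].

Lemma measurable_closed_box a b : measurable (closed_box a b).
Proof. exact: measurable_box. Qed.

Lemma measurable_hyperplane (i : 'I_n) (c : R) :
  measurable [set x : 'rV[R]_n | x 0 i = c].
Proof.
rewrite (_ : [set _ | _] = setT `&` (fun x : 'rV[R]_n => x 0 i) @^-1` [set c]).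
  by apply: measurable_entry => //; exact: measurable_set1.
by rewrite setTI.
Qed.

(** Countably many boxes whose side in direction [i] degenerates to a point cover the hyperplane. *)
Lemma leb_hyperplane (i : 'I_n) (c : R) : leb R n [set x | x 0 i = c] = 0%E.
Proof.
pose B (k : nat) := closed_box (fun j => if j == i then c else - k%:R)
  (fun j => if j == i then c else k%:R).
have HB : [set x : 'rV[R]_n | x 0 i = c] `<=` \bigcup_k B k.
  move=> x /= xc; exists (Num.trunc (\sum_j `|x 0 j|)).+1 => // j.
  case: eqVneq => [->|_]; first by rewrite xc in_itv/= lexx.
  rewrite in_itv/= -ler_norml; apply/ltW.
  apply: le_lt_trans (truncnS_gt _); rewrite (bigD1 j)//= lerDl.
  by apply: sumr_ge0.
have B0 k : leb R n (B k) = 0%E.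
  rewrite leb_box.
    by rewrite (bigD1 i)//= eqxx subrr mul0r.
  move=> j; case: eqVneq => // _; by rewrite (@le_trans _ _ 0)// oppr_le0.
apply/eqP; rewrite eq_le measure_ge0 andbT.
have := measure_sigma_subadditive (leb R n) (fun k => measurable_closed_box _ _) (measurable_hyperplane i c) HB.
by rewrite eseries0// => k _ _; exact: B0.
Qed.

Lemma open_box_sub a b : open_box a b `<=` closed_box a b.
Proof. by move=> x h i; exact: subset_itv_oo_cc (h i). Qed.

Lemma measurable_open_box a b : measurable (open_box a b).
Proof.
rewrite [X in measurable X](_ : _ =
    \bigcap_(i : 'I_n) ((fun x : 'rV[R]_n => x 0 i) @^-1` `]a i, b i[)).
  apply: fin_bigcap_measurable => [|i _]; first exact: finite_finset.
  rewrite -[X in measurable X]setTI.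
  by apply: measurable_entry => //; exact: measurable_itv.
by apply/seteqP; split=> [x h i _|x h i]; exact: h.
Qed.

Lemma negligible_box_boundary a b :
  (leb R n).-negligible (closed_box a b `\` open_box a b).
Proof.
have : (leb R n).-negligible (\big[setU/set0]_(i : 'I_n)
    ([set x : 'rV[R]_n | x 0 i = a i] `|` [set x | x 0 i = b i])).
  elim/big_ind: _ => [|A B|i _]; [exact: negligible_set0|exact: negligibleU|].
  by apply: negligibleU; (apply/negligibleP;
    [exact: measurable_hyperplane|exact: leb_hyperplane]).
apply: negligibleS => x [xc xo]; apply: contrapT => xU; apply: xo => i.
have xi : ~ (x 0 i = a i \/ x 0 i = b i).
  by move=> xi; apply: xU; rewrite (bigD1 i)//=; left.
have := xc i; rewrite !in_itv/= !lt_neqAle => /andP[-> ->]; rewrite !andbT.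
by apply/andP; split; apply/eqP => e; apply: xi; [left|right].
Qed.

Lemma leb_between_boxes a b (Q : set 'rV[R]_n) : (forall i, a i <= b i) ->
  measurable Q -> open_box a b `<=` Q -> Q `<=` closed_box a b ->
  leb R n Q = (\prod_(i < n) (b i - a i))%:E.
Proof.
move=> ab mQ oQ Qc; rewrite -leb_box//.
have mc := measurable_closed_box a b.
apply/eqP; rewrite eq_le le_measure ?inE//=.
rewrite -[X in leb R n X](setDUK Qc).
apply: le_trans (measureU2 (leb R n) mQ (measurableD mc mQ)) _.
rewrite [X in (_ + X)%E](_ : _ = 0%E) ?adde0//.
apply/(@negligibleP _ _ _ (leb R n)); first exact: measurableD.
by apply: negligibleS (negligible_box_boundary a b); exact: setDS.
Qed.

Lemma integral_between_boxes a b (Q : set 'rV[R]_n) (f : 'rV[R]_n -> \bar R) :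
  measurable Q -> open_box a b `<=` Q -> Q `<=` closed_box a b ->
  (leb R n).-integrable (closed_box a b) f ->
  (\int[leb R n]_(x in Q) f x = \int[leb R n]_(x in closed_box a b) f x)%E.
Proof.
move=> mQ oQ Qc mf; have mc := measurable_closed_box a b.
have N0 := negligible_box_boundary a b.
have mN : measurable (closed_box a b `\` Q) by exact: measurableD.
rewrite [RHS](negligible_integral mN mc)//; first by rewrite setDD setIidr.
apply/(@negligibleP _ _ _ (leb R n)) => //; apply: negligibleS N0; exact: setDS.
Qed.

Lemma sup_ball_sub_eucl_ball z s r : 0 <= s -> n%:R * s < r ->
  closed_box (fun i => z 0 i - s) (fun i => z 0 i + s) `<=` eucl_ball z r.
Proof.
move=> s0 sr x xz; rewrite /eucl_ball/=; apply: le_lt_trans sr.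
apply: eucl_norm_le_coord => // i; rewrite !mxE ler_norml.
by have := xz i; rewrite in_itv/= => /andP[a b]; apply/andP; split; lra.
Qed.

Lemma eucl_ball_sub_sup_ball z r :
  eucl_ball z r `<=` open_box (fun i => z 0 i - r) (fun i => z 0 i + r).
Proof.
move=> x xz i; have := eucl_norm_coord (x - z) 0 i.
move/le_lt_trans/(_ xz); rewrite !mxE ltr_norml in_itv/= => /andP[a b].
by apply/andP; split; lra.
Qed.

Lemma leb_sup_ball z s : 0 <= s ->
  leb R n (closed_box (fun i => z 0 i - s) (fun i => z 0 i + s)) = ((2 * s) ^+ n)%:E.
Proof.
move=> s0; rewrite leb_box => [|i]; last by lra.
rewrite (eq_bigr (fun=> 2 * s)) ?prodr_const ?card_ord// => i _; ring.
Qed.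

Lemma leb_eucl_ball_le z r : 0 <= r -> (leb R n (eucl_ball z r) <= ((2 * r) ^+ n)%:E)%E.
Proof.
move=> r0; rewrite -(leb_sup_ball z)// le_measure ?inE//.
- exact: measurable_eucl_ball.
- exact: measurable_closed_box.
- by apply: subset_trans (@open_box_sub _ _); exact: eucl_ball_sub_sup_ball.
Qed.

Lemma leb_eucl_ball_ge z r : 0 < r ->
  (((2 * (r / n.+1%:R)) ^+ n)%:E <= leb R n (eucl_ball z r))%E.
Proof.
move=> r0; have s0 : 0 < r / n.+1%:R by rewrite divr_gt0.
rewrite -(leb_sup_ball z (ltW s0)) le_measure ?inE//.
- exact: measurable_closed_box.
- exact: measurable_eucl_ball.
- apply: sup_ball_sub_eucl_ball; first exact: ltW.
  rewrite mulrCA -[ltRHS]mulr1 ltr_pM2l// ltr_pdivrMr// mul1r ltr_nat.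
  by [].
Qed.

Lemma leb_eucl_ball_fin z r : 0 < r -> leb R n (eucl_ball z r) \is a fin_num.
Proof.
move=> r0; rewrite ge0_fin_numE//.
by rewrite (le_lt_trans (leb_eucl_ball_le _ (ltW r0)))// ltry.
Qed.

Definition vol z r : R := fine (leb R n (eucl_ball z r)).

Lemma volE z r : 0 < r -> leb R n (eucl_ball z r) = (vol z r)%:E.
Proof. by move=> r0; rewrite fineK// leb_eucl_ball_fin. Qed.

Lemma vol_le z r : 0 < r -> vol z r <= (2 * r) ^+ n.
Proof. by move=> r0; rewrite -lee_fin -volE// leb_eucl_ball_le// ltW. Qed.

Lemma vol_ge z r : 0 < r -> (2 * (r / n.+1%:R)) ^+ n <= vol z r.
Proof. by move=> r0; rewrite -lee_fin -volE// leb_eucl_ball_ge. Qed.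

Lemma vol_gt0 z r : 0 < r -> 0 < vol z r.
Proof.
move=> r0; apply: lt_le_trans (vol_ge z r0).
by rewrite exprn_gt0// mulr_gt0// divr_gt0.
Qed.

(** Balls are never measured exactly: the cube around the first has half-side [r], the one inside
    the second has half-side [r' / n.+1], and their ratio gives the constant whatever the
    centers. *)
Lemma vol_doubling z z' r r' c : 0 < r -> 0 < r' -> r <= c * r' ->
  vol z r <= (c * n.+1%:R) ^+ n * vol z' r'.
Proof.
move=> r0 r'0 rc.
have c0 : 0 < c by rewrite -(pmulr_lgt0 _ r'0); exact: lt_le_trans rc.
apply: le_trans (vol_le z r0) _.
have := vol_ge z' r'0; rewrite -(@ler_pM2l _ ((c * n.+1%:R) ^+ n)); last first.
  by rewrite exprn_gt0// mulr_gt0.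
apply: le_trans; rewrite -exprMn.
have -> : c * n.+1%:R * (2 * (r' / n.+1%:R)) = 2 * (c * r').
  by field; rewrite nat1r pnatr_eq0.
apply: lerXn2r; rewrite ?nnegrE ?ler_pM2l// ?mulr_ge0 ?ltW//.
Qed.

Definition cube_lo N (x : 'rV[R]_n) i : R := (Num.floor (2 ^+ N * x 0 i))%:~R / 2 ^+ N.
Definition cube_hi N (x : 'rV[R]_n) i : R :=
  (Num.floor (2 ^+ N * x 0 i) + 1)%:~R / 2 ^+ N.

Lemma dyadic_cubeE N x :
  dyadic_cube N x = [set y | forall i, y 0 i \in `[cube_lo N x i, cube_hi N x i[].
Proof.
have key (y : 'rV[R]_n) i : (y 0 i \in `[cube_lo N x i, cube_hi N x i[) =
      (Num.floor (2 ^+ N * y 0 i) == Num.floor (2 ^+ N * x 0 i)).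
  by rewrite floor_eq in_itv/= ler_pdivrMr ?exprn_gt0// ltr_pdivlMr ?exprn_gt0// [y 0 i * _]mulrC.
apply/seteqP; split=> [y /rowP h i|y h].
  by rewrite key; have := h i; rewrite !mxE => ->.
by apply/rowP => i; have := h i; rewrite key !mxE => /eqP ->.
Qed.

Lemma open_box_sub_cube N x : open_box (cube_lo N x) (cube_hi N x) `<=` dyadic_cube N x.
Proof. by rewrite dyadic_cubeE => y h i; exact: subset_itv_oo_co (h i). Qed.

Lemma cube_sub_closed_box N x :
  dyadic_cube N x `<=` closed_box (cube_lo N x) (cube_hi N x).
Proof. by rewrite dyadic_cubeE => y h i; exact: subset_itv_co_cc (h i). Qed.

Lemma cube_side N x i : cube_hi N x i - cube_lo N x i = 2 ^- N.
Proof. by rewrite /cube_hi /cube_lo -mulrBl intrD addrAC subrr add0r mul1r. Qed.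

Lemma cube_lo_le_hi N x i : cube_lo N x i < cube_hi N x i.
Proof. by rewrite -subr_gt0 cube_side invr_gt0 exprn_gt0. Qed.

Lemma leb_dyadic_cube N x : leb R n (dyadic_cube N x) = ((2 ^- N) ^+ n)%:E.
Proof.
rewrite (@leb_between_boxes (cube_lo N x) (cube_hi N x)).
- by rewrite (eq_bigr (fun=> 2 ^- N)) ?prodr_const ?card_ord// => i _; exact: cube_side.
- by move=> i; exact/ltW/cube_lo_le_hi.
- exact: measurable_dyadic_cube.
- exact: open_box_sub_cube.
- exact: cube_sub_closed_box.
Qed.

(** A dyadic cube of side [2 ^- N] lies in the ball of radius [n.+1 * 2 ^- N] around any of its
    points. The factor in the conclusion is the volume of the cube circumscribed to that ball,
    relative to the dyadic cube. *)
Lemma ae_le_of_ball_means (U V : set 'rV[R]_n) (f : 'rV[R]_n -> R) A delta :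
  eucl_open V -> V `<=` U -> measurable U -> (leb R n U < +oo)%E ->
  measurable_fun U f -> (forall x, U x -> 0 <= f x) ->
  (\int[leb R n]_(x in U) (f x)%:E < +oo)%E -> 0 < delta -> 0 <= A ->
  (forall x t, V x -> 0 < t < delta -> eucl_ball x t `<=` U /\
    (\int[leb R n]_(y in eucl_ball x t) (f y)%:E <= (A * vol x t)%:E)%E) ->
  {ae leb R n, forall x, V x -> f x <= (2 * n.+1%:R) ^+ n * A}.
Proof.
move=> oV VU mU Uoo mf f0 ioof d0 A0 H.
have mV := measurable_eucl_open oV.
have [N0 hN0] := half_expn_small (divr_gt0 d0 (ltr0Sn R n)).
apply: (@ae_le_of_dyadic_cubes _ _ _ _ _ _ N0) => //.
- exact: measurable_funS mf.
- by move=> x /VU; exact: f0.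
- by move=> x _; rewrite mulr_ge0// exprn_ge0.
- apply: le_lt_trans ioof; apply: ge0_subset_integral => //.
    exact/measurable_EFinP.
- rewrite integral_cst//; apply: lte_mul_pinfty => //.
    by rewrite lee_fin mulr_ge0// exprn_ge0.
  by apply: le_lt_trans Uoo; rewrite le_measure ?inE.
- move=> N x NN0 xV.
  have mC := measurable_dyadic_cube N x.
  rewrite integral_cst// [X in (_ * X)%E]leb_dyadic_cube -EFinM.
  pose t : R := n.+1%:R * 2 ^- N.
  have e0 : 0 < 2 ^- N :> R by rewrite invr_gt0 exprn_gt0.
  have t0 : 0 < t by rewrite mulr_gt0.
  have td : t < delta by rewrite /t mulrC -ltr_pdivlMr//; exact: hN0.
  have Vx : V x by exact: xV.
  have [|tU h] := H x t Vx; first by rewrite t0.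
  apply: (@le_trans _ _ (A * vol x t)%:E); last first.
    rewrite lee_fin mulrAC [leRHS]mulrC ler_wpM2l//.
    by apply: le_trans (vol_le x t0) _; rewrite /t -exprMn mulrA.
  apply: le_trans h; apply: ge0_subset_integral => //.
  - exact: measurable_eucl_ball.
  - by apply/measurable_EFinP; exact: measurable_funS mf.
  - by move=> y /tU Uy; rewrite lee_fin f0.
  - move=> y /dyadic_cube_diam; rewrite /eucl_ball/= => /le_lt_trans; apply.
    by rewrite /t ltr_pM2r// ltr_nat.
Qed.

End boxes.

(** * Smooth functions of one real variable *)

Section smooth1.
Context (R : realType).
Implicit Types (f g : R -> R) (p q : {poly R}).

Lemma is_derive1_eq f (x a b : R) :
  is_derive x (1 : R) f a -> a = b -> is_derive x (1 : R) f b.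
Proof. by move=> h <-. Qed.

(* Membership in a derivation-closed family gives derivatives of all orders
   without iterating the derivation operator. *)
Definition smooth1 f : Prop := exists S : set (R -> R), S f /\
  forall g, S g -> exists2 g', S g' & forall x : R, is_derive x (1 : R) g (g' x).

Lemma smooth1_derive f : smooth1 f ->
  exists2 f', smooth1 f' & forall x : R, is_derive x (1 : R) f (f' x).
Proof.
move=> [S [Sf SD]]; have [f' Sf' ff'] := SD _ Sf.
by exists f' => //; exists S.
Qed.

Lemma smooth1_continuous f : smooth1 f -> continuous f.
Proof.
move=> /smooth1_derive[f' _ ff'] x; apply: differentiable_continuous.
by apply/derivable1_diffP; have := ff' x; case.
Qed.

Lemma smooth1_antiderivative f F : smooth1 f ->
  (forall x : R, is_derive x (1 : R) F (f x)) -> smooth1 F.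
Proof.
move=> [S [Sf SD]] FF; exists (S `|` [set F]); split; first by right.
move=> g [/SD[g' Sg' gg']|->]; first by exists g' => //; left.
by exists f => //; left.
Qed.

(** By the Leibniz rule a product differentiates into a sum of products; closing under sums makes
    the family stable under derivation. *)
Inductive product_span (S T : set (R -> R)) : (R -> R) -> Prop :=
| product_span_mul f g of S f & T g : product_span S T (f \* g)
| product_span_add f g of product_span S T f & product_span S T g :
    product_span S T (f \+ g).

Lemma smooth1M f g : smooth1 f -> smooth1 g -> smooth1 (f \* g).
Proof.
move=> [S [Sf SD]] [T [Tg TD]]; exists (product_span S T).
split; first exact: product_span_mul.
move=> h; elim=> [f1 g1 Sf1 Tg1|f1 g1 _ [f' Sf' ff'] _ [g' Sg' gg']].
  have [f' Sf' ff'] := SD _ Sf1; have [g' Sg' gg'] := TD _ Tg1.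
  exists ((f1 \* g') \+ (f' \* g1)).
    by apply: product_span_add; exact: product_span_mul.
  move=> x; apply: (is_derive1_eq (is_deriveM (ff' x) (gg' x))).
  by rewrite /GRing.scale/= [f' x * _]mulrC.
exists (f' \+ g'); first exact: product_span_add.
by move=> x; exact: (is_deriveD (ff' x) (gg' x)).
Qed.

Lemma smooth1_lincomb f g (a b : R) : smooth1 f -> smooth1 g ->
  smooth1 (fun x => a * f x - b * g x).
Proof.
move=> [S [Sf SD]] [T [Tg TD]].
exists [set h | exists f g, [/\ S f, T g & h = (fun x => a * f x - b * g x)]].
split; first by exists f, g.
move=> _ [f1 [g1 [Sf1 Tg1 ->]]].
have [f' Sf' ff'] := SD _ Sf1; have [g' Sg' gg'] := TD _ Tg1.
exists (fun x => a * f' x - b * g' x); first by exists f', g'.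
move=> x; have da := is_deriveZ a (ff' x); have db := is_deriveZ b (gg' x).
exact: (is_deriveB da db).
Qed.

Lemma is_derive_affine f f' (a b : R) : (forall x : R, is_derive x (1 : R) f (f' x)) ->
  forall x : R, is_derive x (1 : R) (fun x => f (a * x + b)) (a * f' (a * x + b)).
Proof.
move=> ff' x; rewrite mulrC.
have daff : is_derive x (1 : R) (fun x => a * x + b) a.
  have da := is_deriveZ a (is_derive_id x (1 : R)).
  have := is_deriveD da (is_derive_cst b x 1).
  by rewrite addr0 /GRing.scale/= mulr1.
exact: (@is_derive1_comp _ f (fun x => a * x + b) x _ _ (ff' _) daff).
Qed.

Lemma smooth1_affine f (a b : R) : smooth1 f -> smooth1 (fun x => f (a * x + b)).
Proof.
move=> [S [Sf SD]].
exists [set h | exists c g, S g /\ h = (fun x => c * g (a * x + b))].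
split; first by exists 1, f; split => //; apply/funext => x; rewrite mul1r.
move=> _ [c [g [Sg ->]]]; have [g' Sg' gg'] := SD _ Sg.
exists (fun x => (c * a) * g' (a * x + b)); first by exists (c * a), g'.
by move=> x; have := is_deriveZ c (is_derive_affine a b gg' x); rewrite -mulrA.
Qed.

(* p(1/x) exp(-1/x): this family is closed under derivation. *)
Definition exp_pole p (x : R) : R := if 0 < x then p.[x^-1] * expR (- x^-1) else 0.

(** For nonnegative t, t^i is at most i! times exp t, by keeping a single term of the exponential
    series; this is summed over the coefficients. *)
Lemma horner_expRN_bounded p : exists C, forall t, 0 <= t -> `|p.[t] * expR (- t)| <= C.
Proof.
exists (\sum_(i < size p) `|p`_i| * i`!%:R) => t t0.
rewrite expRN normrM normfV (gtr0_norm (expR_gt0 _)) ler_pdivrMr ?expR_gt0//.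
rewrite horner_coef; apply: le_trans (ler_norm_sum _ _ _) _.
rewrite mulr_suml; apply: ler_sum => i _.
rewrite normrM -mulrA ler_wpM2l// ger0_norm ?exprn_ge0//.
case: i => -[|i] _ /=; first by rewrite expr0 fact0 mul1r -expR0 ler_expR.
rewrite -ler_pdivrMl ?ltr0n ?fact_gt0// mulrC.
by apply: le_trans (expR_ge1Dxn i t0); rewrite lerDr.
Qed.

Lemma exp_pole_bounded p : exists C, forall x, `|exp_pole p x| <= C.
Proof.
have [C hC] := horner_expRN_bounded p; exists C => x; rewrite /exp_pole.
case: ifPn => [x0|_]; first by apply: hC; rewrite invr_ge0 ltW.
by rewrite normr0; apply: le_trans (hC 0 (lexx _)); exact: normr_ge0.
Qed.

(** Trading a factor ['X] for a factor [x] settles the behaviour at 0: every [exp_pole] is bounded,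
    so each of them is a bounded function times [x]. *)
Lemma exp_poleX p x : exp_pole p x = exp_pole ('X * p) x * x.
Proof.
rewrite /exp_pole; case: ifPn => [x0|_]; last by rewrite mul0r.
by rewrite hornerM hornerX; field; rewrite gt_eqF.
Qed.

Lemma exp_pole_continuous0 p : {for 0, continuous (exp_pole p)}.
Proof.
have [C hC] := exp_pole_bounded ('X * p).
have C0 : 0 <= C by apply: le_trans (hC 0).
apply/(@cvgrPdist_le _ R^o) => e e0; near=> x.
rewrite {1}/exp_pole ltxx sub0r normrN exp_poleX normrM.
apply: (@le_trans _ _ ((C + 1) * `|x|)).
  by rewrite ler_wpM2r// (le_trans (hC x))// lerDl.
rewrite mulrC -ler_pdivlMr ?ltr_wpDl//; near: x.
exists (e / (C + 1)); first by rewrite /= divr_gt0// ltr_wpDl.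
by move=> x /=; rewrite sub0r normrN => /ltW.
Unshelve. all: by end_near. Qed.

Lemma is_derive_exp_pole p (x : R) :
  is_derive x (1 : R) (exp_pole p) (exp_pole ('X ^+ 2 * (p - p^`())) x).
Proof.
have [x0|x0|->] := ltgtP x 0.
- have -> : exp_pole ('X ^+ 2 * (p - p^`())) x = 0.
    by rewrite /exp_pole ltNge ltW.
  apply: near_eq_is_derive (is_derive_cst 0 x 1).
  near=> y; rewrite /exp_pole ltNge ltW//=.
  by near: y; exact: lt_nbhsl.
- have : is_derive x (1 : R) (fun y => p.[y^-1] * expR (- y^-1))
     (exp_pole ('X ^+ 2 * (p - p^`())) x).
    have xN0 : id x != 0 by rewrite gt_eqF.
    have dV := is_deriveV xN0 (is_derive_id x (1 : R)).
    have dp := @is_derive1_comp _ (horner p) (fun y => y^-1) x _ _ (is_derive_poly p x^-1) dV.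
    have dN := is_deriveN dV.
    have de := @is_derive1_comp _ expR (fun y => - y^-1) x _ _ (is_derive_expR (- x^-1)) dN.
    have := is_deriveM dp de => /=.
    move/is_derive1_eq; apply; rewrite /exp_pole x0 !hornerE /GRing.scale/=.
    by field.
  apply: near_eq_is_derive.
  near=> y; rewrite /exp_pole ifT//.
  by near: y; exact: lt_nbhsr.
(* The difference quotient at 0 is [exp_pole ('X * p)], which is continuous there with value 0. *)
- apply/is_derive1_caratheodory; exists (exp_pole ('X * p)); split.
  + by move=> z; rewrite {2}/exp_pole ltxx !subr0 exp_poleX.
  + exact: exp_pole_continuous0.
  + by rewrite /exp_pole ltxx.
Unshelve. all: by end_near. Qed.

Definition flat_exp : R -> R := exp_pole 1.

Lemma smooth1_flat_exp : smooth1 flat_exp.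
Proof.
exists (range exp_pole); split; first by exists 1.
move=> _ [p _ <-]; exists (exp_pole ('X ^+ 2 * (p - p^`()))); first by eexists.
exact: is_derive_exp_pole.
Qed.

Lemma flat_expE x : flat_exp x = if 0 < x then expR (- x^-1) else 0.
Proof. by rewrite /flat_exp /exp_pole hornerC mul1r. Qed.

Lemma flat_exp_ge0 x : 0 <= flat_exp x.
Proof. by rewrite flat_expE; case: ifP => // _; exact: expR_ge0. Qed.

Lemma flat_exp_le1 x : flat_exp x <= 1.
Proof.
rewrite flat_expE; case: ifP => // x0.
by rewrite expR_le1 oppr_le0 invr_ge0 ltW.
Qed.

Lemma flat_exp_eq0 x : x <= 0 -> flat_exp x = 0.
Proof. by move=> x0; rewrite flat_expE ltNge x0. Qed.

End smooth1.

Lemma Rintegral_dominated_cvg d (T : measurableType d) (R : realType)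
    (mu : {measure set T -> \bar R}) (D : set T) (f_ : (T -> R)^nat) (f g : T -> R) :
  measurable D -> (forall k, measurable_fun D (f_ k)) ->
  (forall x, D x -> f_ k x @[k --> \oo] --> f x) ->
  mu.-integrable D (EFin \o g) -> (forall k x, D x -> `|f_ k x| <= g x) ->
  \int[mu]_(x in D) f_ k x @[k --> \oo] --> \int[mu]_(x in D) f x.
Proof.
move=> mD mf ff gi fg.
have mfE k : measurable_fun D (EFin \o f_ k) by exact/measurable_EFinP.
have ffE x : D x -> (EFin \o f_ k) x @[k --> \oo] --> (EFin \o f) x.
  by move=> Dx; apply: cvg_EFin; [exact: nearW|exact: ff].
have fgE k x : D x -> (`|(EFin \o f_ k) x| <= (EFin \o g) x)%E.
  by move=> Dx; rewrite /= lee_fin fg.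
have [] := @dominated_convergence _ _ _ mu D mD (fun k => EFin \o f_ k) (EFin \o f) (EFin \o g) mfE.
- exact: emeasurable_fun_cvg mfE ffE.
- exact: aeW.
- exact: gi.
- by apply: aeW => x k Dx; exact: fgE.
move=> fi _ h; apply: fine_cvg; rewrite fineK//; exact: integrable_fin_num.
Qed.

(** * Bumps on an interval and compactly supported primitives *)

Section bump.
Context (R : realType).
Notation mu := (@lebesgue_measure R).

(** Not normalized: as [k] grows the bumps tend pointwise to the indicator of []a, b[] while staying
    below it, so integrals against them recover integrals over open boxes. *)
Definition bump (a b : R) (k : nat) (x : R) : R :=
  flat_exp (k.+1%:R * (x - a)) * flat_exp (k.+1%:R * (b - x)).

Lemma smooth1_bump a b k : smooth1 (bump a b k).
Proof.
have := smooth1M (smooth1_affine k.+1%:R (- (k.+1%:R * a)) (smooth1_flat_exp R))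
  (smooth1_affine (- k.+1%:R) (k.+1%:R * b) (smooth1_flat_exp R)).
congr smooth1; apply/funext => x; rewrite /bump /=.
by congr (flat_exp _ * flat_exp _); ring.
Qed.

Lemma bump_ge0 a b k x : 0 <= bump a b k x.
Proof. by rewrite mulr_ge0// flat_exp_ge0. Qed.

Lemma bump_le1 a b k x : bump a b k x <= 1.
Proof. by rewrite mulr_ile1// ?flat_exp_ge0// flat_exp_le1. Qed.

Lemma bump_out a b k x : x \notin `]a, b[ -> bump a b k x = 0.
Proof.
rewrite in_itv/= negb_and -!leNgt /bump => /orP[xa|bx].
  by rewrite flat_exp_eq0 ?mul0r// pmulr_rle0// subr_le0.
by rewrite [X in _ * X]flat_exp_eq0 ?mulr0// pmulr_rle0// subr_le0.
Qed.

Lemma flat_exp_cvg1 (y : R) : 0 < y -> flat_exp (k.+1%:R * y) @[k --> \oo] --> (1 : R).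
Proof.
move=> y0; have -> : (fun k => flat_exp (k.+1%:R * y)) =
    (fun k : nat => expR (- (y^-1 * k.+1%:R^-1))).
  by apply/funext => k; rewrite flat_expE mulr_gt0// invfM mulrC.
rewrite [X in _ --> X](_ : _ = expR (- (y^-1 * 0))); last by rewrite mulr0 oppr0 expR0.
apply: continuous_cvg; first exact: continuous_expR.
by apply: cvgN; apply: cvgM; [exact: cvg_cst|exact: (@cvg_harmonic R)].
Qed.

Lemma bump_cvg a b x : bump a b k x @[k --> \oo] --> (\1_`]a, b[ x : R).
Proof.
rewrite indicE; have [xab|xab] := boolP (x \in `]a, b[).
  rewrite mem_set//= -[1%:R]mulr1; move: xab; rewrite in_itv/= => /andP[ax xb].
  apply: (@cvgM R nat \oo _ (fun k : nat => flat_exp (k.+1%:R * (x - a)))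
    (fun k : nat => flat_exp (k.+1%:R * (b - x)))).
    by apply: flat_exp_cvg1; rewrite subr_gt0.
  by apply: flat_exp_cvg1; rewrite subr_gt0.
rewrite memNset; last exact/negP.
by under eq_fun do rewrite bump_out//; exact: cvg_cst.
Qed.

Lemma measurable_bump a b k : measurable_fun setT (bump a b k).
Proof. by apply: continuous_measurable_fun; exact/smooth1_continuous/smooth1_bump. Qed.

Lemma bump_le_indic a b k x : bump a b k x <= \1_`]a, b[ x.
Proof.
rewrite indicE; have [xab|xab] := boolP (x \in `]a, b[).
  by rewrite mem_set// bump_le1.
by rewrite bump_out// ler0n.
Qed.

Lemma integrable_le_indic (f : R -> R) a b : measurable_fun setT f ->
  (forall x, `|f x| <= \1_`]a, b[ x) -> mu.-integrable setT (EFin \o f).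
Proof.
move=> mf f1; apply: le_integrable (integrable_indic_itv a b false true) => //.
  exact/measurable_EFinP.
move=> x _ /=; rewrite lee_fin (le_trans (f1 x))// ger0_norm//.
Qed.

Lemma integrable_bump a b k : mu.-integrable setT (EFin \o bump a b k).
Proof.
apply: (@integrable_le_indic _ a b); first exact: measurable_bump.
by move=> x; rewrite ger0_norm ?bump_ge0// bump_le_indic.
Qed.

Definition mass (f : R -> R) : R := \int[mu]_x f x.

Lemma cvg_mass_bump a b : a <= b -> mass (bump a b k) @[k --> \oo] --> b - a.
Proof.
move=> ab.
have <- : \int[mu]_x (\1_`]a, b[ x : R) = b - a.
  rewrite /Rintegral integral_indic// setIT [X in fine X](lebesgue_measure_itv `]a, b[)/= lte_fin.
  by case: ltP => //= ba; rewrite (@le_anti _ _ a b) ?subrr// ab ba.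
apply: (@Rintegral_dominated_cvg _ _ R mu setT (fun k => bump a b k)
  (fun x => \1_`]a, b[ x) (fun x => \1_`]a, b[ x)) => //.
- by move=> k; exact: measurable_bump.
- by move=> x _; exact: bump_cvg.
- exact: (integrable_indic_itv a b false true).
- by move=> k x _; rewrite ger0_norm ?bump_ge0// bump_le_indic.
Qed.

Definition cumulative_mass (f : R -> R) (x : R) : R := \int[mu]_(t in `]-oo, x]) f t.

Section cumulative_mass.
Context (f : R -> R) (a b : R).
Hypothesis sf : smooth1 f.
Hypothesis f0 : forall x, 0 <= f x.
Hypothesis fi : mu.-integrable setT (EFin \o f).
Hypothesis fout : forall x, x \notin `]a, b[ -> f x = 0.

Lemma mass_ge0 : 0 <= mass f.
Proof. exact: Rintegral_ge0. Qed.

Lemma cumulative_mass_ge0 x : 0 <= cumulative_mass f x.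
Proof. exact: Rintegral_ge0. Qed.

Lemma cumulative_mass_le x : cumulative_mass f x <= mass f.
Proof.
rewrite /cumulative_mass /mass /Rintegral fine_le//.
- by apply: integrable_fin_num => //; exact: integrableS fi.
- exact: integrable_fin_num.
- apply: ge0_subset_integral => //; first by case/integrableP: fi.
  by move=> y _; rewrite lee_fin.
Qed.

Lemma cumulative_mass_lo x : x <= a -> cumulative_mass f x = 0.
Proof.
move=> xa; rewrite /cumulative_mass; under eq_Rintegral => y.
  rewrite inE/= in_itv/= => yx.
  rewrite fout; last by rewrite in_itv/= negb_and -leNgt (le_trans yx xa).
  over.
by rewrite Rintegral_cst// mul0r.
Qed.

Lemma cumulative_mass_hi x : b <= x -> cumulative_mass f x = mass f.
Proof.
move=> bx; rewrite /cumulative_mass Rintegral_mkcond; apply: eq_Rintegral => y _.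
rewrite patchE; case: ifPn => //; rewrite notin_setE/= in_itv/= => /negP.
rewrite -ltNge => xy; rewrite fout// in_itv/= negb_and -!leNgt.
by rewrite (le_trans bx (ltW xy)) orbT.
Qed.

Lemma is_derive_cumulative_mass x : is_derive x (1 : R) (cumulative_mass f) (f x).
Proof.
have xx1 : x < x + 1 by rewrite ltrDl.
have fi' : mu.-integrable [set` Interval -oo%O (BRight (x + 1))] (EFin \o f).
  exact: integrableS fi.
have dd : derivable (cumulative_mass f) x 1 /\ derive1 (cumulative_mass f) x = f x.
  apply: (continuous_FTC1 xx1 fi'); [exact: ltNyr|exact: smooth1_continuous].
case: dd => dF F'; apply: DeriveDef => //.
by rewrite -F' derive1E.
Qed.

End cumulative_mass.

(** The combination [mass g * f - mass f * g] has total integral zero, so its primitive vanishes to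
    the right of [b] as well as to the left of [a]. This makes the primitive admissible as a factor
    of a test function. *)
Lemma mass_balanced_primitive (f g : R -> R) a b : a < b ->
  smooth1 f -> smooth1 g -> (forall x, 0 <= f x) -> (forall x, 0 <= g x) ->
  mu.-integrable setT (EFin \o f) -> mu.-integrable setT (EFin \o g) ->
  (forall x, x \notin `]a, b[ -> f x = 0) -> (forall x, x \notin `]a, b[ -> g x = 0) ->
  exists P : R -> R, [/\ smooth1 P,
    forall x : R, is_derive x (1 : R) P (mass g * f x - mass f * g x),
    forall x, x \notin `]a, b[ -> P x = 0 &
    forall x, `|P x| <= mass f * mass g].
Proof.
move=> ab sf sg f0 g0 fi gi fout gout.
pose F := cumulative_mass f; pose G := cumulative_mass g.
have dP (x : R) : is_derive x (1 : R) (fun x => mass g * F x - mass f * G x)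
    (mass g * f x - mass f * g x).
  have dF := is_deriveZ (mass g) (is_derive_cumulative_mass sf fi x).
  have dG := is_deriveZ (mass f) (is_derive_cumulative_mass sg gi x).
  exact: (is_deriveB dF dG).
exists (fun x => mass g * F x - mass f * G x); split => //.
- apply: smooth1_antiderivative dP; exact: smooth1_lincomb.
- move=> x; rewrite in_itv/= negb_and -!leNgt => /orP[xa|bx].
    by rewrite /F /G (cumulative_mass_lo fout)// (cumulative_mass_lo gout)// !mulr0 subrr.
  by rewrite /F /G (cumulative_mass_hi fout)// (cumulative_mass_hi gout)// mulrC subrr.
- move=> x; rewrite ler_norml.
  have := cumulative_mass_ge0 f0 x; have := cumulative_mass_le f0 fi x.
  have := cumulative_mass_ge0 g0 x; have := cumulative_mass_le g0 gi x.
  have := mass_ge0 f0; have := mass_ge0 g0.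
  rewrite -/F -/G => *; apply/andP; split; nra.
Qed.

End bump.

(** * Tensor products of one-variable functions as test functions *)

Section tensor.
Context (R : realType) (n : nat).
Implicit Types (f : 'I_n -> R -> R) (x : 'rV[R]_n).

Definition tensor f x : R := \prod_j f j (x 0 j).

Definition upd (T : Type) (f : 'I_n -> T) (i : 'I_n) (g : T) : 'I_n -> T :=
  fun j => if j == i then g else f j.

Lemma updE (T : Type) (f : 'I_n -> T) i g : upd f i g i = g.
Proof. by rewrite /upd eqxx. Qed.

Lemma upd_neq (T : Type) (f : 'I_n -> T) i g j : j != i -> upd f i g j = f j.
Proof. by rewrite /upd => /negPf ->. Qed.

Lemma tensor_upd f i g x :
  tensor (upd f i g) x = g (x 0 i) * \prod_(j | j != i) f j (x 0 j).
Proof.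
rewrite /tensor (bigD1 i)//= updE; congr (_ * _).
by apply: eq_bigr => j ji; rewrite upd_neq.
Qed.

Lemma is_derive_tensor f i (f' : R -> R) : (forall t : R, is_derive t (1 : R) (f i) (f' t)) ->
  forall x, is_derive x (delta_mx 0 i) (tensor f) (tensor (upd f i f') x).
Proof.
move=> fif' x; rewrite tensor_upd; set c := \prod_(_ | _) _.
have [df vf] := fif' (x 0 i).
have cv : (fun h => h^-1 *: ((f i \o shift (x 0 i)) (h *: (1 : R)) - f i (x 0 i)))
    @ 0^' --> f' (x 0 i).
  by rewrite -vf; exact: df.
have E : (fun h => h^-1 *: ((tensor f \o shift x) (h *: delta_mx 0 i) - tensor f x)) =
    (fun h : R => (h^-1 *: ((f i \o shift (x 0 i)) (h *: (1 : R)) - f i (x 0 i))) * c).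
  apply/funext => h /=.
  have -> : tensor f x = f i (x 0 i) * c by rewrite /tensor (bigD1 i).
  have -> : tensor f (h *: delta_mx 0 i + x) = f i (h *: 1 + x 0 i) * c.
    rewrite /tensor (bigD1 i)//= !mxE !eqxx; congr (_ * _).
    apply: eq_bigr => j ji; rewrite !mxE (negPf ji) andbF mulr0 add0r//.
  by rewrite -mulrBl /GRing.scale/= mulrA.
have cvt : (fun h => h^-1 *: ((tensor f \o shift x) (h *: delta_mx 0 i) - tensor f x))
    @ 0^' --> f' (x 0 i) * c.
  by rewrite E; apply: cvgM => //; exact: cvg_cst.
apply: DeriveDef; first by apply/cvg_ex; eexists; exact: cvt.
exact: cvg_lim cvt.
Qed.

Lemma partial_deriv_tensor f i (f' : R -> R) : (forall t : R, is_derive t (1 : R) (f i) (f' t)) ->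
  partial_deriv i (tensor f) = tensor (upd f i f').
Proof.
move=> fif'; apply/funext => x.
by have [_ <-] := is_derive_tensor fif' x.
Qed.

Lemma continuous_tensor f : (forall j, continuous (f j)) -> continuous (tensor f).
Proof.
move=> cf.
have h (s : seq 'I_n) : continuous (fun y : 'rV[R]_n => \prod_(j <- s) f j (y 0 j) : R).
  elim: s => [|j s IH].
    rewrite (_ : (fun _ => _) = cst (1 : R)); first exact: cst_continuous.
    by apply/funext => y; rewrite big_nil.
  rewrite (_ : (fun _ => _) = (fun y : 'rV[R]_n =>
      f j (y 0 j) * \prod_(i <- s) f i (y 0 i))); last first.
    by apply/funext => y; rewrite big_cons.
  move=> y; apply: (@continuousM _ _ (fun z : 'rV[R]_n => f j (z 0 j))); last exact: IH.
  apply: (@continuous_comp _ _ _ (fun z : 'rV[R]_n => z 0 j) (f j)); last exact: cf.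
  exact: coord_continuous.
exact: h.
Qed.

(** A partial derivative differentiates one factor and leaves the others, so iterated partial
    derivatives remain tensor products of smooth factors. *)
Lemma smooth_tensor f : (forall j, smooth1 (f j)) -> smooth (tensor f).
Proof.
move=> sf s; have [f' sf' ->] : exists2 f', (forall j, smooth1 (f' j)) &
    foldr (@partial_deriv _ _) (tensor f) s = tensor f'.
  elim: s => [|i s [f' sf' IH]]; first by exists f.
  have [g sg f'g] := smooth1_derive (sf' i).
  exists (upd f' i g); last by rewrite /= IH; exact: partial_deriv_tensor.
  by move=> j; rewrite /upd; case: ifP.
split; first by apply: continuous_tensor => j; exact: smooth1_continuous.
move=> i x; have [g _ f'g] := smooth1_derive (sf' i).
by have [] := is_derive_tensor f'g x.
Qed.

Lemma compact_closed_box (lo hi : 'I_n -> R) : compact (closed_box lo hi).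
Proof.
have := @rV_compact R n (fun i => `[lo i, hi i]%classic) (fun i => @segment_compact _ _ _).
by congr compact.
Qed.

Lemma closed_closed_box (lo hi : 'I_n -> R) : closed (closed_box lo hi).
Proof.
apply: compact_closed; last exact: compact_closed_box.
exact: norm_hausdorff.
Qed.

Lemma tensor_out f (lo hi : 'I_n -> R) x :
  (forall j t, t \notin `]lo j, hi j[ -> f j t = 0) ->
  ~ open_box lo hi x -> tensor f x = 0.
Proof.
move=> fout /existsNP[j /negP xj].
by rewrite /tensor (bigD1 j)//= fout ?mul0r.
Qed.

Lemma test_function_tensor f (lo hi : 'I_n -> R) (U : set 'rV[R]_n) :
  (forall j, smooth1 (f j)) ->
  (forall j t, t \notin `]lo j, hi j[ -> f j t = 0) ->
  closed_box lo hi `<=` U -> test_function U (tensor f).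
Proof.
move=> sf fout boxU.
have sub : closure [set x | tensor f x != 0] `<=` closed_box lo hi.
  rewrite [X in _ `<=` X](closure_id _).1; last exact: closed_closed_box.
  apply: closureS => x /= fx; apply: open_box_sub; apply: contrapT => xo.
  by move: fx; rewrite (tensor_out fout xo) eqxx.
split; first exact: smooth_tensor.
  by apply: subclosed_compact sub; [exact: closed_closure|exact: compact_closed_box].
exact: subset_trans boxU.
Qed.

Lemma measurable_tensor f : (forall j, measurable_fun setT (f j)) ->
  measurable_fun setT (tensor f).
Proof.
move=> mf; rewrite /tensor; apply: measurable_prod => j _.
by apply: measurableT_comp => //; exact: measurable_entry.
Qed.

End tensor.

Section Rintegral_extra.
Context d (T : measurableType d) (R : realType) (mu : {measure set T -> \bar R}).

Lemma ae_mono (P Q : T -> Prop) : (forall x, P x -> Q x) ->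
  {ae mu, forall x, P x} -> {ae mu, forall x, Q x}.
Proof. by move=> PQ; apply: negligibleS => x /=; apply: contra_not; exact: PQ. Qed.

Lemma integrable_mul_bounded (D : set T) (f h : T -> R) (C : R) :
  measurable D -> mu.-integrable D (EFin \o f) -> measurable_fun D h ->
  (forall x, D x -> `|h x| <= C) -> mu.-integrable D (EFin \o (fun x => f x * h x)).
Proof.
move=> mD fi mh hC.
have mf : measurable_fun D f by apply/measurable_EFinP; exact: measurable_int fi.
apply: (@le_integrable _ _ _ _ D mD _ (EFin \o (fun x => C * f x))).
- by apply/measurable_EFinP; exact: measurable_funM.
- move=> x Dx /=; rewrite lee_fin !normrM mulrC ler_wpM2r//.
  by rewrite (le_trans (hC x Dx))// ler_norm.
- exact: (integrableZl mD C fi).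
Qed.

Lemma Rintegral_support (A D : set T) (f : T -> R) : A `<=` D ->
  (forall x, D x -> ~ A x -> f x = 0) ->
  \int[mu]_(x in D) f x = \int[mu]_(x in A) f x.
Proof.
move=> AD f0; rewrite Rintegral_mkcond [RHS]Rintegral_mkcond.
apply: eq_Rintegral => x _; rewrite !patchE.
have [Ax|Ax] := pselect (A x).
  by rewrite !mem_set//; exact: AD.
rewrite [in RHS]memNset//; case: ifPn => // /[!inE] Dx; exact: f0.
Qed.

Lemma normr_Rintegral_le_ae (D : set T) (f : T -> R) (C : R) :
  measurable D -> (mu D < +oo)%E -> measurable_fun D f -> 0 <= C ->
  {ae mu, forall x, D x -> `|f x| <= C} ->
  `|\int[mu]_(x in D) f x| <= C * fine (mu D).
Proof.
move=> mD Doo mf C0 fC.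
have mfE : measurable_fun D (EFin \o f) by exact/measurable_EFinP.
have le1 : (\int[mu]_(x in D) `|(EFin \o f) x| <= C%:E * mu D)%E.
  apply: integral_le_bound; rewrite ?lee_fin//.
have Dfin : mu D \is a fin_num by rewrite ge0_fin_numE.
have fi : mu.-integrable D (EFin \o f).
  apply/integrableP; split => //; apply: le_lt_trans le1 _.
  by rewrite -(fineK Dfin) -EFinM ltry.
apply: le_trans (le_normr_Rintegral mD fi) _.
rewrite -lee_fin EFinM (fineK Dfin) /Rintegral fineK//.
by apply: integrable_fin_num => //; exact: (integrable_abse fi).
Qed.

End Rintegral_extra.

Lemma cvg_prod_seq (R : realType) (I : Type) (s : seq I) (u : I -> nat -> R) (l : I -> R) :
  (forall i, u i k @[k --> \oo] --> l i) ->
  \prod_(i <- s) u i k @[k --> \oo] --> \prod_(i <- s) l i.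
Proof.
move=> ul; elim: s => [|i s IH].
  rewrite big_nil (_ : (fun _ => _) = cst (1 : R)); first exact: cvg_cst.
  by apply/funext => k; rewrite big_nil.
rewrite big_cons (_ : (fun _ => _) = (fun k => u i k * \prod_(j <- s) u j k)).
  by apply: cvgM.
by apply/funext => k; rewrite big_cons.
Qed.

(** * From bounded weak derivatives to pointwise bounds, scalar case *)

Section scalar_weak_derivative.
Context (R : realType) (n : nat) (U : set 'rV[R]_n) (w : 'rV[R]_n -> R)
  (Gam : 'I_n -> 'rV[R]_n -> R) (L : R).
Hypothesis mU : measurable U.
Hypothesis mw : measurable_fun U w.
Hypothesis iw : forall a b, closed_box a b `<=` U ->
  (leb R n).-integrable (closed_box a b) (EFin \o w).
Hypothesis mGam : forall i, measurable_fun U (Gam i).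
Hypothesis L0 : 0 <= L.
Hypothesis GamL : forall i, {ae leb R n, forall x, U x -> `|Gam i x| <= L}.
Hypothesis weak : forall g i, test_function U g ->
  \int[leb R n]_(x in U) (w x * partial_deriv i g x) =
  - \int[leb R n]_(x in U) (Gam i x * g x).

Implicit Types (a b lo hi : 'I_n -> R).

Lemma tensor_bump_cvg a b x :
  tensor (fun j => bump (a j) (b j) k) x @[k --> \oo] --> (\1_(open_box a b) x : R).
Proof.
have -> : \1_(open_box a b) x = \prod_j (\1_`]a j, b j[ (x 0 j) : R).
  have [xab|xab] := pselect (open_box a b x).
    rewrite indicE mem_set// big1// => j _.
    by rewrite indicE mem_set//; exact: xab.
  rewrite indicE memNset//; move/existsNP: xab => [j xj].
  by rewrite (bigD1 j)//= indicE memNset ?mul0r.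
by apply: cvg_prod_seq => j; exact: bump_cvg.
Qed.

Lemma tensor_bump_ge0 a b k x : 0 <= tensor (fun j => bump (a j) (b j) k) x.
Proof. by apply: prodr_ge0 => j _; exact: bump_ge0. Qed.

Lemma tensor_bump_le1 a b k x : tensor (fun j => bump (a j) (b j) k) x <= 1.
Proof. by apply: prodr_ile1 => j; rewrite bump_ge0 bump_le1. Qed.

Lemma measurable_tensor_bump a b k :
  measurable_fun setT (tensor (fun j => bump (a j) (b j) k)).
Proof. by apply: measurable_tensor => j; exact: measurable_bump. Qed.

Lemma cvg_integral_tensor_bump a b lo hi : closed_box lo hi `<=` U ->
  open_box a b `<=` closed_box lo hi ->
  \int[leb R n]_(x in closed_box lo hi) (w x * tensor (fun j => bump (a j) (b j) k) x)
    @[k --> \oo] --> \int[leb R n]_(x in open_box a b) w x.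
Proof.
move=> boxU ablh.
have mB := measurable_closed_box lo hi.
have -> : \int[leb R n]_(x in open_box a b) w x =
    \int[leb R n]_(x in closed_box lo hi) (w x * \1_(open_box a b) x).
  rewrite (Rintegral_support _ ablh).
    by apply: eq_Rintegral => x /[!inE] xab; rewrite indicE mem_set// mulr1.
  by move=> x _ xab; rewrite indicE memNset// mulr0.
have mwB : measurable_fun (closed_box lo hi) w by exact: measurable_funS mw.
apply: (@Rintegral_dominated_cvg _ _ R (leb R n) _ _ _ (fun x => `|w x|)) => //.
- move=> k; apply: measurable_funM => //; apply: measurable_funTS.
  exact: measurable_tensor_bump.
- by move=> x _; apply: cvgM; [exact: cvg_cst|exact: tensor_bump_cvg].
- exact: (integrable_abse (iw boxU)).
- move=> k x _; rewrite normrM ler_piMr// ger0_norm ?tensor_bump_ge0//.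
  exact: tensor_bump_le1.
Qed.

(* Tests the weak derivative in direction i against a tensor product of bumps
   whose i-th factor is replaced by the compactly supported primitive of
   mass_balanced_primitive. *)
Lemma box_exchange_bump a b lo hi i k (a' := upd a i (lo i)) (b' := upd b i (hi i))
    (m := mass (bump (a i) (b i) k)) (m' := mass (bump (lo i) (hi i) k)) :
  closed_box lo hi `<=` U ->
  (forall j, lo j <= a j) -> (forall j, a j < b j) -> (forall j, b j <= hi j) ->
  `|m' * \int[leb R n]_(x in closed_box a' b') (w x * tensor (fun j => bump (a j) (b j) k) x)
    - m * \int[leb R n]_(x in closed_box a' b') (w x * tensor (fun j => bump (a' j) (b' j) k) x)|
    <= L * (m * m') * \prod_j (b' j - a' j).
Proof.
move=> boxU loa ab bhi.
have a'b' j : a' j < b' j.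
  rewrite /a' /b' /upd; case: eqP => // _.
  exact: le_lt_trans (loa i) (lt_le_trans (ab i) (bhi i)).
have lohi : lo i < hi i by have := a'b' i; rewrite /a' /b' !updE.
have KU : closed_box a' b' `<=` U.
  apply: subset_trans boxU => x xK j; have := xK j; rewrite !in_itv/= /a' /b' /upd.
  case: eqP => [->//|_ /andP[h1 h2]].
  by rewrite (le_trans (loa j) h1) (le_trans h2 (bhi j)).
have mK := measurable_closed_box a' b'.
have sub : open_box a b `<=` open_box a' b'.
  move=> x xab j; have := xab j; rewrite !in_itv/= /a' /b' /upd.
  case: eqP => [-> /andP[h1 h2]|//].
  by rewrite (le_lt_trans (loa i) h1) (lt_le_trans h2 (bhi i)).
pose f j := bump (a j) (b j) k; pose F j := bump (a' j) (b' j) k.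
have bump_out' c e t : t \notin `]lo i, hi i[ -> lo i <= c -> e <= hi i -> bump c e k t = 0.
  move=> th lc eh; apply: bump_out; apply: contra th; rewrite !in_itv/= => /andP[h1 h2].
  by rewrite (le_lt_trans lc h1) (lt_le_trans h2 eh).
have [P [sP dP Pout Ple]] := mass_balanced_primitive lohi
  (smooth1_bump (a i) (b i) k) (smooth1_bump (lo i) (hi i) k)
  (bump_ge0 (a i) (b i) k) (bump_ge0 (lo i) (hi i) k)
  (integrable_bump (a i) (b i) k) (integrable_bump (lo i) (hi i) k)
  (fun x h => bump_out' _ _ x h (loa i) (bhi i))
  (fun x h => bump_out' _ _ x h (lexx _) (lexx _)).
rewrite -/m -/m' in dP Ple.
pose g := tensor (upd f i P).
have gout x : ~ open_box a' b' x -> g x = 0.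
  apply: tensor_out => j t; rewrite /upd /a' /b' /upd; case: eqP => [_|_]; first exact: Pout.
  exact: bump_out.
have tg : test_function U g.
  apply: (test_function_tensor (lo := a') (hi := b')) => //.
    by move=> j; rewrite /upd; case: ifP => // _; exact: smooth1_bump.
  move=> j t; rewrite /upd /a' /b' /upd; case: eqP => [_|_]; first exact: Pout.
  exact: bump_out.
have dg x : partial_deriv i g x = m' * tensor f x - m * tensor F x.
  have dPi t : is_derive t (1 : R) (upd f i P i) (m' * bump (a i) (b i) k t - m * bump (lo i) (hi i) k t).
    by rewrite updE.
  have tD (h : 'I_n -> R -> R) : tensor h x = h i (x 0 i) * \prod_(j | j != i) h j (x 0 j).
    by rewrite /tensor (bigD1 i).
  rewrite (partial_deriv_tensor dPi) tensor_upd (tD f) (tD F).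
  rewrite {1}/F {1}/f /a' /b' !updE mulrBl !mulrA; congr (_ * _ - _ * _).
    by apply: eq_bigr => j ji; rewrite upd_neq.
  by apply: eq_bigr => j ji; rewrite /F /a' /b' !upd_neq.
have mwK : measurable_fun (closed_box a' b') w by exact: measurable_funS mw.
have iwt c e : (leb R n).-integrable (closed_box a' b')
    (EFin \o (fun x => w x * tensor (fun j => bump (c j) (e j) k) x)).
  apply: (@integrable_mul_bounded _ _ _ _ _ _ _ 1) => //; first exact: iw.
    by apply: measurable_funTS; exact: measurable_tensor_bump.
  by move=> x _; rewrite ger0_norm ?tensor_bump_ge0 ?tensor_bump_le1.
have iwt' c e r : (leb R n).-integrable (closed_box a' b')
    (EFin \o (fun x => r * (w x * tensor (fun j => bump (c j) (e j) k) x))).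
  exact: (integrableZl mK r (iwt c e)).
have -> : m' * \int[leb R n]_(x in closed_box a' b') (w x * tensor f x)
    - m * \int[leb R n]_(x in closed_box a' b') (w x * tensor F x) =
    \int[leb R n]_(x in U) (w x * partial_deriv i g x).
  rewrite (Rintegral_support _ KU); last first.
    move=> x _ xK; rewrite dg (@tensor_out _ _ _ a b); last 2 first.
    - by move=> j t; exact: bump_out.
    - by move=> xo; apply: xK; apply: open_box_sub; exact: sub.
    rewrite (@tensor_out _ _ _ a' b') ?mulr0 ?subrr ?mulr0//.
    - by move=> j t; exact: bump_out.
    - by move=> xo; apply: xK; exact: open_box_sub.
  have e1 := RintegralZl m' mK (iwt a b).
  have e2 := RintegralZl m mK (iwt a' b').
  have e3 := RintegralB mK (iwt' a b m') (iwt' a' b' m).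
  apply: etrans (etrans (esym e3) _); first by rewrite e1 e2.
  by apply: eq_Rintegral => x _; rewrite dg; ring.
rewrite (weak _ tg) normrN (Rintegral_support _ KU); last first.
  by move=> x _ xK; rewrite gout ?mulr0// => xo; apply: xK; exact: open_box_sub.
have vK : leb R n (closed_box a' b') = (\prod_j (b' j - a' j))%:E.
  by apply: leb_box => j; exact: ltW.
have -> : \prod_j (b' j - a' j) = fine (leb R n (closed_box a' b')) by rewrite vK.
have mm0 : 0 <= m * m' by rewrite mulr_ge0//; apply: Rintegral_ge0 => x _; exact: bump_ge0.
apply: normr_Rintegral_le_ae => //.
- by rewrite [ltLHS]vK ltry.
- apply: measurable_funM; first exact: measurable_funS (mGam i).
  apply: measurable_funTS; apply: measurable_tensor => j; rewrite /upd.
  by case: ifP => _; [apply: continuous_measurable_fun; exact: smooth1_continuous|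
    exact: measurable_bump].
- exact: mulr_ge0.
- apply: ae_mono (GamL i) => x h xK; rewrite normrM.
  apply: ler_pM => //; first exact/h/KU.
  rewrite /g tensor_upd normrM -[leRHS]mulr1; apply: ler_pM => //.
  rewrite ger0_norm; last by apply: prodr_ge0 => j _; exact: bump_ge0.
  by apply: prodr_ile1 => j; rewrite bump_ge0 bump_le1.
Qed.

(** Limit of sharp bumps: masses become side lengths, and the integrals converge by dominated
    convergence because [w] is integrable on closed boxes in [U]. *)
Lemma box_exchange a b lo hi i (a' := upd a i (lo i)) (b' := upd b i (hi i)) :
  closed_box lo hi `<=` U ->
  (forall j, lo j <= a j) -> (forall j, a j < b j) -> (forall j, b j <= hi j) ->
  `|(hi i - lo i) * \int[leb R n]_(x in open_box a b) w x
    - (b i - a i) * \int[leb R n]_(x in open_box a' b') w x|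
    <= L * ((b i - a i) * (hi i - lo i)) * \prod_j (b' j - a' j).
Proof.
move=> boxU loa ab bhi.
have lohi : lo i <= hi i.
  exact: (le_trans (loa i) (le_trans (ltW (ab i)) (bhi i))).
have KU : closed_box a' b' `<=` U.
  apply: subset_trans boxU => x xK j; have := xK j; rewrite !in_itv/= /a' /b' /upd.
  case: eqP => [->//|_ /andP[h1 h2]].
  by rewrite (le_trans (loa j) h1) (le_trans h2 (bhi j)).
have sub : open_box a b `<=` closed_box a' b'.
  apply: subset_trans (@open_box_sub _ _ _ _).
  move=> x xab j; have := xab j; rewrite !in_itv/= /a' /b' /upd.
  case: eqP => [-> /andP[h1 h2]|//].
  by rewrite (le_lt_trans (loa i) h1) (lt_le_trans h2 (bhi i)).
have c1 := cvg_integral_tensor_bump KU sub.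
have c2 := cvg_integral_tensor_bump KU (@open_box_sub _ _ a' b').
have m1 := cvg_mass_bump (ltW (ab i)).
have m2 := cvg_mass_bump lohi.
apply: (ler_cvg_to (cvg_norm (cvgB (cvgM m2 c1) (cvgM m1 c2)))
  (cvgM (cvgM (cvg_cst L) (cvgM m1 m2)) (cvg_cst (\prod_j (b' j - a' j))))).
by apply: nearW => k; exact: box_exchange_bump.
Qed.

Definition box_average a b : R :=
  (\prod_j (b j - a j))^-1 * \int[leb R n]_(x in open_box a b) w x.

(** Dividing [box_exchange] by the volumes cancels the sides of the inner box: the bound involves
    only the outer side, however thin the inner box is. This uniformity is what survives the passage
    to points. *)
Lemma box_average_exchange a b lo hi i (a' := upd a i (lo i)) (b' := upd b i (hi i)) :
  closed_box lo hi `<=` U ->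
  (forall j, lo j <= a j) -> (forall j, a j < b j) -> (forall j, b j <= hi j) ->
  `|box_average a b - box_average a' b'| <= L * (hi i - lo i).
Proof.
move=> boxU loa ab bhi; have := box_exchange i boxU loa ab bhi.
rewrite -/a' -/b' /box_average.
set X := \int[_]_(_ in open_box a b) _; set X' := \int[_]_(_ in open_box a' b') _.
have -> : \prod_j (b j - a j) = (b i - a i) * \prod_(j | j != i) (b j - a j).
  by rewrite (bigD1 i).
have -> : \prod_j (b' j - a' j) = (hi i - lo i) * \prod_(j | j != i) (b j - a j).
  rewrite (bigD1 i)//= /a' /b' !updE; congr (_ * _).
  by apply: eq_bigr => j ji; rewrite !upd_neq.
set c := \prod_(_ | _) _.
have s0 : 0 < b i - a i by rewrite subr_gt0.
have t0 : 0 < hi i - lo i.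
  by rewrite subr_gt0; exact: le_lt_trans (loa i) (lt_le_trans (ab i) (bhi i)).
have c0 : 0 < c by apply: prodr_gt0 => j _; rewrite subr_gt0.
set s := b i - a i in s0 *; set t := hi i - lo i in t0 *.
have -> : (s * c)^-1 * X - (t * c)^-1 * X' = (t * X - s * X') / (s * t * c).
  by field; rewrite !gt_eqF.
rewrite normrM [X in _ * X <= _]ger0_norm; last by rewrite invr_ge0 !mulr_ge0// ltW.
rewrite ler_pdivrMr; last by rewrite !mulr_gt0.
by move=> /le_trans; apply; rewrite le_eqVlt; apply/orP; left; apply/eqP; ring.
Qed.

Lemma box_average_sub a b lo hi l : closed_box lo hi `<=` U ->
  (forall j, lo j <= a j) -> (forall j, a j < b j) -> (forall j, b j <= hi j) ->
  (forall j, hi j - lo j = l) ->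
  `|box_average a b - box_average lo hi| <= n%:R * (L * l).
Proof.
move=> boxU loa ab bhi side.
(* Hybrid boxes: the first [k] sides are already those of the outer box, and each further side costs
   one exchange, that is [L * l]. *)
pose ha k j := if (nat_of_ord j < k)%N then lo j else a j.
pose hb k j := if (nat_of_ord j < k)%N then hi j else b j.
have lohi j : lo j < hi j by exact: le_lt_trans (loa j) (lt_le_trans (ab j) (bhi j)).
have chain k : (k <= n)%N ->
    `|box_average a b - box_average (ha k) (hb k)| <= k%:R * (L * l).
  elim: k => [_|k IH kn].
    have -> : ha 0%N = a by apply/funext.
    have -> : hb 0%N = b by apply/funext.
    by rewrite subrr normr0 mul0r.
  have -> : ha k.+1 = upd (ha k) (Ordinal kn) (lo (Ordinal kn)).
    apply/funext => j; rewrite /upd /ha; case: eqVneq => [->|]; first by rewrite /= ltnSn.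
    by rewrite -val_eqE/= ltnS leq_eqVlt => /negPf ->.
  have -> : hb k.+1 = upd (hb k) (Ordinal kn) (hi (Ordinal kn)).
    apply/funext => j; rewrite /upd /hb; case: eqVneq => [->|]; first by rewrite /= ltnSn.
    by rewrite -val_eqE/= ltnS leq_eqVlt => /negPf ->.
  have := @box_average_exchange (ha k) (hb k) lo hi (Ordinal kn) boxU.
  rewrite side => ex; rewrite -natr1 mulrDl mul1r.
  apply: le_trans (lerD (IH (ltnW kn)) (ex _ _ _)).
  - by rewrite -[X in `|X|](subrKA (box_average (ha k) (hb k))) ler_normD.
  - by move=> j; rewrite /ha; case: ifP.
  - by move=> j; rewrite /ha /hb; case: ifP.
  - by move=> j; rewrite /hb; case: ifP.
have := chain n (leqnn n).
have -> : ha n = lo by apply/funext => j; rewrite /ha ltn_ord.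
by have -> : hb n = hi by apply/funext => j; rewrite /hb ltn_ord.
Qed.

Lemma cube_sub_box N x lo hi : dyadic_cube N x `<=` open_box lo hi ->
  (forall j, lo j <= cube_lo N x j) /\ (forall j, cube_hi N x j <= hi j).
Proof.
move=> sub; have mem (y : 'rV[R]_n) : (forall j, cube_lo N x j <= y 0 j < cube_hi N x j) ->
    forall j, lo j < y 0 j < hi j.
  move=> h j; have : open_box lo hi y.
    by apply: sub; rewrite dyadic_cubeE => i; rewrite in_itv/=.
  by move=> /(_ j); rewrite in_itv.
split=> j.
  have /mem/(_ j) : forall i, cube_lo N x i <= (\row_i cube_lo N x i) 0 i < cube_hi N x i.
    by move=> i; rewrite mxE lexx cube_lo_le_hi.
  by rewrite mxE => /andP[/ltW].
rewrite leNgt; apply/negP => hj.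
(* If the cube passed [hi j], this point, a lower corner pushed up to [hi j] in direction [j], would
   be in the cube but not in the open box. *)
pose y : 'rV[R]_n := \row_i (if i == j then Num.max (hi j) (cube_lo N x j) else cube_lo N x i).
have /mem/(_ j) : forall i, cube_lo N x i <= y 0 i < cube_hi N x i.
  move=> i; rewrite mxE; case: eqP => [->|_]; last by rewrite lexx cube_lo_le_hi.
  by rewrite le_max lexx orbT gt_max hj cube_lo_le_hi.
by rewrite mxE eqxx gt_max ltxx andbF.
Qed.

(** The average over every cube in [V] is within [n * (L * l)] of the average over the large box, so
    the dyadic comparison applies. An upper bound is enough because directions of both signs are
    tested later. *)
Lemma ae_le_box_average (V : set 'rV[R]_n) lo hi l : closed_box lo hi `<=` U ->
  eucl_open V -> V `<=` open_box lo hi ->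
  (forall j, hi j - lo j = l) -> 0 < l ->
  {ae leb R n, forall x, V x -> w x <= box_average lo hi + n%:R * (L * l)}.
Proof.
move=> boxU oV Vbox side l0; set B := _ + _.
have mV := measurable_eucl_open oV.
have mC := measurable_closed_box lo hi.
have VC : V `<=` closed_box lo hi by apply: subset_trans Vbox _; exact: open_box_sub.
have iwV : (leb R n).-integrable V (EFin \o w) by apply: integrableS (iw boxU).
have lebC : leb R n (closed_box lo hi) = (\prod_j (hi j - lo j))%:E.
  by apply: leb_box => j; rewrite -subr_ge0 side ltW.
have Voo : (leb R n V < +oo)%E.
  by apply: (@le_lt_trans _ _ (leb R n (closed_box lo hi))); [rewrite le_measure ?inE|rewrite lebC ltry].
(* The dyadic comparison asks for nonnegative functions: the positive and negative parts of [w] go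
   to opposite sides and [|B|] is added to both, so that [g - f] is still [B - w]. *)
pose f x := Num.max (w x) 0 + `|B|; pose g x := Num.max (- w x) 0 + (`|B| + B).
have fg x : g x - f x = B - w x.
  rewrite /f /g; case: (leP (w x) 0) => w0; case: (leP (- w x) 0) => w1; lra.
have mwV : measurable_fun V w by apply: measurable_funS mw => //; exact: subset_trans boxU.
have mf : measurable_fun V f.
  by apply: measurable_funD => //; apply: measurable_maxr.
have mg : measurable_fun V g.
  by apply: measurable_funD => //; apply: measurable_maxr => //; exact: measurableT_comp.
have B0 : 0 <= `|B| + B by have := ler_norm (- B); rewrite normrN; lra.
have f0 x : 0 <= f x by rewrite addr_ge0// le_max lexx orbT.
have g0 x : 0 <= g x by rewrite addr_ge0// le_max lexx orbT.
have ic (c : R) : (leb R n).-integrable V (EFin \o cst c).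
  apply: measurable_bounded_integrable => //.
  exact: bounded_cst.
have iN : (leb R n).-integrable V (EFin \o (fun x => `|w x|)) by exact: (integrable_abse iwV).
have if_ : (leb R n).-integrable V (EFin \o f).
  apply: le_integrable (integrableD mV iN (ic `|B|)) => //; first exact/measurable_EFinP.
  move=> x _ /=; rewrite !lee_fin/= [leRHS]ger0_norm ?addr_ge0// ger0_norm//.
  by rewrite lerD2r ge_max ler_norm normr_ge0.
have ig_ : (leb R n).-integrable V (EFin \o g).
  apply: le_integrable (integrableD mV iN (ic (`|B| + B))) => //; first exact/measurable_EFinP.
  move=> x _ /=; rewrite !lee_fin/= [leRHS]ger0_norm; last exact: addr_ge0.
  rewrite (ger0_norm (g0 x)).
  by rewrite lerD2r ge_max -normrN ler_norm normr_ge0.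
have lty (h : 'rV[R]_n -> R) : (forall x, 0 <= h x) -> (leb R n).-integrable V (EFin \o h) ->
    (\int[leb R n]_(x in V) (h x)%:E < +oo)%E.
  move=> h0 /integrableP[_]; under eq_integral do rewrite gee0_abs ?lee_fin//.
  by [].
suff : {ae leb R n, forall x, V x -> f x <= g x}.
  by apply: ae_mono => x h Vx; have := h Vx; rewrite -subr_ge0 fg subr_ge0.
apply: (@ae_le_of_dyadic_cubes _ _ _ _ _ _ 0%N) => //.
- exact: lty.
- exact: lty.
move=> N x _ QV.
have mQ := measurable_dyadic_cube N x.
have Qbox : dyadic_cube N x `<=` open_box lo hi by exact: subset_trans Vbox.
have [h1 h2] := cube_sub_box Qbox.
have CU : closed_box (cube_lo N x) (cube_hi N x) `<=` U.
  apply: subset_trans boxU => y yC j; have := yC j; rewrite !in_itv/= => /andP[u v].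
  by rewrite (le_trans (h1 j) u) (le_trans v (h2 j)).
have ifQ : (leb R n).-integrable (dyadic_cube N x) (EFin \o f) by exact: integrableS if_.
have igQ : (leb R n).-integrable (dyadic_cube N x) (EFin \o g) by exact: integrableS ig_.
have iwQ : (leb R n).-integrable (dyadic_cube N x) (EFin \o w) by exact: integrableS iwV.
have icQ c : (leb R n).-integrable (dyadic_cube N x) (EFin \o cst c) by exact: integrableS (ic c).
have finQ (h : 'rV[R]_n -> R) : (leb R n).-integrable (dyadic_cube N x) (EFin \o h) ->
    (\int[leb R n]_(y in dyadic_cube N x) (h y)%:E)%E \is a fin_num.
  by move=> ih; exact: integrable_fin_num.
rewrite -(fineK (finQ f ifQ)) -(fineK (finQ g igQ)) lee_fin.
rewrite -subr_ge0 -[leRHS](RintegralB mQ igQ ifQ).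
have -> : \int[leb R n]_(y in dyadic_cube N x) (g y - f y) =
    \int[leb R n]_(y in dyadic_cube N x) (B - w y).
  by apply: eq_Rintegral => y _; exact: fg.
rewrite (RintegralB mQ (icQ B) iwQ) Rintegral_cst// subr_ge0.
rewrite [X in fine X]leb_dyadic_cube/=.
have -> : \int[leb R n]_(y in dyadic_cube N x) w y =
    \int[leb R n]_(y in open_box (cube_lo N x) (cube_hi N x)) w y.
  rewrite /Rintegral (integral_between_boxes mQ (@open_box_sub_cube _ _ _ _) (@cube_sub_closed_box _ _ _ _) (iw CU)).
  by rewrite (integral_between_boxes (measurable_open_box _ _) (@subset_refl _ _) (@open_box_sub _ _ _ _) (iw CU)).
have := box_average_sub boxU h1 (@cube_lo_le_hi _ _ N x) h2 side.
rewrite {1}/box_average (eq_bigr (fun=> 2 ^- N)); last by move=> j _; exact: cube_side.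
rewrite prodr_const card_ord => /ler_normlP[_].
have e0 : 0 < (2 ^- N) ^+ n :> R by rewrite exprn_gt0// invr_gt0 exprn_gt0.
by rewrite lerBlDl -ler_pdivrMr// mulrC.
Qed.

End scalar_weak_derivative.

(** * Poincare estimate for vector-valued functions, uniform in p *)

Section vector_poincare.
Context (R : realType) (n p : nat).
Implicit Types (U : set 'rV[R]_n).

Lemma open_eucl_open (O : set 'rV[R]_n) : open O -> eucl_open O.
Proof.
move=> oO x Ox; have /nbhs_ballP[e /= e0 eO] : nbhs x O by exact: open_nbhs_nbhs.
exists e => // y xy; apply: eO; rewrite mx_norm_ball /ball_/= -opprB normrN.
rewrite [ltLHS]mx_normrE; apply/bigmax_ltP; split => // -[i j] _ /=.
rewrite ord1; apply: le_lt_trans xy; exact: eucl_norm_coord.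
Qed.

Lemma measurable_closed_rV (K : set 'rV[R]_n) : closed K -> measurable K.
Proof.
move=> cK; rewrite -[K]setCK; apply: measurableC; apply: measurable_eucl_open.
by apply: open_eucl_open; exact: closed_openC.
Qed.

Lemma compact_bounded_continuous (K : set 'rV[R]_n) (h : 'rV[R]_n -> R) :
  compact K -> continuous h -> exists M, forall x, K x -> `|h x| <= M.
Proof.
move=> cK ch.
have : compact (h @` K).
  by apply: continuous_compact => //; exact: continuous_subspaceT.
move=> /compact_bounded[M [Mr hM]]; exists (M + 1) => x Kx.
by apply: hM; [rewrite ltrDl|exists x].
Qed.

Lemma continuous_measurable_rV (h : 'rV[R]_n -> R) : continuous h -> measurable_fun setT h.
Proof.
move=> ch; apply: (@measurability _ _ _ _ _ _ _ (@RGenOpens.measurableE R)).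
move=> _ [_ [a [b ->] <-]]; rewrite setTI.
apply: measurable_eucl_open; apply: open_eucl_open.
by apply: open_comp => // x _; exact: ch.
Qed.

(** Both [g] and its derivative are continuous and vanish off the compact support, so they are
    bounded there and integrability of [f] on compact sets is enough. *)
Lemma test_function_integrable U (f : 'rV[R]_n -> R) (g : 'rV[R]_n -> R) (i : 'I_n) :
  measurable U -> measurable_fun U f ->
  (forall C, compact C -> C `<=` U -> (leb R n).-integrable C (EFin \o f)) ->
  test_function U g ->
  (leb R n).-integrable U (EFin \o (fun x => f x * g x)) /\
  (leb R n).-integrable U (EFin \o (fun x => f x * partial_deriv i g x)).
Proof.
move=> mU mf fi [sg cK KU]; set K := closure _ in cK KU.
have closK : closed K by exact: closed_closure.
have mK := measurable_closed_rV closK.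
have g0 x : ~ K x -> g x = 0.
  move=> nKx; apply/eqP/negP => /negP gx; apply: nKx.
  by apply: subset_closure.
have dg0 x : ~ K x -> partial_deriv i g x = 0.
  move=> nKx; rewrite /partial_deriv.
  have : {near x, g =1 cst 0}.
    have /open_nbhs_nbhs : open_nbhs x (~` K) by split => //; exact: closed_openC.
    by apply: filterS => y /g0.
  move=> /near_eq_derive ->; exact: derive_cst.
have [cg _] := sg [::]; have [cdg _] := sg [:: i].
have key h : continuous h -> (forall x, ~ K x -> h x = 0) ->
    (leb R n).-integrable U (EFin \o (fun x => f x * h x)).
  move=> ch h0; have [M hM] := compact_bounded_continuous cK ch.
  have mh := continuous_measurable_rV ch.
  have iK : (leb R n).-integrable K (EFin \o (fun x => f x * h x)).
    apply: (integrable_mul_bounded mK (fi _ cK KU) (C := M)) => //.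
    exact: measurable_funTS.
  have -> : EFin \o (fun x => f x * h x) = (EFin \o (fun x => f x * h x)) \_ K.
    apply/funext => x; rewrite patchE; case: ifPn => // /negP xK.
    by rewrite /= h0 ?mulr0// => Kx; apply: xK; rewrite inE.
  by apply/integrable_restrict => //; rewrite setIidr.
by split; exact: key.
Qed.

(* Rational directions reduce an a.e. bound on a vector to countably many
   scalar ones, with a constant independent of the dimension p. *)
Lemma rational_direction_bound (y : 'rV[R]_p) (A : R) : 0 <= A ->
  (forall q : 'rV[rat]_p, \sum_j ratr (q 0 j) * y 0 j <=
     eucl_norm (map_mx ratr q : 'rV[R]_p) * A) ->
  eucl_norm y <= A.
Proof.
move=> A0 H; set N := eucl_norm y.
have N0 : 0 <= N by exact: eucl_norm_ge0.
rewrite leNgt; apply/negP => AN.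
have N1 : 0 < N by exact: le_lt_trans AN.
(* Chosen so that [(p + 1) * e * (N + A)] equals [N * (N - A) / 2], whereas testing against a
   rational vector within [e] of [y] in each coordinate forces [N * (N - A) <= p * e * (N + A)]. *)
pose e : R := N * (N - A) / (2 * (p%:R + 1) * (N + A)).
have p1 : 0 < p%:R + 1 :> R by rewrite ltr_wpDl.
have D0 : 0 < 2 * (p%:R + 1) * (N + A) by rewrite !mulr_gt0// ltr_pwDl.
have e0 : 0 < e by rewrite divr_gt0// mulr_gt0// subr_gt0.
have /choice[q hq] : forall j, exists q : rat, y 0 j - e < ratr q < y 0 j + e.
  move=> j; have : y 0 j - e < y 0 j + e by lra.
  by move=> /rat_in_itvoo[q]; rewrite in_itv/=; exists q.
have := H (\row_j q j).
set v : 'rV[R]_p := map_mx _ _.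
have vE j : v 0 j = ratr (q j) by rewrite !mxE.
have vy : eucl_norm (v - y) <= p%:R * e.
  apply: eucl_norm_le_coord; first exact: ltW.
  move=> j; rewrite !mxE ler_norml; have /andP[h1 h2] := hq j.
  by apply/andP; split; lra.
have Nv : eucl_norm v <= N + p%:R * e.
  have := ler_eucl_normD (v - y) y; rewrite subrK -/N => /le_trans; apply.
  by rewrite addrC lerD2l.
have dvy : N ^+ 2 - p%:R * e * N <= \sum_j ratr ((\row_j q j) 0 j) * y 0 j.
  have -> : \sum_j ratr ((\row_j q j) 0 j) * y 0 j = N ^+ 2 - \sum_j (y - v) 0 j * y 0 j.
    rewrite /N sqr_eucl_norm_row -sumrB; apply: eq_bigr => j _.
    rewrite !mxE; ring.
  rewrite lerD2l lerN2; apply: le_trans (dot_le _ _) _.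
  by rewrite ler_wpM2r// eucl_normBC.
move=> h.
have : N * (N - A) <= p%:R * e * (N + A).
  have : eucl_norm v * A <= (N + p%:R * e) * A by rewrite ler_wpM2r.
  by nra.
have pe : p%:R * e <= (p%:R + 1) * e by rewrite (ler_wpM2r (ltW e0))// lerDl.
have NA : 0 < N + A by rewrite ltr_pwDl.
have : p%:R * e * (N + A) <= (p%:R + 1) * e * (N + A) by rewrite (ler_wpM2r (ltW NA)).
have -> : (p%:R + 1) * e * (N + A) = N * (N - A) / 2.
  by rewrite /e; field; rewrite ?gt_eqF.
have : 0 < N * (N - A) by rewrite mulr_gt0// subr_gt0.
lra.
Qed.

Lemma ae_countable (T : countType) d (X : measurableType d)
    (mu : {measure set X -> \bar R}) (P : T -> X -> Prop) :
  (forall t, {ae mu, forall x, P t x}) -> {ae mu, forall x, forall t, P t x}.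
Proof.
move=> aeP.
have : {ae mu, forall x, forall k, if choice.unpickle k is Some t then P t x else True}.
  apply/ae_foralln => k; case: (choice.unpickle k) => [t|]; first exact: aeP.
  exact: aeW.
by apply: ae_mono => x h t; have := h (choice.pickle t); rewrite choice.pickleK.
Qed.

Lemma measurable_eucl_norm (k m : nat) :
  measurable_fun setT (@eucl_norm R k m).
Proof.
have msqrt : measurable_fun setT (@Num.sqrt R).
  by apply: continuous_measurable_fun; exact: sqrt_continuous.
apply: (measurableT_comp msqrt).
apply: measurable_sum => i; apply: measurable_sum => j.
by apply: measurable_funX; exact: measurable_entry.
Qed.

(** The cube of half-side [s] around [z] fits in the ball where the gradient is bounded, and each of
    its [n] directions contributes [L * (2 * s)]. The vector [c] collects the averages of the
    components over this cube; averages being linear, the same [c] serves every direction [v]. *)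
Lemma weak_gradient_ae_bound (z : 'rV[R]_n) (r s L : R) (u : 'rV[R]_n -> 'rV[R]_p)
    (G : 'rV[R]_n -> 'M[R]_(p, n)) :
  0 < s -> n%:R * s < r -> 0 <= L -> weak_gradient (eucl_ball z r) u G ->
  {ae leb R n, forall x, eucl_ball z r x -> eucl_norm (G x) <= L} ->
  exists c, {ae leb R n, forall x, eucl_ball z s x ->
    eucl_norm (u x - c) <= n%:R * (L * (2 * s))}.
Proof.
move=> s0 sr L0 [[mu_ lu] [mG lG] weak] GL.
set U := eucl_ball z r in mu_ lu mG lG weak GL *.
have mU : measurable U by exact: measurable_eucl_ball.
have muj j : measurable_fun U (fun x => u x 0 j).
  by apply: (measurableT_comp (@measurable_entry _ _ 1 p 0 j) mu_).
have mGj j i : measurable_fun U (fun x => G x j i).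
  by apply: (measurableT_comp (@measurable_entry _ _ p n j i) mG).
have icomp (h k : 'rV[R]_n -> R) : measurable_fun U h -> measurable_fun U k ->
    (forall x, `|h x| <= k x) ->
    (forall C : set 'rV[R]_n, compact C -> C `<=` U ->
      (\int[leb R n]_(x in C) (k x)%:E < +oo)%E) ->
    forall C, compact C -> C `<=` U -> (leb R n).-integrable C (EFin \o h).
  move=> mh mk hk lk C cC CU.
  have mC : measurable C.
    apply: measurable_closed_rV; apply: compact_closed => //; exact: norm_hausdorff.
  apply/integrableP; split; first by apply/measurable_EFinP; exact: measurable_funS mh.
  apply: le_lt_trans (lk C cC CU); apply: ge0_le_integral => //.
  - by apply: measurableT_comp => //; apply/measurable_EFinP; exact: measurable_funS mh.
  - by apply/measurable_EFinP; exact: measurable_funS mk.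
  - by move=> x _; rewrite lee_fin.
have mnu : measurable_fun U (fun x => eucl_norm (u x)).
  exact: (measurableT_comp (@measurable_eucl_norm 1 p) mu_).
have mnG : measurable_fun U (fun x => eucl_norm (G x)).
  exact: (measurableT_comp (@measurable_eucl_norm p n) mG).
have iuj j := icomp (fun x => u x 0 j) _ (muj j) mnu (fun x => eucl_norm_coord (u x) 0 j) lu.
have iGj j i := icomp (fun x => G x j i) _ (mGj j i) mnG (fun x => eucl_norm_coord (G x) j i) lG.
pose lo i := z 0 i - s; pose hi i := z 0 i + s.
have boxU : closed_box lo hi `<=` U by apply: sup_ball_sub_eucl_ball => //; exact: ltW.
have side i : hi i - lo i = 2 * s by rewrite /hi /lo; ring.
pose w (v : 'rV[R]_p) x := \sum_j v 0 j * u x 0 j.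
pose Gam (v : 'rV[R]_p) (i : 'I_n) x := \sum_j v 0 j * G x j i.
have iw v C : compact C -> C `<=` U -> (leb R n).-integrable C (EFin \o w v).
  move=> cC CU.
  have mC : measurable C.
    apply: measurable_closed_rV; apply: compact_closed => //; exact: norm_hausdorff.
  rewrite (_ : EFin \o w v = (fun x => \sum_(j <- index_enum 'I_p) (v 0 j)%:E * (u x 0 j)%:E)%E).
    apply: integrable_sum => // j _; exact: (integrableZl mC (v 0 j) (iuj j C cC CU)).
  by apply/funext => x /=; rewrite /w -sumEFin.
have mw v : measurable_fun U (w v).
  by apply: measurable_sum => j; apply: measurable_funM => //; exact: muj.
have mGam v i : measurable_fun U (Gam v i).
  by apply: measurable_sum => j; apply: measurable_funM => //; exact: mGj.
have GamL v i : {ae leb R n, forall x, U x -> `|Gam v i x| <= eucl_norm v * L}.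
  apply: ae_mono GL => x h Ux; apply: le_trans (dot_col_le _ _ _) _.
  by rewrite ler_wpM2l ?eucl_norm_ge0//; exact: h.
have sum_int (D : set 'rV[R]_n) (v : 'rV[R]_p) (h : 'I_p -> 'rV[R]_n -> R) : measurable D ->
    (forall j, (leb R n).-integrable D (EFin \o h j)) ->
    \int[leb R n]_(x in D) (\sum_j v 0 j * h j x) = \sum_j v 0 j * \int[leb R n]_(x in D) h j x.
  move=> mD ih.
  have ivh j : (leb R n).-integrable D (EFin \o (fun x => v 0 j * h j x)).
    exact: (integrableZl mD (v 0 j) (ih j)).
  transitivity (\sum_j \int[leb R n]_(x in D) (v 0 j * h j x)).
    have ifin j : (\int[leb R n]_(x in D) (v 0 j * h j x)%:E)%E \is a fin_num.
      by apply: integrable_fin_num => //; exact: ivh.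
    rewrite /Rintegral -[RHS]/(fine (\sum_j fine (\int[leb R n]_(x in D) (v 0 j * h j x)%:E))%:E).
    rewrite EFin_sum_fine// -(@integral_sum _ _ _ (leb R n) D mD 'I_p (fun j x => (v 0 j * h j x)%:E))//.
    by congr fine; apply: eq_integral => x _; rewrite sumEFin.
  by apply: eq_bigr => j _; rewrite RintegralZl.
have weakv v g i : test_function U g ->
    \int[leb R n]_(x in U) (w v x * partial_deriv i g x) =
    - \int[leb R n]_(x in U) (Gam v i x * g x).
  move=> tg.
  have iu1 j := (test_function_integrable i mU (muj j) (iuj j) tg).2.
  have iG1 j := (test_function_integrable i mU (mGj j i) (iGj j i) tg).1.
  transitivity (\sum_j v 0 j * \int[leb R n]_(x in U) (u x 0 j * partial_deriv i g x)).
    rewrite -(sum_int _ _ (fun j x => u x 0 j * partial_deriv i g x) mU iu1).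
    by apply: eq_Rintegral => x _; rewrite /w mulr_suml; apply: eq_bigr => j _; rewrite mulrA.
  transitivity (- \sum_j v 0 j * \int[leb R n]_(x in U) (G x j i * g x)).
    rewrite -sumrN; apply: eq_bigr => j _; rewrite -mulrN; congr (_ * _); exact: weak.
  congr (- _).
  rewrite -(sum_int _ _ (fun j x => G x j i * g x) mU iG1).
  by apply: eq_Rintegral => x _; rewrite /Gam mulr_suml; apply: eq_bigr => j _; rewrite mulrA.
pose c : 'rV[R]_p := \row_j box_average (fun x => u x 0 j) lo hi.
have cE v : box_average (w v) lo hi = \sum_j v 0 j * c 0 j.
  have iO j : (leb R n).-integrable (open_box lo hi) (EFin \o (fun x => u x 0 j)).
    apply: (@integrableS _ _ _ _ (closed_box lo hi)).
    - exact: measurable_closed_box.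
    - exact: measurable_open_box.
    - exact: open_box_sub.
    - apply: iuj => //; exact: compact_closed_box.
  rewrite /box_average sum_int//; last exact: measurable_open_box.
  by rewrite mulr_sumr; apply: eq_bigr => j _; rewrite mxE /box_average mulrCA.
exists c.
have aev v : {ae leb R n, forall x, eucl_ball z s x ->
    w v x <= \sum_j v 0 j * c 0 j + n%:R * (eucl_norm v * L * (2 * s))}.
  rewrite -cE; apply: (@ae_le_box_average _ _ U (w v) (Gam v)) => //.
  - by move=> a b abU; apply: iw => //; exact: compact_closed_box.
  - by rewrite mulr_ge0// eucl_norm_ge0.
  - by move=> g i; exact: weakv.
  - exact: eucl_open_ball.
  - exact: eucl_ball_sub_sup_ball.
  - by rewrite mulr_gt0.
have := @ae_countable 'rV[rat]_p _ _ (leb R n) (fun q x => eucl_ball z s x ->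
  w (map_mx ratr q) x <= \sum_j (map_mx ratr q : 'rV[R]_p) 0 j * c 0 j +
    n%:R * (eucl_norm (map_mx ratr q : 'rV[R]_p) * L * (2 * s))) (fun q => aev _).
apply: ae_mono => x h xz; apply: rational_direction_bound.
  by rewrite !mulr_ge0// ltW.
move=> q; have := h q xz; rewrite -lerBlDl /w -sumrB => hq.
have -> : \sum_j ratr (q 0 j) * (u x - c) 0 j =
    \sum_j ((map_mx ratr q : 'rV[R]_p) 0 j * u x 0 j - (map_mx ratr q : 'rV[R]_p) 0 j * c 0 j).
  by apply: eq_bigr => j _; rewrite !mxE mulrBr.
by apply: le_trans hq _; rewrite le_eqVlt; apply/orP; left; apply/eqP; ring.
Qed.

End vector_poincare.

(** * Square-integrable functions *)

Section square_means.
Context (R : realType) (n p : nat).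
Implicit Types (f g : 'rV[R]_n -> 'rV[R]_p) (A : set 'rV[R]_n) (z : 'rV[R]_n) (c : 'rV[R]_p).

Definition sq_integrable A f : Prop := measurable_fun A f /\
  (leb R n).-integrable A (EFin \o (fun x => eucl_norm (f x) ^+ 2)).

Lemma sq_integrableS A D f : measurable A -> measurable D -> A `<=` D ->
  sq_integrable D f -> sq_integrable A f.
Proof.
move=> mA mD AD [mf fi]; split; first exact: measurable_funS mf.
exact: integrableS fi.
Qed.

Lemma measurable_sqr_norm A f : measurable_fun A f ->
  measurable_fun A (fun x => eucl_norm (f x) ^+ 2).
Proof.
move=> mf; apply: measurable_funX.
exact: (measurableT_comp (@measurable_eucl_norm R 1 p) mf).
Qed.

Lemma LnormOn2_powE A f : measurable A ->
  ((LnormOn 2%:E A f) `^ 2 = \int[leb R n]_(x in A) (eucl_norm (f x) ^+ 2)%:E)%E.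
Proof.
move=> mA; rewrite /LnormOn poweR_Lnorm// [RHS]integral_mkcond.
apply: eq_integral => x _ /=; rewrite !patchE; case: ifPn => xA.
  by rewrite /= ger0_norm ?eucl_norm_ge0// powR_mulrn ?eucl_norm_ge0.
by rewrite /= normr0 powR0.
Qed.

Lemma L2On_sq_integrable A f : measurable A -> L2On A f -> sq_integrable A f.
Proof.
move=> mA [mf foo]; split=> //; apply/integrableP; split.
  by apply/measurable_EFinP; exact: measurable_sqr_norm.
under eq_integral do rewrite gee0_abs ?lee_fin ?sqr_ge0//.
rewrite -LnormOn2_powE//; move: foo (Lnorm_ge0 (leb R n) 2%:E (EFin \o ((fun x => eucl_norm (f x)) \_ A))).
by rewrite -/(LnormOn 2%:E A f); case: (LnormOn _ _ _) => // r _ _; rewrite poweR_EFin ltry.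
Qed.

Lemma fine_LnormOn2 A f : measurable A -> L2On A f ->
  fine (LnormOn 2%:E A f) ^+ 2 = \int[leb R n]_(x in A) eucl_norm (f x) ^+ 2.
Proof.
move=> mA [mf foo]; rewrite /Rintegral -LnormOn2_powE//.
have := Lnorm_ge0 (leb R n) 2%:E (EFin \o ((fun x => eucl_norm (f x)) \_ A)).
rewrite -/(LnormOn 2%:E A f); move: foo; case: (LnormOn _ _ _) => // r _.
by rewrite lee_fin => r0; rewrite poweR_EFin/= powR_mulrn.
Qed.

Lemma fine_LnormOn2_ge0 A f : 0 <= fine (LnormOn 2%:E A f).
Proof. by rewrite fine_ge0// Lnorm_ge0. Qed.

Lemma integrable_cst_fin A (c : R) : measurable A -> (leb R n A < +oo)%E ->
  (leb R n).-integrable A (EFin \o cst c).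
Proof.
move=> mA Aoo; apply: measurable_bounded_integrable => //; exact: bounded_cst.
Qed.

Lemma measurable_coord A f j : measurable_fun A f -> measurable_fun A (fun x => f x 0 j).
Proof. by move=> mf; apply: (measurableT_comp (@measurable_entry _ _ 1 p 0 j) mf). Qed.

(** On a set of finite measure, the inequality t <= 1 + t^2 reduces this to square integrability. *)
Lemma integrable_coord A f j : measurable A -> (leb R n A < +oo)%E ->
  sq_integrable A f -> (leb R n).-integrable A (EFin \o (fun x => f x 0 j)).
Proof.
move=> mA Aoo [mf fi].
apply: le_integrable (integrableD mA (integrable_cst_fin 1 mA Aoo) fi) => //.
  by apply/measurable_EFinP; exact: measurable_coord.
move=> x _ /=; rewrite lee_fin [leRHS]ger0_norm; last by rewrite addr_ge0// sqr_ge0.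
apply: le_trans (eucl_norm_coord (f x) 0 j) _.
have := sqr_ge0 (eucl_norm (f x) - 1); have := eucl_norm_ge0 (f x); nra.
Qed.

Lemma sq_integrableB A f g : measurable A -> (leb R n A < +oo)%E ->
  sq_integrable A f -> sq_integrable A g -> sq_integrable A (fun x => f x - g x).
Proof.
move=> mA Aoo [mf fi] [mg gi].
have mB : measurable_fun A (fun x => f x - g x).
  apply: (@measurability _ _ _ _ _ _ (@entry_preimages _ R 1 p)) => //.
  move=> _ [B [[i j] _ [C mC <-]] <-]; rewrite !setTI ord1/=.
  have := measurable_funB (measurable_coord j mf) (measurable_coord j mg).
  move=> /(_ mA C mC); congr (measurable (_ `&` _)).
  by apply/seteqP; split => x /=; rewrite !mxE.
split=> //.
have i2 : (leb R n).-integrable A (EFin \o (fun x => 2 * eucl_norm (f x) ^+ 2)).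
  exact: (integrableZl mA 2 fi).
have i3 : (leb R n).-integrable A (EFin \o (fun x => 2 * eucl_norm (g x) ^+ 2)).
  exact: (integrableZl mA 2 gi).
apply: le_integrable (integrableD mA i2 i3) => //.
  by apply/measurable_EFinP; exact: measurable_sqr_norm.
move=> x _ /=; rewrite lee_fin [leRHS]ger0_norm; last first.
  by apply: addr_ge0; apply: mulr_ge0 => //; exact: sqr_ge0.
rewrite ger0_norm ?sqr_ge0//.
by have := sqr_eucl_normD_le (f x) (- g x); rewrite eucl_normN.
Qed.

Lemma sq_integrable_cst A c : measurable A -> (leb R n A < +oo)%E ->
  sq_integrable A (cst c).
Proof.
move=> mA Aoo; split; first exact: measurable_cst.
exact: (integrable_cst_fin (eucl_norm c ^+ 2) mA Aoo).
Qed.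

Lemma Rintegral_sqr_subE A f c : measurable A -> (leb R n A < +oo)%E ->
  sq_integrable A f ->
  \int[leb R n]_(x in A) eucl_norm (f x - c) ^+ 2 =
  \int[leb R n]_(x in A) eucl_norm (f x) ^+ 2
  - 2 * (\sum_j c 0 j * \int[leb R n]_(x in A) f x 0 j)
  + eucl_norm c ^+ 2 * fine (leb R n A).
Proof.
move=> mA Aoo fs; have [mf fi] := fs.
have ij j := integrable_coord j mA Aoo fs.
have icj j : (leb R n).-integrable A (EFin \o (fun x => c 0 j * f x 0 j)).
  exact: (integrableZl mA (c 0 j) (ij j)).
have isum : (leb R n).-integrable A (EFin \o (fun x => \sum_j c 0 j * f x 0 j)).
  rewrite (_ : EFin \o _ = (fun x => \sum_(j <- index_enum 'I_p) (c 0 j * f x 0 j)%:E)%E).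
    by apply: integrable_sum => // j _; exact: icj.
  by apply/funext => x /=; rewrite -sumEFin.
have i2sum : (leb R n).-integrable A (EFin \o (fun x => 2 * \sum_j c 0 j * f x 0 j)).
  exact: (integrableZl mA 2 isum).
have iB : (leb R n).-integrable A (EFin \o
    (fun x => eucl_norm (f x) ^+ 2 - 2 * \sum_j c 0 j * f x 0 j)).
  exact: (integrableB mA fi i2sum).
have e1 : \int[leb R n]_(x in A) (\sum_j c 0 j * f x 0 j) =
    \sum_j c 0 j * \int[leb R n]_(x in A) f x 0 j.
  transitivity (\sum_j \int[leb R n]_(x in A) (c 0 j * f x 0 j)); last first.
    by apply: eq_bigr => j _; rewrite RintegralZl.
  have ifin j : (\int[leb R n]_(x in A) (c 0 j * f x 0 j)%:E)%E \is a fin_num.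
    by apply: integrable_fin_num => //; exact: icj.
  rewrite /Rintegral -[RHS]/(fine (\sum_j fine (\int[leb R n]_(x in A) (c 0 j * f x 0 j)%:E))%:E).
  rewrite EFin_sum_fine// -(@integral_sum _ _ _ (leb R n) A mA 'I_p (fun j x => (c 0 j * f x 0 j)%:E))//.
  by congr fine; apply: eq_integral => x _; rewrite sumEFin.
rewrite -e1 -RintegralZl// -RintegralB// -Rintegral_cst//.
rewrite -(RintegralD mA iB (integrable_cst_fin (eucl_norm c ^+ 2) mA Aoo)).
apply: eq_Rintegral => x _.
rewrite /cst !sqr_eucl_norm_row mulr_sumr -sumrB -big_split/=.
by apply: eq_bigr => j _; rewrite !mxE; ring.
Qed.

End square_means.

(** * Means, oscillation and density of zeros on balls *)

Section ball_means.
Context (R : realType) (n p : nat).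
Implicit Types (f g : 'rV[R]_n -> 'rV[R]_p) (z : 'rV[R]_n) (r : R) (c : 'rV[R]_p).

Definition mean_sq f z r c : R :=
  (vol z r)^-1 * \int[leb R n]_(x in eucl_ball z r) eucl_norm (f x - c) ^+ 2.

Definition mean f z r : 'rV[R]_p := average (eucl_ball z r) f.

Definition osc f z r : R := oscillation (eucl_ball z r) f.

Definition zero_density f z r : R :=
  (vol z r)^-1 * fine (leb R n (eucl_ball z r `&` [set x | f x = 0])).

Lemma leb_eucl_ball_lty z r : 0 < r -> (leb R n (eucl_ball z r) < +oo)%E.
Proof. by move=> r0; rewrite volE// ltry. Qed.

Lemma mean_sq_ge0 f z r c : 0 < r -> 0 <= mean_sq f z r c.
Proof.
move=> r0; rewrite mulr_ge0 ?invr_ge0 ?(ltW (vol_gt0 _ r0))//.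
by apply: Rintegral_ge0 => x _; exact: sqr_ge0.
Qed.

Lemma osc_ge0 f z r : 0 <= osc f z r.
Proof. exact: sqrtr_ge0. Qed.

Lemma sqr_osc f z r : 0 < r -> osc f z r ^+ 2 = mean_sq f z r (mean f z r).
Proof. by move=> r0; rewrite sqr_sqrtr//; exact: mean_sq_ge0. Qed.

(** The cross term vanishes around the mean. Hence [osc] is the least root mean square distance to a
    constant, and the mean is no farther from [c] than [f] is in root mean square. *)
Lemma mean_sq_pythagoras f z r c : 0 < r -> sq_integrable (eucl_ball z r) f ->
  mean_sq f z r c = osc f z r ^+ 2 + eucl_norm (mean f z r - c) ^+ 2.
Proof.
move=> r0 fs; rewrite sqr_osc//.
have v0 := vol_gt0 z r0; have mB := measurable_eucl_ball z r.
have Boo := leb_eucl_ball_lty z r0.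
pose S := \int[leb R n]_(x in eucl_ball z r) eucl_norm (f x) ^+ 2.
have E e : mean_sq f z r e =
    (vol z r)^-1 * S - 2 * (\sum_j e 0 j * mean f z r 0 j) + eucl_norm e ^+ 2.
  rewrite /mean_sq (Rintegral_sqr_subE e mB Boo fs) -/S -/(vol z r).
  have -> : \sum_j e 0 j * mean f z r 0 j =
      (vol z r)^-1 * \sum_j e 0 j * \int[leb R n]_(x in eucl_ball z r) f x 0 j.
    by rewrite mulr_sumr; apply: eq_bigr => j _; rewrite mxE mulrCA.
  by field; rewrite gt_eqF.
rewrite !E !sqr_eucl_norm_row.
have sqE : \sum_j mean f z r 0 j * mean f z r 0 j = \sum_j mean f z r 0 j ^+ 2.
  by apply: eq_bigr => j _; rewrite expr2.
have -> : \sum_j (mean f z r - c) 0 j ^+ 2 = \sum_j mean f z r 0 j ^+ 2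
    - 2 * (\sum_j c 0 j * mean f z r 0 j) + \sum_j c 0 j ^+ 2.
  rewrite mulr_sumr -sumrB -big_split/=; apply: eq_bigr => j _; rewrite !mxE; ring.
rewrite sqE; ring.
Qed.

Lemma sqr_osc_le_mean_sq f z r c : 0 < r -> sq_integrable (eucl_ball z r) f ->
  osc f z r ^+ 2 <= mean_sq f z r c.
Proof. by move=> r0 fs; rewrite mean_sq_pythagoras// lerDl sqr_ge0. Qed.

Lemma mean_dist_le_mean_sq f z r c : 0 < r -> sq_integrable (eucl_ball z r) f ->
  eucl_norm (mean f z r - c) ^+ 2 <= mean_sq f z r c.
Proof. by move=> r0 fs; rewrite mean_sq_pythagoras// lerDr sqr_ge0. Qed.

Lemma integrable_sqr_sub f z r c : 0 < r -> sq_integrable (eucl_ball z r) f ->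
  (leb R n).-integrable (eucl_ball z r) (EFin \o (fun x => eucl_norm (f x - c) ^+ 2)).
Proof.
move=> r0 fs; have mB := measurable_eucl_ball z r.
have Boo := leb_eucl_ball_lty z r0.
by have [] := sq_integrableB mB Boo fs (sq_integrable_cst c mB Boo).
Qed.

Lemma le_Rintegral_subset (A D : set 'rV[R]_n) (h : 'rV[R]_n -> R) :
  measurable A -> measurable D -> A `<=` D ->
  (leb R n).-integrable D (EFin \o h) -> (forall x, D x -> 0 <= h x) ->
  \int[leb R n]_(x in A) h x <= \int[leb R n]_(x in D) h x.
Proof.
move=> mA mD AD hi h0; have hiA := integrableS mD mA AD hi.
rewrite /Rintegral fine_le//.
- exact: integrable_fin_num.
- exact: integrable_fin_num.
- by apply: ge0_subset_integral => //; case/integrableP: hi.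
Qed.

Lemma mean_sq_subball f z r z' r' c k : 0 < r -> 0 < r' -> r <= k * r' ->
  eucl_ball z' r' `<=` eucl_ball z r -> sq_integrable (eucl_ball z r) f ->
  mean_sq f z' r' c <= (k * n.+1%:R) ^+ n * mean_sq f z r c.
Proof.
move=> r0 r'0 rk sub fs; rewrite /mean_sq.
have v0 := vol_gt0 z r0; have v'0 := vol_gt0 z' r'0.
have mB := measurable_eucl_ball z r; have mB' := measurable_eucl_ball z' r'.
have le1 := le_Rintegral_subset mB' mB sub (integrable_sqr_sub c r0 fs)
  (fun x _ => sqr_ge0 _).
have i0 : 0 <= \int[leb R n]_(x in eucl_ball z r) eucl_norm (f x - c) ^+ 2.
  by apply: Rintegral_ge0 => x _; exact: sqr_ge0.
have dbl := vol_doubling z z' r0 r'0 rk.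
rewrite ler_pdivrMl//; apply: (le_trans le1).
rewrite [leRHS](_ : _ = (k * n.+1%:R) ^+ n * vol z' r' / vol z r *
    \int[leb R n]_(x in eucl_ball z r) eucl_norm (f x - c) ^+ 2); last by ring.
by rewrite -[leLHS]mul1r ler_wpM2r// ler_pdivlMr// mul1r.
Qed.

Lemma mean_sq_le2 f g z r c : 0 < r -> sq_integrable (eucl_ball z r) f ->
  sq_integrable (eucl_ball z r) g ->
  mean_sq f z r c <= 2 * mean_sq g z r c +
    2 * ((vol z r)^-1 * \int[leb R n]_(x in eucl_ball z r) eucl_norm (f x - g x) ^+ 2).
Proof.
move=> r0 fs gs; have mB := measurable_eucl_ball z r.
have Boo := leb_eucl_ball_lty z r0.
have v0 := vol_gt0 z r0.
have igc := integrable_sqr_sub c r0 gs.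
have [_ ifg] := sq_integrableB mB Boo fs gs.
have i2 : (leb R n).-integrable (eucl_ball z r) (EFin \o (fun x => 2 * eucl_norm (g x - c) ^+ 2)).
  exact: (integrableZl mB 2 igc).
have i3 : (leb R n).-integrable (eucl_ball z r) (EFin \o (fun x => 2 * eucl_norm (f x - g x) ^+ 2)).
  exact: (integrableZl mB 2 ifg).
rewrite /mean_sq mulrCA [X in _ <= _ + X]mulrCA -mulrDr.
rewrite ler_wpM2l ?invr_ge0 ?(ltW v0)//.
rewrite -(RintegralZl 2 mB igc) -(RintegralZl 2 mB ifg) -(RintegralD mB i2 i3).
apply: (le_Rintegral mB (integrable_sqr_sub c r0 fs) (integrableD mB i2 i3)).
move=> x _; have -> : f x - c = (g x - c) + (f x - g x) by rewrite [RHS]addrC addrA subrK.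
exact: sqr_eucl_normD_le.
Qed.

Lemma mean_sq_le_ae f z r c A : 0 < r -> sq_integrable (eucl_ball z r) f -> 0 <= A ->
  {ae leb R n, forall x, eucl_ball z r x -> eucl_norm (f x - c) <= A} ->
  mean_sq f z r c <= A ^+ 2.
Proof.
move=> r0 fs A0 fA; have v0 := vol_gt0 z r0; have mB := measurable_eucl_ball z r.
rewrite /mean_sq ler_pdivrMl// mulrC.
apply: le_trans (ler_norm _) _; apply: normr_Rintegral_le_ae => //.
- exact: leb_eucl_ball_lty.
- have [mf _] := sq_integrableB mB (leb_eucl_ball_lty z r0) fs
    (sq_integrable_cst c mB (leb_eucl_ball_lty z r0)).
  exact: measurable_sqr_norm.
- exact: sqr_ge0.
- apply: ae_mono fA => x h xz; rewrite ger0_norm ?sqr_ge0//.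
  by rewrite ler_pXn2r ?nnegrE ?eucl_norm_ge0//; exact: h.
Qed.

Lemma measurable_zero_set A f : measurable A -> measurable_fun A f ->
  measurable (A `&` [set x | f x = 0]).
Proof.
move=> mA mf.
have h : measurable_fun A (fun x => eucl_norm (f x)).
  exact: (measurableT_comp (@measurable_eucl_norm R 1 p) mf).
have := h mA [set 0] (measurable_set1 0).
congr measurable; congr (_ `&` _); apply/seteqP; split => x /=.
  exact: eucl_norm_eq0.
by move=> ->; rewrite eucl_norm0.
Qed.

Lemma leb_zero_set_fin f z r : 0 < r -> measurable_fun (eucl_ball z r) f ->
  leb R n (eucl_ball z r `&` [set x | f x = 0]) \is a fin_num.
Proof.
move=> r0 mf; rewrite ge0_fin_numE//.
apply: le_lt_trans (leb_eucl_ball_lty z r0); rewrite le_measure ?inE//.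
  by apply: measurable_zero_set => //; exact: measurable_eucl_ball.
exact: measurable_eucl_ball.
Qed.

Lemma zero_density_ge0 f z r : 0 < r -> 0 <= zero_density f z r.
Proof.
by move=> r0; rewrite mulr_ge0 ?invr_ge0 ?(ltW (vol_gt0 _ r0))// fine_ge0.
Qed.

Lemma zero_density_le1 f z r : 0 < r -> measurable_fun (eucl_ball z r) f ->
  zero_density f z r <= 1.
Proof.
move=> r0 mf; have v0 := vol_gt0 z r0.
rewrite /zero_density ler_pdivrMl// mulr1 fine_le//.
- exact: leb_zero_set_fin.
- exact: leb_eucl_ball_fin.
- rewrite le_measure ?inE//.
    by apply: measurable_zero_set => //; exact: measurable_eucl_ball.
  exact: measurable_eucl_ball.
Qed.

Lemma zero_density_mean f z r : 0 < r -> sq_integrable (eucl_ball z r) f ->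
  zero_density f z r * eucl_norm (mean f z r) ^+ 2 <= osc f z r ^+ 2.
Proof.
move=> r0 fs; have v0 := vol_gt0 z r0; have mB := measurable_eucl_ball z r.
have [mf _] := fs.
have mZ := measurable_zero_set mB mf.
rewrite sqr_osc// /zero_density /mean_sq -mulrA ler_wpM2l ?invr_ge0 ?(ltW v0)//.
have i := integrable_sqr_sub (mean f z r) r0 fs.
have le := le_Rintegral_subset mZ mB (@subIsetl _ _ _) i (fun x _ => sqr_ge0 _).
apply: le_trans le.
have -> : \int[leb R n]_(x in eucl_ball z r `&` [set x | f x = 0])
    eucl_norm (f x - mean f z r) ^+ 2 =
    \int[leb R n]_(x in eucl_ball z r `&` [set x | f x = 0]) eucl_norm (mean f z r) ^+ 2.
  by apply: eq_Rintegral => x /[!inE] -[_ /= ->]; rewrite sub0r eucl_normN.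
by rewrite Rintegral_cst// mulrC.
Qed.

End ball_means.

(** Bookkeeping for [osc_decay]. The term from [psi] is 2 * (2 * V + 2 * E) / 64, that is (V + E) /
    16: the part in [V] fits in [V / 8], the part in [E] in [e]. *)
Lemma decay_arith (R : realFieldType) (T V o M M1 S X DE De e E : R) :
  M1 <= S -> M <= 2 * M1 + 2 * X -> T <= M -> X <= DE -> o <= 2 * V + 2 * E ->
  S <= o / 64 -> DE <= De -> 0 <= V -> 0 <= E -> E <= e ->
  T <= V / 8 + (e + 2 * De).
Proof. by move=> *; lra. Qed.

Lemma decay_arith2 (R : realFieldType) (a : R) : a <= 16^-1 -> 2 * a <= 8^-1.
Proof. by move=> ?; lra. Qed.

(** * One step of oscillation decay *)

Section oscillation_decay.
Context (R : realType) (n p : nat) (K : R).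
Hypothesis K0 : 0 <= K.
Implicit Types (phi psi : 'rV[R]_n -> 'rV[R]_p) (z : 'rV[R]_n) (r : R).

Definition approximable phi z r : Prop :=
  exists psi : 'rV[R]_n -> 'rV[R]_p,
    [/\ L2On (eucl_ball z r) psi,
        (\int[leb R n]_(x in eucl_ball z r) (eucl_norm (phi x - psi x) ^+ 2)%:E <=
           leb R n (eucl_ball z r `&` [set x | phi x = 0%R]))%E &
        exists2 G : 'rV[R]_n -> 'M[R]_(p, n),
          weak_gradient (eucl_ball z (r / 2)) psi G &
          (r%:E * LnormOn +oo (eucl_ball z (r / 2)) G <=
             (K * oscillation (eucl_ball z r) psi)%:E)%E].

(** Small for two reasons: [n * ratio < 1/2] puts the cube of half-side [ratio * r] inside the
    half-radius ball where the gradient is bounded, and [n * K * ratio <= 1/16] makes the Poincare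
    error at most an eighth of the oscillation of [psi]. *)
Definition ratio : R := (16 * n.+1%:R * (K + 1))^-1.

(** Bounds the volume ratio of balls of radii [r] and [t] whenever [t >= ratio * r], so it also pays
    for the radii between two consecutive scales. *)
Definition doubling : R := (ratio^-1 * n.+1%:R) ^+ n.

Definition decay_cst : R := 1 + 2 * doubling.

Lemma ratio_gt0 : 0 < ratio.
Proof. by rewrite invr_gt0 !mulr_gt0// ltr_wpDl. Qed.

Lemma ratio_le : ratio <= 16^-1.
Proof.
rewrite lef_pV2 ?posrE ?mulr_gt0// ?ltr_wpDl// -mulrA ler_peMr//.
have : 1 <= n.+1%:R :> R by rewrite ler1n.
have := K0; nra.
Qed.

Lemma n_ratio_lt : n%:R * ratio < 2^-1.
Proof.
rewrite /ratio ltr_pdivrMr; last by rewrite !mulr_gt0// ltr_wpDl.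
rewrite [ltRHS](_ : _ = 8 * (n.+1%:R * (K + 1))); last by field.
have h : n.+1%:R <= n.+1%:R * (K + 1) by rewrite ler_peMr// lerDr.
have h0 : n%:R < n.+1%:R :> R by rewrite ltr_nat.
have : 0 < n.+1%:R :> R by [].
lra.
Qed.

Lemma nK_ratio_le : n%:R * K * ratio <= 16^-1.
Proof.
rewrite /ratio ler_pdivrMr; last by rewrite !mulr_gt0// ltr_wpDl.
rewrite [leRHS](_ : _ = n.+1%:R * (K + 1)); last by field.
by rewrite ler_pM// ?ler_nat// lerDl.
Qed.

Lemma doubling_ge0 : 0 <= doubling.
Proof. by rewrite exprn_ge0// mulr_ge0// invr_ge0 ltW// ratio_gt0. Qed.

(** The norm at [+oo] unfolds to an essential supremum on a space of positive measure, hence the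
    first premise. *)
Lemma LnormOn_infty_ae (A : set 'rV[R]_n) (G : 'rV[R]_n -> 'M[R]_(p, n)) (M : R) :
  (0 < leb R n setT)%E -> (LnormOn +oo A G <= M%:E)%E ->
  {ae leb R n, forall x, A x -> eucl_norm (G x) <= M}.
Proof.
move=> T0; rewrite /LnormOn unlock T0 => /ess_supP; apply: ae_mono => x /= h Ax.
move: h; rewrite patchE mem_set// lee_fin; apply: le_trans; exact: ler_norm.
Qed.

Lemma leb_setT_gt0 : (0 < leb R n setT)%E.
Proof.
apply: (@lt_le_trans _ _ (leb R n (eucl_ball 0 1))).
  by rewrite volE// lte_fin vol_gt0.
by rewrite le_measure ?inE//; exact: measurable_eucl_ball.
Qed.

Lemma osc_decay phi z r : 0 < r -> sq_integrable (eucl_ball z r) phi ->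
  approximable phi z r ->
  osc phi z (ratio * r) ^+ 2 <= osc phi z r ^+ 2 / 8 + decay_cst * zero_density phi z r.
Proof.
move=> r0 phis [psi [psiL2 close [G wG GL]]].
have l0 := ratio_gt0.
have r'0 : 0 < ratio * r by rewrite mulr_gt0.
have mB := measurable_eucl_ball z r; have Boo := leb_eucl_ball_lty z r0.
have psis := L2On_sq_integrable mB psiL2.
have sub : eucl_ball z (ratio * r) `<=` eucl_ball z r.
  apply: sub_eucl_ball; rewrite subrr eucl_norm0 add0r ler_piMl ?(ltW r0)//.
  by apply: le_trans ratio_le _; rewrite invf_le1// ler1n.
have mB' := measurable_eucl_ball z (ratio * r).
have psis' := sq_integrableS mB' mB sub psis.
have phis' := sq_integrableS mB' mB sub phis.
have [mphi _] := phis.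
pose E := (vol z r)^-1 * \int[leb R n]_(x in eucl_ball z r) eucl_norm (phi x - psi x) ^+ 2.
have v0 := vol_gt0 z r0.
have difs := sq_integrableB mB Boo phis psis.
have Ele : E <= zero_density phi z r.
  rewrite /E /zero_density ler_wpM2l ?invr_ge0 ?(ltW v0)// /Rintegral fine_le//.
  - by apply: integrable_fin_num => //; have [] := difs.
  - exact: leb_zero_set_fin.
pose L := K * osc psi z r / r.
have L0 : 0 <= L by rewrite divr_ge0 ?(ltW r0)// mulr_ge0// osc_ge0.
have GL' : {ae leb R n, forall x, eucl_ball z (r / 2) x -> eucl_norm (G x) <= L}.
  apply: LnormOn_infty_ae; first exact: leb_setT_gt0.
  have -> : L = r^-1 * (K * osc psi z r) by rewrite /L mulrC.
  by rewrite EFinM lee_pdivlMl.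
have [c psic] : exists c, {ae leb R n, forall x, eucl_ball z (ratio * r) x ->
    eucl_norm (psi x - c) <= n%:R * (L * (2 * (ratio * r)))}.
  apply: weak_gradient_ae_bound wG GL' => //.
  rewrite mulrA mulrC; rewrite ltr_pM2l//; exact: n_ratio_lt.
have b0 : 0 <= n%:R * (L * (2 * (ratio * r))).
  by rewrite mulr_ge0// mulr_ge0// mulr_ge0// (ltW r'0).
have m1 := mean_sq_le_ae r'0 psis' b0 psic.
have m2 := mean_sq_le2 c r'0 phis' psis'.
have m3 : osc phi z (ratio * r) ^+ 2 <= mean_sq phi z (ratio * r) c by exact: sqr_osc_le_mean_sq.
have m4 : (vol z (ratio * r))^-1 * \int[leb R n]_(x in eucl_ball z (ratio * r))
    eucl_norm (phi x - psi x) ^+ 2 <= doubling * E.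
  have rr : r <= ratio^-1 * (ratio * r) by rewrite mulKf ?gt_eqF.
  have := mean_sq_subball 0 r0 r'0 rr sub difs.
  rewrite /mean_sq; under eq_Rintegral do rewrite subr0.
  by under [X in _ <= _ * (_ * X) -> _]eq_Rintegral do rewrite subr0.
(* The mean is the best constant, so the oscillation of [psi] may be measured around the mean of
   [phi]. *)
have m5 : osc psi z r ^+ 2 <= 2 * osc phi z r ^+ 2 + 2 * E.
  apply: le_trans (sqr_osc_le_mean_sq (mean phi z r) r0 psis) _.
  rewrite (sqr_osc phi z r0).
  have := mean_sq_le2 (mean phi z r) r0 psis phis.
  rewrite /E; under [X in _ <= _ + _ * (_ * X) -> _]eq_Rintegral do rewrite eucl_normBC.
  by [].
have bE : n%:R * (L * (2 * (ratio * r))) = 2 * (n%:R * K * ratio) * osc psi z r.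
  by rewrite /L; field; rewrite gt_eqF.
have m6 : (n%:R * (L * (2 * (ratio * r)))) ^+ 2 <= osc psi z r ^+ 2 / 64.
  rewrite bE exprMn mulrC ler_wpM2l ?sqr_ge0//.
  have a0 : 0 <= n%:R * K * ratio by rewrite mulr_ge0 ?mulr_ge0// (ltW l0).
  have a8 : 2 * (n%:R * K * ratio) <= 8^-1.
    exact: decay_arith2 nK_ratio_le.
  have -> : 64^-1 = 8^-1 ^+ 2 :> R by rewrite exprVn -natrX.
  by apply: lerXn2r a8; rewrite nnegrE; [exact: mulr_ge0|rewrite invr_ge0].
have E0 : 0 <= E.
  by rewrite mulr_ge0 ?invr_ge0 ?(ltW v0)//; apply: Rintegral_ge0 => x _; exact: sqr_ge0.
have D0 := doubling_ge0.
have m7 : doubling * E <= doubling * zero_density phi z r by rewrite ler_wpM2l.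
have V0 := sqr_ge0 (osc phi z r).
have -> : decay_cst * zero_density phi z r =
    zero_density phi z r + 2 * (doubling * zero_density phi z r).
  by rewrite /decay_cst mulrDl mul1r mulrA.
exact: decay_arith m1 m2 m3 m4 m5 m6 m7 V0 E0 Ele.
Qed.

End oscillation_decay.

Section arithmetic.
Context (R : realFieldType).
Implicit Types (o e q D : R).

Lemma le_of_sqr (a b : R) : 0 <= b -> a ^+ 2 <= b ^+ 2 -> a <= b.
Proof.
move=> b0 ab; rewrite leNgt; apply/negP => ba.
by move: ab; rewrite leNgt ltrXn2r// (le_lt_trans b0 ba).
Qed.

(** Lets [1 + D] stand for the square root of [D], which explains the leading 1 in [shift_cst],
    [near_cst], [gap_cst], [init_cst] and [bound_cst]. *)
Lemma sqr_1D_ge D : 0 <= D -> D <= (1 + D) ^+ 2.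
Proof. by move=> ?; nra. Qed.

Lemma sqr_affine_ge o e (c1 : R) : 0 <= o -> 1 <= c1 -> 0 <= e <= 1 ->
  o ^+ 2 / 8 + c1 * e <= (o / 2 + c1) ^+ 2.
Proof.
move=> o0 c11 /andP[e0 e1]; have : c1 * e <= c1 by rewrite ler_piMr// (le_trans ler01).
have : c1 <= c1 ^+ 2 by rewrite expr2 ler_peMl// (le_trans ler01).
by have := mulr_ge0 o0 (le_trans ler01 c11); have := sqr_ge0 o; nra.
Qed.

Lemma half_affine_le o o' q o0 (c1 : R) : o' <= o / 2 + c1 -> o <= q * o0 + 2 * c1 ->
  o' <= 2^-1 * q * o0 + 2 * c1.
Proof. by rewrite -mulrA; move: (q * o0) => t ? ?; lra. Qed.

Lemma half_le o q o0 : o <= q * o0 -> o / 2 <= 2^-1 * q * o0.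
Proof. by rewrite -mulrA; move: (q * o0) => t ?; lra. Qed.

(** As [c1 >= 1], a mean of size at least [3 * c1] has square at least [8 * c1], so [c1 * e] is at
    most [o ^+ 2 / 8]; two eighths make the quarter that halves [o]. *)
Lemma decay_large o e (c1 m T : R) : 1 <= c1 -> 0 <= e -> 3 * c1 <= m ->
  e * m ^+ 2 <= o ^+ 2 -> T <= o ^+ 2 / 8 + c1 * e -> T <= (o / 2) ^+ 2.
Proof.
move=> c11 e0 m3 em Te.
have m9 : 8 * c1 <= m ^+ 2.
  have h : 9 * c1 <= m ^+ 2.
    apply: (@le_trans _ _ ((3 * c1) ^+ 2)); first by nra.
    by rewrite ler_pXn2r ?nnegrE//; lra.
  by lra.
have : e * (8 * c1) <= o ^+ 2 by apply: le_trans em; rewrite ler_wpM2l.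
by rewrite expr_div_n; lra.
Qed.

Lemma mean_large_lower (m mk d q t c1 : R) : 3 * c1 + q <= m -> m <= d + mk ->
  d <= q * (1 - t) -> 0 <= q -> 0 <= t -> 3 * c1 <= mk.
Proof. by move=> h1 h2 h3 q0 t0; have := mulr_ge0 q0 t0; nra. Qed.

(** Partial sums of a geometric series, [t] standing for [2 ^- k]: shifts of size [c2 * o * 2 ^- i]
    add up to [2 * c2 * o * (1 - 2 ^- k)]. *)
Lemma telescope_arith (c2 o ok t d d' D : R) : 0 <= c2 ->
  D <= d' + d -> d <= 2 * c2 * o * (1 - t) -> d' <= c2 * ok -> ok <= t * o ->
  D <= 2 * c2 * o * (1 - 2^-1 * t).
Proof.
move=> c20 h1 h2 h3 h4; have h5 : c2 * ok <= c2 * (t * o) by rewrite ler_wpM2l.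
by rewrite [leRHS](_ : _ = 2 * c2 * o * (1 - t) + c2 * (t * o)); [lra|field].
Qed.

End arithmetic.

(** * Iteration over geometric scales at a fixed center *)

Section iteration.
Context (R : realType) (n p : nat) (K : R) (phi : 'rV[R]_n -> 'rV[R]_p).
Hypothesis K0 : 0 <= K.
Hypothesis phis : sq_integrable (eucl_ball 0 1) phi.
Hypothesis phi_approx : forall z r, 0 < r -> eucl_ball z r `<=` eucl_ball 0 1 ->
  approximable K phi z r.
Implicit Types (z x y : 'rV[R]_n) (r t : R).

Notation lambda := (@ratio R n K).
Notation C1 := (@decay_cst R n K).
Notation unit_ball := (eucl_ball (0 : 'rV[R]_n) 1).

Definition shift_cst : R := 1 + @doubling R n K.
Notation C2 := shift_cst.

Lemma decay_cst_ge1 : 1 <= C1.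
Proof. by rewrite /decay_cst lerDl mulr_ge0// doubling_ge0. Qed.

Lemma shift_cst_ge1 : 1 <= C2.
Proof. by rewrite /shift_cst lerDl doubling_ge0. Qed.

Local Opaque ratio decay_cst doubling osc mean zero_density mean_sq.

Lemma sq_integrable_sub z r : eucl_ball z r `<=` unit_ball ->
  sq_integrable (eucl_ball z r) phi.
Proof.
by move=> sub; apply: sq_integrableS sub phis; exact: measurable_eucl_ball.
Qed.

Lemma radius_gt0 r k : 0 < r -> 0 < lambda ^+ k * r.
Proof. by move=> r0; rewrite mulr_gt0// exprn_gt0// ratio_gt0. Qed.

Lemma ratio_lt1 : lambda < 1.
Proof. by apply: le_lt_trans (ratio_le n K0) _; rewrite invf_lt1// ltr1n. Qed.

Lemma sub_radius z r k : 0 < r -> eucl_ball z (lambda ^+ k * r) `<=` eucl_ball z r.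
Proof.
move=> r0; apply: sub_eucl_ball; rewrite subrr eucl_norm0 add0r ler_piMl ?(ltW r0)//.
by rewrite exprn_ile1// ltW ?ratio_gt0 ?ratio_lt1.
Qed.

Lemma osc_step z r k : 0 < r -> eucl_ball z r `<=` unit_ball ->
  osc phi z (lambda ^+ k.+1 * r) ^+ 2 <= osc phi z (lambda ^+ k * r) ^+ 2 / 8 +
    C1 * zero_density phi z (lambda ^+ k * r).
Proof.
move=> r0 sub.
have subk : eucl_ball z (lambda ^+ k * r) `<=` unit_ball.
  by apply: subset_trans sub; exact: sub_radius.
rewrite (exprS lambda) -mulrA; apply: osc_decay => //.
- exact: radius_gt0.
- exact: sq_integrable_sub.
- by apply: phi_approx => //; exact: radius_gt0.
Qed.

Lemma mean_step z r k : 0 < r -> eucl_ball z r `<=` unit_ball ->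
  eucl_norm (mean phi z (lambda ^+ k.+1 * r) - mean phi z (lambda ^+ k * r)) <=
    C2 * osc phi z (lambda ^+ k * r).
Proof.
move=> r0 sub.
have rk := radius_gt0 k r0; have rk1 := radius_gt0 k.+1 r0.
have subk : eucl_ball z (lambda ^+ k * r) `<=` unit_ball.
  by apply: subset_trans sub; exact: sub_radius.
have subk1 : eucl_ball z (lambda ^+ k.+1 * r) `<=` eucl_ball z (lambda ^+ k * r).
  by rewrite exprS -mulrA -{1}[lambda]expr1; exact: sub_radius.
have ms := sq_integrable_sub subk.
have ms1 := sq_integrable_sub (subset_trans subk1 subk).
have l0 := ratio_gt0 n K0.
have le1 := mean_dist_le_mean_sq (mean phi z (lambda ^+ k * r)) rk1 ms1.
have rr : lambda ^+ k * r <= lambda^-1 * (lambda ^+ k.+1 * r).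
  by rewrite exprS -mulrA mulKf ?gt_eqF.
have le2 := mean_sq_subball (mean phi z (lambda ^+ k * r)) rk rk1 rr subk1 ms.
rewrite -sqr_osc// in le2.
apply: le_of_sqr.
  by apply: mulr_ge0; [exact: le_trans ler01 shift_cst_ge1|exact: osc_ge0].
apply: le_trans le1 (le_trans le2 _); rewrite [leRHS]exprMn ler_wpM2r ?sqr_ge0//.
by apply: sqr_1D_ge; exact: doubling_ge0.
Qed.

(** Bounding the density of zeros by 1 and taking roots, one step sends [o] to at most [o / 2 + C1];
    the fixed point of this recursion is [2 * C1]. *)
Lemma osc_iter z r k : 0 < r -> eucl_ball z r `<=` unit_ball ->
  osc phi z (lambda ^+ k * r) <= 2 ^- k * osc phi z r + 2 * C1.
Proof.
move=> r0 sub; have c1 := decay_cst_ge1.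
have c0 : 0 <= C1 by exact: le_trans ler01 c1.
elim: k => [|k IH].
  by rewrite !expr0 invr1 !mul1r lerDl mulr_ge0.
have st := osc_step k r0 sub.
have subk : eucl_ball z (lambda ^+ k * r) `<=` unit_ball.
  by apply: subset_trans sub; exact: sub_radius.
have [mk _] := sq_integrable_sub subk.
have e1 := zero_density_le1 (radius_gt0 k r0) mk.
have e0 := zero_density_ge0 phi z (radius_gt0 k r0).
have o0 := osc_ge0 phi z (lambda ^+ k * r).
have o1 : osc phi z (lambda ^+ k.+1 * r) <= osc phi z (lambda ^+ k * r) / 2 + C1.
  apply: le_of_sqr; first by apply: addr_ge0 c0; exact: divr_ge0 o0 (ler0n _ 2).
  by apply: le_trans st _; apply: (sqr_affine_ge o0 c1); rewrite e0 e1.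
by have := half_affine_le o1 IH; rewrite (exprS (2 : R)) invfM.
Qed.

(** One induction carries both conclusions because each feeds the other: the oscillation halves
    while the mean exceeds [3 * C1], and the mean stays there because its shifts add up to less than
    [2 * C2 * osc], the reserve kept in the hypothesis. *)
Lemma mean_large z r k : 0 < r -> eucl_ball z r `<=` unit_ball ->
  3 * C1 + 2 * C2 * osc phi z r <= eucl_norm (mean phi z r) ->
  osc phi z (lambda ^+ k * r) <= 2 ^- k * osc phi z r /\
  eucl_norm (mean phi z (lambda ^+ k * r) - mean phi z r) <=
    2 * C2 * osc phi z r * (1 - 2 ^- k).
Proof.
move=> r0 sub big; have c1 := decay_cst_ge1; have c2 := shift_cst_ge1.
have oz0 := osc_ge0 phi z r.
elim: k => [|k [IHo IHm]].
  by rewrite !expr0 invr1 !mul1r !subrr eucl_norm0 mulr0 lexx.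
have st := osc_step k r0 sub; have ms := mean_step k r0 sub.
have subk : eucl_ball z (lambda ^+ k * r) `<=` unit_ball.
  by apply: subset_trans sub; exact: sub_radius.
have zm := zero_density_mean (radius_gt0 k r0) (sq_integrable_sub subk).
have e0 := zero_density_ge0 phi z (radius_gt0 k r0).
have ok0 := osc_ge0 phi z (lambda ^+ k * r).
set o := osc phi z (lambda ^+ k * r) in IHo st ms zm ok0 *.
set mk := mean phi z (lambda ^+ k * r) in IHm ms zm *.
set e := zero_density phi z (lambda ^+ k * r) in st zm e0 *.
have h0 : 0 <= 2 ^- k :> R by rewrite invr_ge0 exprn_ge0.
have c20 : 0 <= C2 by exact: le_trans ler01 c2.
have q0 : 0 <= 2 * C2 * osc phi z r.
  exact: mulr_ge0 (mulr_ge0 (ler0n _ 2) c20) oz0.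
have tri : eucl_norm (mean phi z r) <= eucl_norm (mk - mean phi z r) + eucl_norm mk.
  by have := ler_eucl_normD (mean phi z r - mk) mk; rewrite subrK eucl_normBC.
have mk3 := mean_large_lower big tri IHm q0 h0.
have o2 : osc phi z (lambda ^+ k.+1 * r) <= o / 2.
  apply: le_of_sqr; first exact: divr_ge0 ok0 (ler0n _ 2).
  exact: decay_large c1 e0 mk3 zm st.
split.
  apply: le_trans o2 _; rewrite (exprS (2 : R)) invfM.
  exact: half_le IHo.
have := ler_eucl_distD mk (mean phi z (lambda ^+ k.+1 * r)) (mean phi z r).
by move/telescope_arith => /(_ _ _ _ _ c20 IHm ms IHo); rewrite (exprS (2 : R)) invfM.
Qed.

Lemma scale_exists r t : 0 < t <= r ->
  exists k, lambda ^+ k.+1 * r < t <= lambda ^+ k * r.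
Proof.
move=> /andP[t0 tr].
have r0 : 0 < r by exact: lt_le_trans tr.
have ex : exists k, lambda ^+ k * r < t.
  have l16 : lambda <= 2^-1.
    by apply: le_trans (ratio_le n K0) _; rewrite lef_pV2 ?posrE ?ler_nat.
  have [N hN] := half_expn_small (divr_gt0 t0 r0).
  exists N; rewrite -ltr_pdivlMr//; apply: le_lt_trans (hN N (leqnn N)).
  rewrite -exprVn; apply: lerXn2r l16; rewrite nnegrE; last by rewrite invr_ge0.
  exact/ltW/ratio_gt0.
(* The first scale below [t] is not scale 0, since [t <= r]; its predecessor is the scale sought. *)
have [m hm hmin] := ex_minnP ex.
case: m hm hmin => [|k] hm hmin.
  by move: hm; rewrite expr0 mul1r ltNge tr.
exists k; rewrite hm/= leNgt; apply/negP => /hmin; rewrite ltnn//.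
Qed.

End iteration.

Section arithmetic2.
Context (R : realFieldType).

Lemma dist_lower_arith (m m' d o c1 c2 c4 M o' : R) : 0 <= o -> 0 <= c4 -> 0 <= c2 -> 0 <= c1 ->
  M * (1 + o) <= m -> m <= d + m' -> d <= c4 * o -> o' <= c4 * o ->
  3 * c1 + 2 * c2 * c4 + c4 <= M -> 3 * c1 + 2 * c2 * o' <= m'.
Proof.
move=> o0 c40 c20 c10 h1 h2 h3 h4 h5.
have : (3 * c1 + 2 * c2 * c4 + c4) * (1 + o) <= M * (1 + o).
  by rewrite ler_wpM2r// addr_ge0.
have : c2 * o' <= c2 * (c4 * o) by rewrite ler_wpM2l.
have := mulr_ge0 c10 o0; have := mulr_ge0 c20 c40.
have -> : (3 * c1 + 2 * c2 * c4 + c4) * (1 + o) = 3 * c1 + 3 * (c1 * o) +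
  2 * (c2 * c4) + 2 * (c2 * (c4 * o)) + c4 + c4 * o by ring.
have -> : 2 * c2 * o' = 2 * (c2 * o') by ring.
lra.
Qed.

Lemma sum_sqr_le (a b s : R) : 0 <= a -> 0 <= b -> a + b <= s -> a ^+ 2 + b ^+ 2 <= s ^+ 2.
Proof.
move=> a0 b0 abs; apply: (@le_trans _ _ ((a + b) ^+ 2)).
  by rewrite sqrrD addrAC lerDl mulrn_wge0// mulr_ge0.
by apply: lerXn2r => //; rewrite nnegrE ?addr_ge0// (le_trans _ abs)// addr_ge0.
Qed.

Lemma near_mean_arith (ok dk d' o' o c2 c4 t : R) : 0 <= t -> t <= 1 -> 0 <= c2 -> 0 <= o' ->
  ok <= t * o' -> dk <= d' + c4 * o -> d' <= 2 * c2 * o' * (1 - t) -> o' <= c4 * o ->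
  ok + dk <= (2 * c4 + 2 * c2 * c4) * o.
Proof.
move=> t0 t1 c20 o'0 h1 h2 h3 h4.
have a1 : t * o' <= o' by rewrite ler_piMl.
have a2 : 2 * c2 * o' * (1 - t) <= 2 * c2 * o'.
  by rewrite ler_piMr ?mulr_ge0// lerBlDr lerDl.
have a3 : c2 * o' <= c2 * (c4 * o) by rewrite ler_wpM2l.
have -> : (2 * c4 + 2 * c2 * c4) * o = 2 * (c4 * o) + 2 * (c2 * (c4 * o)) by ring.
move: a2 h3; have -> : 2 * c2 * o' = 2 * (c2 * o') by ring.
lra.
Qed.

End arithmetic2.

(** * A large mean keeps the boundary away *)

Section nonvanishing.
Context (R : realType) (n p : nat) (K : R) (phi : 'rV[R]_n -> 'rV[R]_p).
Hypothesis K0 : 0 <= K.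
Hypothesis phis : sq_integrable (eucl_ball 0 1) phi.
Hypothesis phi_approx : forall z r, 0 < r -> eucl_ball z r `<=` eucl_ball 0 1 ->
  approximable K phi z r.
Implicit Types (z x y : 'rV[R]_n) (r t : R).

Notation lambda := (@ratio R n K).
Notation C1 := (@decay_cst R n K).
Notation C2 := (@shift_cst R n K).
Notation unit_ball := (eucl_ball (0 : 'rV[R]_n) 1).

(** Plays two parts: the volume ratio when the radius is halved and the center moved, and the loss
    in [ae_le_of_ball_means]. *)
Definition cover_cst : R := (2 * n.+1%:R) ^+ n.
Definition near_cst : R := 1 + cover_cst.
(** In multiples of the oscillation on the original ball, bounds oscillation plus displacement of
    the mean at all smaller scales around a point of the half-radius ball. *)
Definition spread_cst : R := 2 * near_cst + 2 * C2 * near_cst.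
(** In the same unit, bounds the distance of [phi] to the mean almost everywhere on the half-radius
    ball. *)
Definition gap_cst : R := (1 + cover_cst * @doubling R n K) * spread_cst.
(* Threshold for |m| / (1 + osc): the first terms propagate largeness to every
   half-radius ball (mean_sq_near), gap_cst then contradicts phi = 0. *)
Definition large_cst : R := 3 * C1 + 2 * C2 * near_cst + near_cst + gap_cst.

Lemma cover_cst_ge0 : 0 <= cover_cst.
Proof. by rewrite exprn_ge0// mulr_ge0. Qed.

Lemma near_cst_ge1 : 1 <= near_cst.
Proof. by rewrite lerDl cover_cst_ge0. Qed.

Lemma spread_cst_ge0 : 0 <= spread_cst.
Proof.
have c2 := le_trans ler01 (shift_cst_ge1 n K0); have c4 := le_trans ler01 near_cst_ge1.
exact: addr_ge0 (mulr_ge0 (ler0n _ 2) c4) (mulr_ge0 (mulr_ge0 (ler0n _ 2) c2) c4).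
Qed.

Lemma gap_cst_ge0 : 0 <= gap_cst.
Proof.
apply: mulr_ge0 spread_cst_ge0; apply: addr_ge0 => //.
by apply: mulr_ge0; [exact: cover_cst_ge0|exact: doubling_ge0].
Qed.

Lemma large_cst_ge : 3 * C1 + 2 * C2 * near_cst + near_cst <= large_cst /\
  gap_cst < large_cst /\ 0 < large_cst.
Proof.
have c1 := decay_cst_ge1 n K0; have g0 := gap_cst_ge0.
have c2 := le_trans ler01 (shift_cst_ge1 n K0); have c4 := le_trans ler01 near_cst_ge1.
have q0 : 0 < 3 * C1 + 2 * C2 * near_cst + near_cst.
  apply: (ltr_wpDr c4); apply: ltr_wpDr; first exact: mulr_ge0 (mulr_ge0 (ler0n _ 2) c2) c4.
  exact: mulr_gt0 (ltr0Sn _ 2) (lt_le_trans ltr01 c1).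
rewrite /large_cst; split; first by rewrite lerDl.
by split; [rewrite ltrDr|exact: ltr_wpDr g0 q0].
Qed.

Lemma mean_sq_interpolate x r t k c : 0 < r -> eucl_ball x r `<=` unit_ball ->
  lambda ^+ k.+1 * r < t <= lambda ^+ k * r ->
  mean_sq phi x t c <= @doubling R n K * mean_sq phi x (lambda ^+ k * r) c.
Proof.
move=> r0 sub /andP[t1 t2].
have rk := radius_gt0 n K0 k r0.
have t0 : 0 < t by apply: le_lt_trans t1; exact: (ltW (radius_gt0 n K0 k.+1 r0)).
have subk : eucl_ball x (lambda ^+ k * r) `<=` unit_ball.
  by apply: subset_trans sub; exact: sub_radius.
have rt : lambda ^+ k * r <= lambda^-1 * t.
  rewrite ler_pdivlMl ?ratio_gt0//; apply/ltW; apply: le_lt_trans t1.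
  by rewrite exprS mulrA.
have subt : eucl_ball x t `<=` eucl_ball x (lambda ^+ k * r).
  by apply: sub_eucl_ball; rewrite subrr eucl_norm0 add0r.
exact: (mean_sq_subball c rk t0 rt subt (sq_integrable_sub phis subk)).
Qed.

Local Opaque ratio decay_cst doubling osc mean zero_density mean_sq shift_cst cover_cst.

Lemma ae_sqr_dist_le (z : 'rV[R]_n) r (V : set 'rV[R]_n) c A delta : 0 < r ->
  eucl_ball z r `<=` unit_ball -> eucl_open V -> V `<=` eucl_ball z r -> 0 < delta -> 0 <= A ->
  (forall x t, V x -> 0 < t < delta -> eucl_ball x t `<=` eucl_ball z r /\
     mean_sq phi x t c <= A) ->
  {ae leb R n, forall x, V x -> eucl_norm (phi x - c) ^+ 2 <= cover_cst * A}.
Proof.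
move=> r0 sub oV VB d0 A0 H.
have mB := measurable_eucl_ball z r.
have fs := sq_integrable_sub phis sub.
have ic := integrable_sqr_sub c r0 fs.
have mf : measurable_fun (eucl_ball z r) (fun x => eucl_norm (phi x - c) ^+ 2).
  by apply/measurable_EFinP; exact: measurable_int ic.
apply: (ae_le_of_ball_means (U := eucl_ball z r) (delta := delta)) => //.
- exact: leb_eucl_ball_lty.
- by move=> x _; exact: sqr_ge0.
- case/integrableP: ic => _; under eq_integral do rewrite gee0_abs ?lee_fin ?sqr_ge0//.
  by [].
- move=> x t Vx t0d; have [subt mA] := H x t Vx t0d; split => //.
  have t0 : 0 < t by case/andP: t0d.
  have fst := sq_integrable_sub phis (subset_trans subt sub).
  have it := integrable_sqr_sub c t0 fst.
  have v0 := vol_gt0 x t0.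
  rewrite -(fineK (integrable_fin_num _ it)); last exact: measurable_eucl_ball.
  by rewrite lee_fin -ler_pdivrMr// mulrC.
Qed.

Lemma half_sub_ball z r x : 0 < r -> eucl_ball z (r / 2) x ->
  eucl_ball x (r / 2) `<=` eucl_ball z r.
Proof.
move=> r0; rewrite /eucl_ball/= => xz; apply: sub_eucl_ball.
by apply/ltW; rewrite -ltrBrDr; apply: lt_le_trans xz _; rewrite {2}(splitr r) addrK.
Qed.

(** Recentering at [x] with half the radius leaves an oscillation and a displacement of the mean of
    at most [near_cst * osc], which [large_cst] absorbs. Then [mean_large] controls all smaller
    scales around [x], and the Pythagorean identity combines oscillation and displacement. *)
Lemma mean_sq_near z r x k : 0 < r -> eucl_ball z r `<=` unit_ball ->
  large_cst * (1 + osc phi z r) <= eucl_norm (mean phi z r) ->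
  eucl_ball z (r / 2) x ->
  mean_sq phi x (lambda ^+ k * (r / 2)) (mean phi z r) <= (spread_cst * osc phi z r) ^+ 2.
Proof.
move=> r0 sub big xz; have r20 : 0 < r / 2 by exact: divr_gt0.
have subx := half_sub_ball r0 xz.
have subu := subset_trans subx sub.
have fs := sq_integrable_sub phis sub.
have fsx := sq_integrable_sub phis subu.
have o0 := osc_ge0 phi z r; have ox0 := osc_ge0 phi x (r / 2).
have c1 := le_trans ler01 (decay_cst_ge1 n K0).
have c2 := le_trans ler01 (shift_cst_ge1 n K0).
have c4 := le_trans ler01 near_cst_ge1.
set m := mean phi z r in big *; set o := osc phi z r in big o0 *.
have bound : mean_sq phi x (r / 2) m <= (near_cst * o) ^+ 2.
  have r2 : r <= 2 * (r / 2) by rewrite mulrC divfK.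
  apply: le_trans (mean_sq_subball m r0 r20 r2 subx fs) _.
  rewrite -/cover_cst -sqr_osc// [leRHS]exprMn; apply: ler_wpM2r; first exact: sqr_ge0.
  exact: sqr_1D_ge cover_cst_ge0.
have no0 : 0 <= near_cst * o by exact: mulr_ge0.
have ox : osc phi x (r / 2) <= near_cst * o.
  apply: (le_of_sqr no0); apply: le_trans bound; exact: sqr_osc_le_mean_sq.
have mx : eucl_norm (mean phi x (r / 2) - m) <= near_cst * o.
  apply: (le_of_sqr no0); apply: le_trans bound; exact: mean_dist_le_mean_sq.
have tri : eucl_norm m <= eucl_norm (mean phi x (r / 2) - m) + eucl_norm (mean phi x (r / 2)).
  by have := ler_eucl_normD (m - mean phi x (r / 2)) (mean phi x (r / 2));
    rewrite subrK eucl_normBC.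
have [ge1 _] := large_cst_ge.
have bigx := dist_lower_arith o0 c4 c2 c1 big tri mx ox ge1.
have [ok mk] := mean_large K0 phis phi_approx k r20 subu bigx.
have rk := radius_gt0 n K0 k r20.
have fsk : sq_integrable (eucl_ball x (lambda ^+ k * (r / 2))) phi.
  apply: (sq_integrable_sub phis); apply: subset_trans subu; exact: sub_radius.
rewrite mean_sq_pythagoras//.
apply: sum_sqr_le; [exact: osc_ge0|exact: eucl_norm_ge0|].
have t0 : 0 <= 2 ^- k :> R by rewrite invr_ge0 exprn_ge0.
have t1 : 2 ^- k <= 1 :> R by rewrite invf_le1 ?exprn_gt0// exprn_ege1// ler1n.
apply: (near_mean_arith t0 t1 c2 ox0 ok _ mk ox).
apply: le_trans (ler_eucl_distD (mean phi x (r / 2)) _ _) _.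
by apply: lerD mx.
Qed.

(** Where [phi] vanishes, its distance to the mean is the norm of the mean, which would then be at
    most [gap_cst * osc], below the assumed threshold. *)
Lemma ae_near_mean z r : 0 < r -> eucl_ball z r `<=` unit_ball ->
  large_cst * (1 + osc phi z r) <= eucl_norm (mean phi z r) ->
  {ae leb R n, forall x, eucl_ball z (r / 2) x -> phi x <> 0}.
Proof.
move=> r0 sub big; have r20 : 0 < r / 2 by exact: divr_gt0.
have o0 := osc_ge0 phi z r.
have d0 := doubling_ge0 n K0.
pose A := @doubling R n K * (spread_cst * osc phi z r) ^+ 2.
have A0 : 0 <= A by apply: mulr_ge0 d0 _; exact: sqr_ge0.
have sub2 : eucl_ball z (r / 2) `<=` eucl_ball z r.
  apply: sub_eucl_ball; rewrite subrr eucl_norm0 add0r ler_pdivrMr// ler_peMr ?(ltW r0)//.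
  by rewrite ler1n.
have H x t : eucl_ball z (r / 2) x -> 0 < t < r / 2 -> eucl_ball x t `<=` eucl_ball z r /\
     mean_sq phi x t (mean phi z r) <= A.
  move=> xz /andP[t0 tr]; have subx := half_sub_ball r0 xz.
  split.
    apply: subset_trans subx; apply: sub_eucl_ball.
    by rewrite subrr eucl_norm0 add0r ltW.
  have [k hk] : exists k, lambda ^+ k.+1 * (r / 2) < t <= lambda ^+ k * (r / 2).
    by apply: scale_exists => //; rewrite t0 ltW.
  apply: le_trans (mean_sq_interpolate _ r20 (subset_trans subx sub) hk) _.
  by apply: (ler_wpM2l d0); exact: mean_sq_near.
have := ae_sqr_dist_le r0 sub (@eucl_open_ball _ _ z (r / 2)) sub2 r20 A0 H.
apply: ae_mono => x h xz phi0; have := h xz; rewrite phi0 sub0r eucl_normN => mA.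
have [_ [gM M0]] := large_cst_ge; have s0 := spread_cst_ge0.
have le1 : eucl_norm (mean phi z r) <= gap_cst * osc phi z r.
  apply: le_of_sqr; first exact: mulr_ge0 gap_cst_ge0 o0.
  apply: le_trans mA _; rewrite /A mulrA /gap_cst -[in leRHS]mulrA [leRHS]exprMn.
  apply: ler_wpM2r; first exact: sqr_ge0.
  by apply: sqr_1D_ge; exact: mulr_ge0 cover_cst_ge0 d0.
have := le_trans big le1; apply/negP; rewrite -ltNge mulrDr mulr1.
apply: ltr_pwDl => //; apply: ler_wpM2r => //; exact: ltW.
Qed.

Lemma zero_boundary_far z r y : 0 < r -> eucl_ball z r `<=` unit_ball ->
  large_cst * (1 + osc phi z r) <= eucl_norm (mean phi z r) ->
  zero_boundary phi y -> r / 2 <= eucl_norm (y - z).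
Proof.
move=> r0 sub big [y1 Fy]; rewrite leNgt; apply/negP => yz.
have ae0 := ae_near_mean r0 sub big.
have y1' : 0 < 1 - eucl_norm y.
  by move: y1; rewrite /eucl_ball/= subr0 subr_gt0.
(* Halving the minimum makes the radius strictly admissible in [zero_boundary] while keeping the
   ball inside the one where zeros are negligible. *)
pose s := Num.min (1 - eucl_norm y) (r / 2 - eucl_norm (y - z)) / 2.
have s0 : 0 < s by rewrite divr_gt0// lt_min y1' subr_gt0.
have s1 : s < Num.min (1 - eucl_norm y) (r / 2 - eucl_norm (y - z)).
  by rewrite /s ltr_pdivrMr// ltr_pMr ?ltr1n// lt_min y1' subr_gt0.
move: s1; rewrite lt_min => /andP[s1 s2].
have := Fy s; rewrite s0 s1 => /(_ isT).
have suby : eucl_ball y s `<=` eucl_ball z (r / 2).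
  by apply: sub_eucl_ball; rewrite addrC -lerBrDr ltW.
have suby1 : eucl_ball y s `<=` unit_ball.
  apply: subset_trans suby _; apply: subset_trans sub.
  apply: sub_eucl_ball; rewrite subrr eucl_norm0 add0r ler_pdivrMr// ler_peMr ?(ltW r0)//.
  by rewrite ler1n.
have [mphi _] := sq_integrable_sub phis suby1.
have mZ : measurable (eucl_ball y s `&` [set x | phi x = 0]).
  by apply: measurable_zero_set => //; exact: measurable_eucl_ball.
have -> : leb R n (eucl_ball y s `&` [set x | phi x = 0]) = 0%E.
  apply/(@negligibleP _ _ _ (leb R n)) => //.
  apply: negligibleS ae0 => x [/suby xz phi0] /=.
  by move=> /(_ xz).
by rewrite mul0e ltxx.
Qed.

End nonvanishing.

Section arithmetic3.
Context (R : realFieldType).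

Lemma decay_sum_le (h o0 T X c c1 : R) : 0 <= h -> h <= T -> 0 <= X -> 0 <= c -> 0 <= c1 ->
  o0 <= c * X -> h * o0 + 2 * c1 <= (c + 2 * c1) * (1 + T * X).
Proof.
move=> h0 hT X0 c0 c10 o0X; have cX := mulr_ge0 c0 X0.
have a1 : h * o0 <= h * (c * X) by rewrite ler_wpM2l.
have a2 : h * (c * X) <= T * (c * X) by rewrite ler_wpM2r.
have a3 := mulr_ge0 c10 (mulr_ge0 (le_trans h0 hT) X0).
have -> : (c + 2 * c1) * (1 + T * X) = c + T * (c * X) + 2 * c1 + 2 * (c1 * (T * X)).
  by ring.
by move: a1 a2 a3 c0; clear; lra.
Qed.

Lemma affine_le (M m o a B : R) : 0 <= M -> 1 <= B -> m <= M * (1 + o) -> o <= a * B ->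
  m <= M * (1 + a) * B.
Proof.
move=> M0 B1 h1 h2; apply: le_trans h1 _; rewrite -mulrA; apply: (ler_wpM2l M0).
by rewrite mulrDl mul1r lerD.
Qed.

Lemma mulr_1D_mul2_le (T X : R) : 0 <= T * X -> 1 + 2 * T * X <= 2 * (1 + T * X).
Proof. by rewrite -mulrA; move: (T * X) => t ?; lra. Qed.

Lemma step_bound_arith (m mj d o c2 a b B : R) : 0 <= c2 -> mj <= d + m -> d <= c2 * o ->
  o <= a * B -> m <= b * B -> mj <= (c2 * a + b) * B.
Proof.
move=> c20 h1 h2 h3 h4; apply: le_trans h1 _; rewrite mulrDl; apply: lerD h4.
by apply: le_trans h2 _; rewrite -mulrA ler_wpM2l.
Qed.

Lemma tail_arith (d c2 o t : R) : 0 <= c2 -> 0 <= o -> 0 <= t ->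
  d <= 2 * c2 * o * (1 - t) -> d <= 2 * c2 * o.
Proof.
move=> c20 o0 t0 /le_trans; apply; rewrite ler_piMr ?lerBlDr ?lerDl//.
exact: mulr_ge0 (mulr_ge0 (ler0n _ 2) c20) o0.
Qed.

Lemma large_arith (M m o c1 c2 c4 : R) : 0 <= c1 -> 0 <= c2 -> 0 <= o -> 1 <= c4 ->
  3 * c1 + 2 * c2 * c4 + c4 <= M -> M * (1 + o) <= m -> 3 * c1 + 2 * c2 * o <= m.
Proof.
move=> c10 c20 o0 c41 MM /(le_trans _); apply.
have a1 : (3 * c1 + 2 * c2 * c4 + c4) * (1 + o) <= M * (1 + o).
  by rewrite ler_wpM2r// addr_ge0.
apply: le_trans a1.
have -> : (3 * c1 + 2 * c2 * c4 + c4) * (1 + o) = 3 * c1 + 3 * (c1 * o) +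
  2 * (c2 * c4) + 2 * (c2 * o * (c4 - 1)) + 2 * (c2 * o) + c4 + c4 * o by ring.
have := mulr_ge0 c10 o0; have := mulr_ge0 c20 (le_trans ler01 c41).
have := mulr_ge0 (mulr_ge0 c20 o0) (etrans (subr_ge0 _ _) c41).
have := mulr_ge0 (le_trans ler01 c41) o0; have := le_trans ler01 c41.
have -> : 2 * c2 * o = 2 * (c2 * o) by ring.
by clear; lra.
Qed.

(** With [c] in the role of [mean_cst], the last three inequalities serve the cases of [scale_le]:
    current scale not large, first large scale positive, first large scale equal to 0. Adding the
    bounds avoids a maximum. *)
Lemma mean_cst_arith (i N oc c2 : R) : 0 <= i -> 0 <= N -> 0 <= oc -> 0 <= c2 ->
  let c := i + N * (1 + 2 * oc) + (c2 * (2 * oc) + 2 * c2 * oc) in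
  [/\ i <= c, N * (1 + oc) <= c, c2 * (2 * oc) + N * (1 + 2 * oc) + 2 * c2 * oc <= c &
    i + 2 * c2 * oc <= c].
Proof.
move=> i0 N0 oc0 c20 c; have a1 := mulr_ge0 N0 oc0; have a2 := mulr_ge0 c20 oc0.
have -> : c = i + (N + 2 * (N * oc)) + 4 * (c2 * oc) by rewrite /c; ring.
have -> : N * (1 + 2 * oc) = N + 2 * (N * oc) by ring.
have -> : N * (1 + oc) = N + N * oc by ring.
have -> : 2 * c2 * oc = 2 * (c2 * oc) by ring.
have -> : c2 * (2 * oc) = 2 * (c2 * oc) by ring.
by split; lra.
Qed.

Lemma quarter_lt (l u : R) : l * (1 / 2) < 2 * u -> l <= 4 * u.
Proof. by move=> ?; lra. Qed.

Lemma quarter_le (l u d : R) : l * (1 / 2) / 2 <= d -> d < u -> l <= 4 * u.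
Proof. by move=> ? ?; lra. Qed.

End arithmetic3.

(** * The exponent of the distance *)

Section holder_exponent.
Context (R : realType) (n : nat) (K : R).
Hypothesis K0 : 0 <= K.
Notation lambda := (@ratio R n K).

(* Chosen so that ratio `^ exponent = 1 / 2, the decay rate of osc. *)
Definition exponent : R := ln 2^-1 / ln lambda.

Lemma exponent_gt0 : 0 < exponent.
Proof.
have l0 := ratio_gt0 n K0.
rewrite /exponent -mulrNN -invrN; apply: divr_gt0; rewrite oppr_gt0; apply: ln_lt0.
  by rewrite invr_gt0 ltr0n invf_lt1// ltr1n.
by rewrite l0 ratio_lt1.
Qed.

Lemma ratio_powR k : (lambda ^+ k) `^ exponent = 2 ^- k.
Proof.
have l0 := ratio_gt0 n K0.
have l1 : ln lambda != 0.
  by rewrite lt_eqF// ln_lt0// l0 ratio_lt1.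
rewrite -(@powR_mulrn _ lambda) ?(ltW l0)// -powRrM mulrC powRrM powR_mulrn ?powR_ge0//.
rewrite -exprVn; congr (_ ^+ _).
rewrite /powR gt_eqF// /exponent divfK// lnK// posrE invr_gt0 ltr0n//.
Qed.

(** Converts a number of halvings of the oscillation into a power of the radius. *)
Lemma half_expn_le_powR k t : lambda ^+ k <= t -> 2 ^- k <= t `^ exponent.
Proof.
move=> kt; rewrite -ratio_powR; have k0 : 0 <= lambda ^+ k.
  by rewrite exprn_ge0// ltW// ratio_gt0.
apply: ge0_ler_powR; rewrite ?nnegrE//; first exact: ltW exponent_gt0.
exact: le_trans kt.
Qed.

End holder_exponent.

(** * Bounds on the half ball, near the boundary *)

Section interior_bound.
Context (R : realType) (n p : nat) (K X : R) (phi : 'rV[R]_n -> 'rV[R]_p).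
Hypothesis K0 : 0 <= K.
Hypothesis X0 : 0 <= X.
Hypothesis phis : sq_integrable (eucl_ball 0 1) phi.
Hypothesis phi_approx : forall z r, 0 < r -> eucl_ball z r `<=` eucl_ball 0 1 ->
  approximable K phi z r.
Hypothesis phi_le : \int[leb R n]_(x in eucl_ball 0 1) eucl_norm (phi x) ^+ 2 <= X ^+ 2.
Implicit Types (z x y : 'rV[R]_n) (t : R).

Notation lambda := (@ratio R n K).
Notation alpha := (@exponent R n K).
Notation C1 := (@decay_cst R n K).
Notation C2 := (@shift_cst R n K).
Notation M := (@large_cst R n K).
Notation unit_ball := (eucl_ball (0 : 'rV[R]_n) 1).
Notation o x k := (osc phi x (lambda ^+ k * (1 / 2))).
Notation m x k := (mean phi x (lambda ^+ k * (1 / 2))).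

(** A ball of radius 1/2 contains a cube of side [1 / n.+1], so [n.+1 ^+ n] bounds the inverse of
    its volume. *)
Definition init_cst : R := 1 + n.+1%:R ^+ n.
Definition osc_cst : R := init_cst + 2 * C1.
Definition mean_cst : R := init_cst + M * (1 + 2 * osc_cst) +
  (C2 * (2 * osc_cst) + 2 * C2 * osc_cst) .
Definition scale_cst : R := osc_cst + mean_cst.

Lemma init_cst_ge1 : 1 <= init_cst.
Proof. by rewrite lerDl exprn_ge0. Qed.

Lemma osc_cst_ge0 : 0 <= osc_cst.
Proof.
apply: addr_ge0 (le_trans ler01 init_cst_ge1) _.
exact: mulr_ge0 (ler0n _ 2) (le_trans ler01 (decay_cst_ge1 n K0)).
Qed.

Lemma mean_cst_ge : [/\ init_cst <= mean_cst, M * (1 + osc_cst) <= mean_cst,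
  C2 * (2 * osc_cst) + M * (1 + 2 * osc_cst) + 2 * C2 * osc_cst <= mean_cst &
  init_cst + 2 * C2 * osc_cst <= mean_cst].
Proof.
have [_ [_ /ltW M0]] := large_cst_ge n K0.
exact: mean_cst_arith (le_trans ler01 init_cst_ge1) M0 osc_cst_ge0
  (le_trans ler01 (shift_cst_ge1 n K0)).
Qed.

Lemma half_ball_sub x : eucl_ball 0 (1 / 2) x -> eucl_ball x (1 / 2) `<=` unit_ball.
Proof. by move=> xB; apply: half_sub_ball. Qed.

Lemma mean_sq_half_le x : eucl_ball 0 (1 / 2) x ->
  mean_sq phi x (1 / 2) 0 <= n.+1%:R ^+ n * X ^+ 2.
Proof.
move=> xB; have subx := half_ball_sub xB.
have h0 : 0 < 1 / 2 :> R by exact: divr_gt0.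
have i0 := integrable_sqr_sub 0 ltr01 phis.
have le1 : \int[leb R n]_(y in eucl_ball x (1 / 2)) eucl_norm (phi y - 0) ^+ 2 <= X ^+ 2.
  apply: le_trans (le_Rintegral_subset _ _ subx i0 _) _.
  - exact: measurable_eucl_ball.
  - exact: measurable_eucl_ball.
  - by move=> y _; exact: sqr_ge0.
  - by apply: le_trans phi_le; under eq_Rintegral do rewrite subr0.
have v0 := vol_gt0 x h0.
have vge : n.+1%:R ^- n <= vol x (1 / 2).
  apply: le_trans (vol_ge x h0); rewrite -exprVn.
  by rewrite (_ : 2 * _ = n.+1%:R^-1)// !mulrA mulr1 mulfV ?pnatr_eq0// mul1r.
have vi : (vol x (1 / 2))^-1 <= n.+1%:R ^+ n.
  by rewrite invf_ple ?posrE// exprn_gt0.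
rewrite /mean_sq; apply: le_trans (ler_wpM2l _ le1) _.
  by rewrite invr_ge0 ltW.
by apply: ler_wpM2r => //; exact: sqr_ge0.
Qed.

Local Opaque ratio decay_cst doubling osc mean zero_density mean_sq shift_cst cover_cst
  large_cst exponent init_cst osc_cst mean_cst.

Lemma init_le x : eucl_ball 0 (1 / 2) x -> osc phi x (1 / 2) <= init_cst * X /\
  eucl_norm (mean phi x (1 / 2)) <= init_cst * X.
Proof.
move=> xB; have subx := half_ball_sub xB.
have h0 : 0 < 1 / 2 :> R by exact: divr_gt0.
have fs := sq_integrable_sub phis subx.
have iX : 0 <= init_cst * X by exact: mulr_ge0 (le_trans ler01 init_cst_ge1) X0.
have le1 : mean_sq phi x (1 / 2) 0 <= (init_cst * X) ^+ 2.
  apply: le_trans (mean_sq_half_le xB) _; rewrite [leRHS]exprMn.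
  by apply: (ler_wpM2r (sqr_ge0 X)); apply: sqr_1D_ge; rewrite exprn_ge0.
split; apply: (le_of_sqr iX); apply: le_trans le1.
  exact: sqr_osc_le_mean_sq.
by rewrite -[mean _ _ _]subr0; exact: mean_dist_le_mean_sq.
Qed.

Lemma scale_le x T k : eucl_ball 0 (1 / 2) x -> 2 ^- k <= T ->
  (forall j, M * (1 + o x j) <= eucl_norm (m x j) -> 2 ^- j <= T) ->
  mean_sq phi x (lambda ^+ k * (1 / 2)) 0 <= (scale_cst * (1 + T * X)) ^+ 2.
Proof.
move=> xB kT H; have subx := half_ball_sub xB.
have h0 : 0 < 1 / 2 :> R by exact: divr_gt0.
have [ao0 m0] := init_le xB.
have p0 j : 0 <= 2 ^- j :> R by rewrite invr_ge0 exprn_ge0.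
have i0 := le_trans ler01 init_cst_ge1.
have c1 := le_trans ler01 (decay_cst_ge1 n K0).
have c2 := le_trans ler01 (shift_cst_ge1 n K0).
have oc0 := osc_cst_ge0.
have [lM [_ /ltW M0]] := large_cst_ge n K0.
have [mc1 mc2 mc3 mc4] := mean_cst_ge.
have TX0 : 0 <= T * X by exact: mulr_ge0 (le_trans (p0 k) kT) X0.
set B := 1 + T * X.
have B1 : 1 <= B by rewrite lerDl.
have B0 : 0 <= B by exact: le_trans ler01 B1.
have osc_le j : 2 ^- j <= T -> o x j <= osc_cst * B.
  move=> jT; apply: le_trans (osc_iter K0 phis phi_approx j h0 subx) _.
  exact: decay_sum_le (p0 j) jT X0 i0 c1 ao0.
(* Serves the scale just before the first large one, where the decay is compared with [T] only up to
   a factor 2. *)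
have osc_le2 j : 2 ^- j.+1 <= T -> o x j <= 2 * osc_cst * B.
  move=> jT; apply: le_trans (osc_iter K0 phis phi_approx j h0 subx) _.
  have jT2 : 2 ^- j <= 2 * T.
    by move: jT; rewrite (exprS (2 : R)) invfM mulrC ler_pdivrMr// mulrC.
  apply: le_trans (decay_sum_le (p0 j) jT2 X0 i0 c1 ao0) _.
  rewrite -/osc_cst -mulrA mulrCA; apply: (ler_wpM2l oc0).
  exact: mulr_1D_mul2_le.
have mean_le : eucl_norm (m x k) <= mean_cst * B.
  have [small|big] := ltP (eucl_norm (m x k)) (M * (1 + o x k)).
    apply: le_trans (affine_le M0 B1 (ltW small) (osc_le _ kT)) _.
    exact: ler_wpM2r.
  pose P j := M * (1 + o x j) <= eucl_norm (m x j).
  have exP : exists j, P j by exists k.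
  have [j Pj jmin] := ex_minnP exP.
  have jk : (j <= k)%N by exact: jmin.
  have jT := H j Pj.
  have oj := osc_le j jT.
  have rj := radius_gt0 n K0 j h0.
  have subj : eucl_ball x (lambda ^+ j * (1 / 2)) `<=` unit_ball.
    by apply: subset_trans subx; exact: sub_radius.
  have oj0 := osc_ge0 phi x (lambda ^+ j * (1 / 2)).
  have bigj := large_arith c1 c2 oj0 (near_cst_ge1 R n) lM Pj.
  have [_ dk] := mean_large K0 phis phi_approx (k - j) rj subj bigj.
  have kE : lambda ^+ (k - j) * (lambda ^+ j * (1 / 2)) = lambda ^+ k * (1 / 2).
    by rewrite mulrA -exprD subnK.
  rewrite kE in dk.
  have d2 := tail_arith c2 oj0 (p0 _) dk.
  have tri (u v : 'rV[R]_p) : eucl_norm u <= eucl_norm (u - v) + eucl_norm v.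
    by have := ler_eucl_normD (u - v) v; rewrite subrK.
  have [b [bB cb]] : exists b, eucl_norm (m x j) <= b * B /\ b + 2 * C2 * osc_cst <= mean_cst.
    (* For [j = 0] the initial bound suffices, because [T >= 1] in that case. Otherwise the previous
       scale is not large, and one step moves the mean by at most [C2] times its oscillation. *)
    case: j Pj jmin {jk bigj dk kE d2} jT oj rj subj oj0 => [|i] Pj jmin jT oj rj subj oj0.
      exists init_cst; split=> //; rewrite expr0 mul1r; apply: le_trans m0 _.
      apply: (ler_wpM2l i0); rewrite /B -[leLHS]add0r; apply: lerD => //.
      by rewrite ler_peMl//; move: jT; rewrite expr0 invr1.
    exists (C2 * (2 * osc_cst) + M * (1 + 2 * osc_cst)); split=> //.
    have oi := osc_le2 i jT.
    have mi : eucl_norm (m x i) <= M * (1 + 2 * osc_cst) * B.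
      apply: affine_le oi => //; rewrite leNgt; apply/negP => /ltW.
      by move=> /jmin; rewrite ltnn.
    exact: step_bound_arith c2 (tri _ _) (mean_step K0 phis i h0 subx) oi mi.
  have := step_bound_arith (mulr_ge0 (ler0n _ 2) c2) (tri _ _) d2 oj bB.
  move=> /le_trans; apply; apply: ler_wpM2r => //.
  by rewrite addrC.
have fk : sq_integrable (eucl_ball x (lambda ^+ k * (1 / 2))) phi.
  by apply: (sq_integrable_sub phis); apply: subset_trans subx; exact: sub_radius.
rewrite mean_sq_pythagoras//; last exact: radius_gt0.
apply: sum_sqr_le; [exact: osc_ge0|exact: eucl_norm_ge0|].
by rewrite subr0 mulrDl; apply: lerD mean_le; exact: osc_le.
Qed.

(** Scale [j] has radius [lambda ^+ j / 2], and a large mean there keeps the boundary at half that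
    radius, whence [lambda ^+ j <= 4 * tau]. The condition [t <= 2 * tau * lambda] gives the same
    bound for the scale just above [t], since the next one lies below [t]. *)
Lemma ball_mean_sq_le x y tau t : eucl_ball 0 (1 / 2) x -> zero_boundary phi y ->
  eucl_norm (x - y) < tau -> 0 < t <= 1 / 2 -> t <= 2 * tau * lambda ->
  mean_sq phi x t 0 <=
    @doubling R n K * (scale_cst * (1 + (4 * tau) `^ alpha * X)) ^+ 2.
Proof.
move=> xB Fy xy t01 ttau; have subx := half_ball_sub xB.
have h0 : 0 < 1 / 2 :> R by exact: divr_gt0.
have l0 := ratio_gt0 n K0.
have [k hk] := scale_exists n K0 t01.
apply: le_trans (mean_sq_interpolate K0 phis 0 h0 subx hk) _.
apply: (ler_wpM2l (doubling_ge0 n K0)); apply: (scale_le xB).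
  apply: (half_expn_le_powR K0); case/andP: hk => /lt_le_trans/(_ ttau) + _.
  rewrite (exprS lambda) -mulrA [ltRHS]mulrC ltr_pM2l//; exact: quarter_lt.
move=> j big; apply: (half_expn_le_powR K0).
have rj := radius_gt0 n K0 j h0.
have subj : eucl_ball x (lambda ^+ j * (1 / 2)) `<=` unit_ball.
  by apply: subset_trans subx; exact: sub_radius.
have := zero_boundary_far K0 phis phi_approx rj subj big Fy.
by rewrite eucl_normBC => /quarter_le; apply.
Qed.

Definition bound_cst : R := (1 + cover_cst R n * @doubling R n K) * scale_cst.

Lemma scale_cst_gt0 : 0 < scale_cst.
Proof.
have [mc _ _ _] := mean_cst_ge.
apply: (ltr_wpDl osc_cst_ge0).
exact: lt_le_trans ltr01 (le_trans init_cst_ge1 mc).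
Qed.

Lemma bound_cst_gt0 : 0 < bound_cst.
Proof.
apply: mulr_gt0 scale_cst_gt0; apply: ltr_wpDr => //.
exact: mulr_ge0 (cover_cst_ge0 R n) (doubling_ge0 n K0).
Qed.

Lemma ae_le_near_boundary tau : 0 < tau ->
  {ae leb R n, forall x, eucl_ball 0 (1 / 2) x ->
    (exists2 y, zero_boundary phi y & eucl_norm (x - y) < tau) ->
    eucl_norm (phi x) <= bound_cst * (1 + (4 * tau) `^ alpha * X)}.
Proof.
move=> tau0; have h0 : 0 < 1 / 2 :> R by exact: divr_gt0.
have l0 := ratio_gt0 n K0.
(* Proximity is expressed by a witness [y] instead of an infimum, so that [V] is open by the
   triangle inequality. *)
pose V := [set x | eucl_ball (0 : 'rV[R]_n) (1 / 2) x /\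
  exists2 y, zero_boundary phi y & eucl_norm (x - y) < tau].
set B := 1 + (4 * tau) `^ alpha * X.
pose A := @doubling R n K * (scale_cst * B) ^+ 2.
have A0 : 0 <= A by apply: (mulr_ge0 (doubling_ge0 n K0)); exact: sqr_ge0.
have oV : eucl_open V.
  move=> x [xB [y Fy xy]].
  have [e e0 eB] := @eucl_open_ball _ _ 0 (1 / 2) x xB.
  exists (Num.min e (tau - eucl_norm (x - y))); first by rewrite lt_min e0 subr_gt0.
  move=> w; rewrite /eucl_ball/= lt_min => /andP[we wt]; split; first exact: eB.
  exists y => //; apply: le_lt_trans (ler_eucl_distD x _ _) _.
  by rewrite eucl_normBC -ltrBrDr eucl_normBC.
have VB : V `<=` unit_ball.
  by move=> x [xB _]; apply: (half_ball_sub xB); rewrite /eucl_ball/= subrr eucl_norm0.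
have d0 : 0 < Num.min (1 / 2) (2 * tau * lambda) by rewrite lt_min h0/= !mulr_gt0.
have H x t : V x -> 0 < t < Num.min (1 / 2) (2 * tau * lambda) ->
    eucl_ball x t `<=` unit_ball /\ mean_sq phi x t 0 <= A.
  move=> [xB [y Fy xy]]; rewrite lt_min => /and3P[t0 /ltW t2 /ltW tl]; split.
    apply: subset_trans (half_ball_sub xB); apply: sub_eucl_ball.
    by rewrite subrr eucl_norm0 add0r.
  by apply: ball_mean_sq_le Fy xy _ tl => //; rewrite t0.
have sub1 : unit_ball `<=` unit_ball by [].
have := ae_sqr_dist_le phis ltr01 sub1 oV VB d0 A0 H.
apply: ae_mono => x h xB near; have := h (conj xB near); rewrite subr0 => {h} hA.
have B0 : 0 <= B by apply: addr_ge0 => //; apply: mulr_ge0 X0; exact: powR_ge0.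
have cd0 : 0 <= cover_cst R n * @doubling R n K.
  exact: mulr_ge0 (cover_cst_ge0 R n) (doubling_ge0 n K0).
apply: le_of_sqr; first exact: mulr_ge0 (ltW bound_cst_gt0) B0.
apply: le_trans hA _; rewrite /A mulrA /bound_cst -[in leRHS]mulrA [leRHS]exprMn.
by apply: ler_wpM2r; [exact: sqr_ge0|exact: sqr_1D_ge].
Qed.

End interior_bound.

(* At rho = 0 the right-hand side is 1, because 0 `^ alpha = 0. *)
Lemma rational_radius (R : realType) (alpha X rho : R) : 0 < alpha -> 0 <= X -> 0 <= rho ->
  exists q : rat, rho < ratr q /\
    (4 * ratr q) `^ alpha * X <= 1 + 8 `^ alpha * (rho `^ alpha * X).
Proof.
move=> a0 X0 rho0.
have mono (u v : R) : 0 <= u -> u <= v -> u `^ alpha <= v `^ alpha.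
  move=> u0 uv; apply: ge0_ler_powR; rewrite ?nnegrE ?(ltW a0)//.
  exact: le_trans uv.
have [rp|rn] := ltP 0 rho.
  have r2 : rho < 2 * rho by rewrite mulr_natl mulr2n ltrDl.
  (* A rational below [2 * rho] satisfies [4 * q <= 8 * rho], the origin of the factor 8. *)
  have [q] := rat_in_itvoo r2; rewrite in_itv/= => /andP[q1 q2]; exists q; split=> //.
  have q0 : 0 <= ratr q :> R by exact: le_trans (ltW q1).
  apply: ler_wpDl => //; rewrite mulrA; apply: (ler_wpM2r X0).
  rewrite -powRM//; apply: mono; first exact: mulr_ge0.
  have -> : 8 * rho = 4 * (2 * rho) by rewrite mulrA -natrM.
  by rewrite ler_pM2l// ltW.
have -> : rho = 0 by apply/le_anti; rewrite rn rho0.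
have X1 : 0 < X + 1 by rewrite ltr_wpDl.
(* With this [s], any [q] below [s / 4] makes the left-hand side at most [X / (X + 1)], hence at
   most 1. *)
pose s := ((X + 1)^-1) `^ alpha^-1.
have s0 : 0 < s / 4 by rewrite divr_gt0// powR_gt0// invr_gt0.
have [q] := rat_in_itvoo s0; rewrite in_itv/= => /andP[q1 q2]; exists q; split=> //.
rewrite powR0 ?gt_eqF// mul0r mulr0 addr0.
apply: (@le_trans _ _ ((X + 1)^-1 * X)); last first.
  by rewrite mulrC ler_pdivrMr// mul1r lerDl.
apply: (ler_wpM2r X0).
have -> : (X + 1)^-1 = s `^ alpha.
  by rewrite /s -powRrM mulVf ?gt_eqF// powRr1// invr_ge0 ltW.
apply: mono; first by rewrite mulr_ge0// ltW.
by rewrite mulrC -ler_pdivlMr// ltW.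
Qed.

(** * Distance to the boundary and conclusion *)

Lemma eucl_dist_ge0 (R : realType) (n : nat) (z : 'rV[R]_n) (F : set 'rV[R]_n) :
  F !=set0 -> 0 <= eucl_dist z F.
Proof.
move=> [y Fy]; apply: lb_le_inf; first by exists (eucl_norm (z - y)); exists y.
by move=> _ [w _ <-]; exact: eucl_norm_ge0.
Qed.

Lemma eucl_dist_lt (R : realType) (n : nat) (z : 'rV[R]_n) (F : set 'rV[R]_n) (t : R) :
  F !=set0 -> eucl_dist z F < t -> exists2 y, F y & eucl_norm (z - y) < t.
Proof.
move=> [y0 Fy0] /inf_lt[|_ [y Fy <-] yt]; last by exists y.
by exists (eucl_norm (z - y0)); exists y0.
Qed.

Lemma bound_arith (R : realFieldType) (b a u g : R) : 0 <= b -> 0 <= a -> 0 <= g ->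
  u <= 1 + a * g -> b * (1 + u) <= b * (2 + a) * (1 + g).
Proof.
move=> b0 a0 g0 ug; rewrite -mulrA; apply: (ler_wpM2l b0).
have -> : (2 + a) * (1 + g) = 2 + a + 2 * g + a * g by ring.
lra.
Qed.

Theorem theorem1 (R : realType) (K : R) (d : nat) (hK : 0 <= K)
    (hd : (1 <= d)%N) :
  exists C alpha : R, [/\ 0 < C, 0 < alpha &
    forall (p : nat) (phi : 'rV[R]_d -> 'rV[R]_p), (1 <= p)%N ->
      L2On (eucl_ball 0 1) phi ->
      zero_boundary phi `&` eucl_ball 0 1 !=set0 ->
      (forall (z : 'rV[R]_d) (r : R), 0 < r -> eucl_ball z r `<=` eucl_ball 0 1 ->
        exists psi : 'rV[R]_d -> 'rV[R]_p,
          [/\ L2On (eucl_ball z r) psi,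
              (\int[leb R d]_(x in eucl_ball z r)
                  (eucl_norm (phi x - psi x) ^+ 2)%:E <=
                leb R d (eucl_ball z r `&` [set x | phi x = 0%R]))%E &
              exists2 G : 'rV[R]_d -> 'M[R]_(p, d),
                weak_gradient (eucl_ball z (r / 2)) psi G &
                (r%:E * LnormOn +oo (eucl_ball z (r / 2)) G <=
                  (K * oscillation (eucl_ball z r) psi)%:E)%E]) ->
      {ae leb R d, forall z, eucl_ball 0 (1 / 2) z ->
        eucl_norm (phi z) <=
          C * (1 + eucl_dist z (zero_boundary phi) `^ alpha *
                   fine (LnormOn 2%:E (eucl_ball 0 1) phi))}].
Proof.
have a0 := exponent_gt0 d hK; have b0 := bound_cst_gt0 d hK.
have p0 : 0 <= 8 `^ exponent d K by exact: powR_ge0.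
exists (bound_cst d K * (2 + 8 `^ exponent d K)), (exponent d K); split=> //.
  by apply: mulr_gt0 => //; exact: ltr_wpDr.
move=> p phi _ phi2 [y0 [Fy0 _]] phi_approx.
set X := fine (LnormOn 2%:E (eucl_ball 0 1) phi).
have mB := measurable_eucl_ball (0 : 'rV[R]_d) 1.
have X0 : 0 <= X by exact: fine_LnormOn2_ge0.
have phis := L2On_sq_integrable mB phi2.
have phi_le : \int[leb R d]_(x in eucl_ball 0 1) eucl_norm (phi x) ^+ 2 <= X ^+ 2.
  by rewrite /X fine_LnormOn2.
(* One null set for each rational radius, so that the radius can be chosen after the point. *)
have near (q : rat) : {ae leb R d, forall x, 0 < ratr q :> R -> eucl_ball 0 (1 / 2) x ->
    (exists2 y, zero_boundary phi y & eucl_norm (x - y) < ratr q) ->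
    eucl_norm (phi x) <= bound_cst d K * (1 + (4 * ratr q) `^ exponent d K * X)}.
  have [q0|q0] := ltP 0 (ratr q : R); last first.
    by apply: aeW.
  by apply: ae_mono (ae_le_near_boundary hK X0 phis phi_approx phi_le q0) => x h _.
apply: ae_mono (ae_countable near) => x h xB.
have F0 : zero_boundary phi !=set0 by exists y0.
have rho0 := eucl_dist_ge0 x F0.
have [q [rq qX]] := rational_radius a0 X0 rho0.
apply: le_trans (h q (le_lt_trans rho0 rq) xB (eucl_dist_lt F0 rq)) _.
by apply: bound_arith (ltW b0) p0 _ qX; apply: mulr_ge0 X0; exact: powR_ge0.
Qed.
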